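(* Let $\psi$ be a symmetric cone obstacle, i.e. there are $h>0$ and $s\in(0,\frac12)$ such that $$\psi(x)=\begin{cases}\frac{h}{\frac12-s}(x-s) & 0\le x\le \frac12,\\ \frac{h}{\frac12-s}(1-s-x) & \frac12\le x\le 1.\end{cases}$$ Let $$G_\psi=\{u\in W^{2,2}(0,1)\;:\;u(0)=u(1)=0,\ u(x)\ge\psi(x)\ \forall x\in[0,1]\},\qquad \mathcal{E}(u)=\int_0^1\frac{u''(x)^2}{(1+u'(x)^2)^{5/2}}\,dx .$$ If $$\sup_{x\in(0,1)}\psi(x)>\sup_{A>0}\ \frac13 A\,\frac{\mathit{HYP2F1}(1,\frac32;\frac74,-A^2)}{\mathit{HYP2F1}(\frac12,1;\frac34,-A^2)}\qquad[\simeq 0.834626],$$ then $\inf_{u\in G_\psi}\mathcal{E}(u)$ is not attained, i.e. there is no $u\in G_\psi$ with $\mathcal{E}(u)=\inf_{w\in G_\psi}\mathcal{E}(w)$.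
   Context: $\mathit{HYP2F1}(a,b;c,z)$ is the (Gauss) hypergeometric function: the analytic continuation (to $\mathbb{C}\setminus[1,\infty)$) of $z\mapsto\sum_{n=0}^\infty \frac{(a)_n(b)_n}{(c)_n}\frac{z^n}{n!}$, $|z|<1$, where $(a)_n=\frac{\Gamma(a+n)}{\Gamma(a)}$. The bracketed decimal is only a numerical approximation of the supremum on the right-hand side. *)

(* Defs.v *)
From mathcomp Require Import all_boot all_order all_algebra.
From mathcomp Require Import all_classical all_reals all_analysis.
From mathcomp Require Import complex.

Set Implicit Arguments.
Unset Strict Implicit.
Unset Printing Implicit Defensive.

Import Order.TTheory GRing.Theory Num.Theory.
Import numFieldNormedType.Exports.

Local Open Scope classical_set_scope.
Local Open Scope complex_scope.
Local Open Scope ring_scope.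

Section Hypergeometric.
Context {R : realType}.

(* Euler's integral; it is the Gamma function for a > 0 only, which covers
   the parameters used here. *)
Definition Gamma (a : R) : R :=
  \int[@lebesgue_measure R]_(t in `]0, +oo[) (t `^ (a - 1) * expR (- t)).

Definition pochhammer (a : R) (n : nat) : R := Gamma (a + n%:R) / Gamma a.

Definition hyp2f1_coef (a b c : R) (n : nat) : R :=
  pochhammer a n * pochhammer b n / pochhammer c n / n`!%:R.

(* Convergence is that of the topology given by the complex modulus. *)
Definition has_power_series_sum (c : nat -> R[i]) (z l : R[i]) : Prop :=
  series (fun n => c n * z ^+ n : R[i]^o) @ \oo --> (l : R[i]^o).

Definition analytic_on (D : set R[i]) (F : R[i] -> R[i]) : Prop :=
  forall z0, D z0 -> exists r : R, 0 < r /\ exists c : nat -> R[i],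
    forall z : R[i], `|z - z0| < r%:C -> has_power_series_sum c (z - z0) (F z).

Definition slit_plane : set R[i] :=
  ~` [set z | exists x : R, 1 <= x /\ z = x%:C].

Definition is_hyp2f1 (a b c : R) (F : R[i] -> R[i]) : Prop :=
  analytic_on slit_plane F /\
  forall z : R[i], `|z| < 1 ->
    has_power_series_sum (fun n => (hyp2f1_coef a b c n)%:C) z (F z).

(* The continuation is unique on the slit plane, so that the choice made by
   xget only affects the irrelevant values on [1, +oo[. *)
Definition HYP2F1 (a b c : R) (z : R[i]) : R[i] :=
  xget (fun=> 0) [set F | is_hyp2f1 a b c F] z.

End Hypergeometric.

Section Sobolev.
Context {R : realType}.
Local Notation mu := (@lebesgue_measure R).

(* Functions on (0,1) are represented by functions on R whose values outside
   the interval are ignored. *)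
Definition L2 (f : R -> R) : Prop := f \_ `]0, 1[ \in Lfun mu 2%:E.

(* C_c^oo(0,1): a closed subset of R contained in (0,1) is compact. *)
Definition test_function (phi : R -> R) : Prop :=
  (forall (n : nat) (x : R), derivable (phi^`(n))%classic x 1) /\
  closure [set x | phi x != 0] `<=` `]0, 1[.

Definition is_weak_derivative (k : nat) (u v : R -> R) : Prop :=
  forall phi, test_function phi ->
    \int[mu]_(x in `]0, 1[) (u x * (phi^`(k))%classic x) =
    (-1) ^+ k * \int[mu]_(x in `]0, 1[) (v x * phi x).

Definition W22 (u : R -> R) : Prop :=
  L2 u /\
  forall k, (1 <= k <= 2)%N -> exists2 v, L2 v & is_weak_derivative k u v.

(* Well defined up to equality almost everywhere on (0,1). *)
Definition weak_derivative (k : nat) (u : R -> R) : R -> R :=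
  xget (fun=> 0) [set v | L2 v /\ is_weak_derivative k u v].

Definition energy (u : R -> R) : \bar R :=
  (\int[mu]_(x in `]0%R, 1%R[)
     (weak_derivative 2 u x ^+ 2
       / (1 + weak_derivative 1 u x ^+ 2) `^ (5 / 2))%:E)%E.

Definition symmetric_cone (psi : R -> R) : Prop :=
  exists h s : R, [/\ 0 < h, 0 < s < 1 / 2,
    forall x : R, 0 <= x <= 1 / 2 -> psi x = h / (1 / 2 - s) * (x - s) &
    forall x : R, 1 / 2 <= x <= 1 -> psi x = h / (1 / 2 - s) * (1 - s - x)].

(* The pointwise conditions refer to the representative of the class of u
   that is continuous on [0,1]. *)
Definition admissible (psi : R -> R) : set (R -> R) :=
  [set u | [/\ W22 u, {within `[0, 1], continuous u}, u 0 = 0, u 1 = 0 &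
    forall x : R, 0 <= x <= 1 -> psi x <= u x]].

End Sobolev.

(* Main.v *)
(* With g(t) = (1 + t^2)^(-5/4) the energy is the integral of u''^2 g(u')^2;
   let c be the integral of g over the real line. The hypergeometric quotient
   at A is a ratio of Stieltjes integrals over v > 0 in the variable
   v^2/(1 + v^2); it tends to 2/c as A tends to infinity, so that the height h
   of the cone exceeds 2/c.

   Lower bound: an admissible u has an interior maximum H >= h at m. Let P be
   the maximum of u' on [0,m] and Q that of -u' on [m,1]. Completing the square
   in (u'' g(u') + c sqrt(1 - u'/P))^2 between a point where u' = P and m, and
   symmetrically on the right, gives
     E(u) >= c^2 + (1/P + 1/Q) c (c H - 2) > c^2,
   because the integral of sqrt(1 - t/P) g(t) over [0,P] is at least c/2 - 1/P.

   On the other hand the infimum is at most c^2: for kap < 1/c and a suitable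
   eta > 0, the function w with w' = Y^-1(1/2 - x), where
   Y(t) = kap * int_0^t g + eta * t, is symmetric, concave and of height at
   least h, and E(w) <= 1/kap^2 since |w''| = 1/(kap g(w') + eta). *)

Require Import Defs.
From mathcomp Require Import all_boot all_order all_algebra.
From mathcomp Require Import all_classical all_reals all_analysis.
From mathcomp Require Import complex.
From mathcomp Require Import measurable_realfun ring lra.

Set Implicit Arguments.
Unset Strict Implicit.
Unset Printing Implicit Defensive.

Import Order.TTheory GRing.Theory Num.Theory.
Import numFieldNormedType.Exports.
Import ComplexField.Normc.

Local Open Scope classical_set_scope.
Local Open Scope complex_scope.
Local Open Scope ring_scope.

(** * Calculus in pointwise form *)

Section PointwiseRules.
Context {R : realType}.
Implicit Types (f g : R -> R) (x a b : R).

(** With V = u' the energy is the integral of (V' g(V))^2 and the height is the integral of V over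
    [0,m]. Extremals under a constraint on that integral satisfy a first integral (V' g(V))^2 = c^2
    (1 - V/P), hence the square that is completed. The gain (1/P + 1/Q) c (c H - 2) tends to 0 only
    if P and Q both tend to infinity: c^2 is approached by functions with unbounded slopes on both
    sides. In the competitor eta > 0 keeps the slope finite, and its size is fixed by the height to
    be reached.

    Two obstacles come from the definitions. The hypergeometric functions are continuations picked
    by choice and evaluated outside the unit disc; they are identified with Stieltjes transforms by
    comparing Taylor coefficients with moments, and by an identity theorem along the negative ray.
    The weak derivatives are representatives picked by choice; a second-order du Bois-Reymond lemma
    shows that an admissible u is a double integral of its second weak derivative, so that a chain
    rule for absolutely continuous functions applies to u'. *)

Lemma is_derive_congr f x a b : is_derive x 1 f a -> a = b -> is_derive x 1 f b.
Proof. by move=> h <-. Qed.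

Lemma is_derive_cstf c x : is_derive x 1 (fun _ : R => c) (0 : R).
Proof. exact: is_derive_cst. Qed.

Lemma is_derive_idf x : is_derive x 1 (fun y : R => y) (1 : R).
Proof. exact: is_derive_id. Qed.

Lemma is_derive_addf f g x a b : is_derive x 1 f a -> is_derive x 1 g b ->
  is_derive x 1 (fun y => f y + g y) (a + b).
Proof. exact: is_deriveD. Qed.

Lemma is_derive_subf f g x a b : is_derive x 1 f a -> is_derive x 1 g b ->
  is_derive x 1 (fun y => f y - g y) (a - b).
Proof. exact: is_deriveB. Qed.

Lemma is_derive_oppf f x a : is_derive x 1 f a ->
  is_derive x 1 (fun y => - f y) (- a).
Proof. exact: is_deriveN. Qed.

Lemma is_derive_mulf f g x a b : is_derive x 1 f a -> is_derive x 1 g b ->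
  is_derive x 1 (fun y => f y * g y) (a * g x + f x * b).
Proof.
move=> df dg; apply: is_derive_congr (is_deriveM df dg) _.
by rewrite /GRing.scale/= addrC mulrC.
Qed.

Lemma is_derive_scalef c f x a : is_derive x 1 f a ->
  is_derive x 1 (fun y => c * f y) (c * a).
Proof. exact: is_deriveZ. Qed.

Lemma is_derive_compf f g x a b : is_derive (g x) 1 f a -> is_derive x 1 g b ->
  is_derive x 1 (fun y => f (g y)) (a * b).
Proof. move=> df dg; exact: (@is_derive1_comp R f g x a b). Qed.

Lemma is_derive_expf f n x a : is_derive x 1 f a ->
  is_derive x 1 (fun y => f y ^+ n) (n%:R * f x ^+ n.-1 * a).
Proof.
move=> df; elim: n => [|n ih].
  by apply: is_derive_congr (is_derive_cstf 1 x) _; rewrite !mul0r.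
under eq_fun do rewrite exprS.
apply: is_derive_congr (is_derive_mulf df ih) _.
case: n {ih} => [|n]; first by rewrite expr0; ring.
by rewrite /= exprS [in RHS]mulrS; ring.
Qed.

Lemma is_derive_invf f x a : f x != 0 -> is_derive x 1 f a ->
  is_derive x 1 (fun y => (f y)^-1) (- (a / f x ^+ 2)).
Proof.
move=> f0 df; apply: is_derive_congr (is_deriveV f0 df) _.
by rewrite /GRing.scale/= mulNr mulrC.
Qed.

Lemma is_derive_continuous f df x : is_derive x 1 f df -> {for x, continuous f}.
Proof.
move=> [fd _]; apply: differentiable_continuous; exact/derivable1_diffP.
Qed.

Lemma continuous_cstf c : continuous (fun _ : R => c : R).
Proof. exact: cst_continuous. Qed.

Lemma continuous_idf : continuous (fun y : R => y : R).
Proof. by move=> x; exact: cvg_id. Qed.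

Lemma continuous_addf f g : continuous f -> continuous g ->
  continuous (fun y => f y + g y).
Proof. by move=> cf cg x; exact: cvgD (cf x) (cg x). Qed.

Lemma continuous_subf f g : continuous f -> continuous g ->
  continuous (fun y => f y - g y).
Proof. by move=> cf cg x; exact: cvgB (cf x) (cg x). Qed.

Lemma continuous_oppf f : continuous f -> continuous (fun y => - f y).
Proof. by move=> cf x; exact: cvgN (cf x). Qed.

Lemma continuous_mulf f g : continuous f -> continuous g ->
  continuous (fun y => f y * g y).
Proof. by move=> cf cg x; exact: cvgM (cf x) (cg x). Qed.

Lemma continuous_compf f g : continuous f -> continuous g ->
  continuous (fun y => f (g y)).
Proof. by move=> cf cg x; exact: continuous_comp (cg x) (cf (g x)). Qed.

Lemma continuous_expf f n : continuous f -> continuous (fun y => f y ^+ n).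
Proof. by move=> cf; exact: @continuous_compf (fun y => y ^+ n) f (@exprn_continuous R n) cf. Qed.

Lemma continuous_invf f : continuous f -> (forall y, f y != 0) ->
  continuous (fun y => (f y)^-1).
Proof. by move=> cf f0 x; exact: cvgV (f0 x) (cf x). Qed.

End PointwiseRules.
Arguments is_derive_compf {R} f g {x a b}.
Arguments is_derive_invf {R} f {x a}.
Arguments continuous_compf {R} f g.
Arguments continuous_cstf {R} c.

Lemma near_ge_natS {R : realType} (t : R) : \forall n \near \oo, t <= n.+1%:R.
Proof.
exists (Num.truncn t) => // n /= tn.
by apply/ltW/(lt_le_trans (truncnS_gt _)); rewrite ler_nat ltnS.
Qed.

Section Calculus.
Context {R : realType}.
Local Notation mu := (@lebesgue_measure R).
Implicit Types (f g F G : R -> R) (a b x y : R).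

(** The derivative is assumed in the open interval only, because the one of [N] in the key
    inequality is computed below [A], where the square root in it is differentiable. *)
Lemma derive_ge0_le (f df : R -> R) a b : a <= b ->
  {within `[a, b], continuous f} ->
  (forall x, a < x < b -> is_derive x 1 f (df x)) ->
  (forall x, a < x < b -> 0 <= df x) -> f a <= f b.
Proof.
rewrite le_eqVlt => /predU1P[->//|ab] cf fd d0.
have fd' x : x \in `]a, b[ -> is_derive x 1 f (df x) by rewrite in_itv/=; exact: fd.
have [c] := MVT ab fd' cf; rewrite in_itv/= => cab e; rewrite -subr_ge0 e mulr_ge0 ?d0// subr_ge0 ltW//.
Qed.

Lemma continuous_integrable_itv f a b : continuous f ->
  mu.-integrable `[a, b] (EFin \o f).
Proof.
move=> cf; apply: continuous_compact_integrable; first exact: segment_compact.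
exact: continuous_subspaceT.
Qed.

Lemma integrable_addf (D : set (measurableTypeR R)) f g : measurable D ->
  mu.-integrable D (EFin \o f) -> mu.-integrable D (EFin \o g) ->
  mu.-integrable D (EFin \o (fun x => f x + g x)).
Proof. by move=> mD intf intg; exact: (integrableD mD intf intg). Qed.

Lemma integrable_subf (D : set (measurableTypeR R)) f g : measurable D ->
  mu.-integrable D (EFin \o f) -> mu.-integrable D (EFin \o g) ->
  mu.-integrable D (EFin \o (fun x => f x - g x)).
Proof. by move=> mD intf intg; exact: (integrableB mD intf intg). Qed.

Lemma integrable_scalef (D : set (measurableTypeR R)) k f : measurable D ->
  mu.-integrable D (EFin \o f) ->
  mu.-integrable D (EFin \o (fun x => k * f x)).
Proof. by move=> mD intf; exact: (integrableZl mD k intf). Qed.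

Lemma integrable_mulf (D : set (measurableTypeR R)) (M : R) (f g : measurableTypeR R -> R) : measurable D ->
  measurable_fun D f -> (forall x, D x -> `|f x| <= M) ->
  mu.-integrable D (EFin \o g) ->
  mu.-integrable D (EFin \o (fun x => f x * g x)).
Proof.
move=> mD mf fM intg.
apply: (@integrableMr _ _ _ _ _ mD f (EFin \o g) mf _ intg).
exists M; split; first exact: num_real.
by move=> N MN x Dx; apply: le_trans (fM x Dx) (ltW MN).
Qed.

Lemma le_integrable_f (D : set (measurableTypeR R)) (f g : measurableTypeR R -> R) : measurable D ->
  measurable_fun D f -> (forall x, D x -> `|f x| <= g x) ->
  mu.-integrable D (EFin \o g) -> mu.-integrable D (EFin \o f).
Proof.
move=> mD mf fg intg; apply: le_integrable intg => //; first exact/measurable_EFinP.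
by move=> x Dx /=; rewrite lee_fin (le_trans (fg x Dx))// ler_norm.
Qed.

Lemma measurable_continuous (D : set (measurableTypeR R)) f : continuous f ->
  measurable_fun D f.
Proof. by move=> cf; apply: measurable_funTS; exact: continuous_measurable_fun. Qed.

Lemma measurable_EFin_continuous (D : set (measurableTypeR R)) f :
  continuous f -> measurable_fun D (fun x => (f x)%:E).
Proof. by move=> cf; apply/measurable_EFinP; exact: measurable_continuous. Qed.

Lemma measurable_itvR (i : interval R) :
  measurable ([set` i] : set (measurableTypeR R)).
Proof. exact: measurable_itv. Qed.

Lemma RintegralZf (D : set (measurableTypeR R)) k f : measurable D ->
  mu.-integrable D (EFin \o f) ->
  \int[mu]_(x in D) (k * f x) = k * \int[mu]_(x in D) f x.
Proof. by move=> mD intf; rewrite RintegralZl. Qed.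

Lemma EFin_Rintegral (D : set (measurableTypeR R)) f : measurable D ->
  mu.-integrable D (EFin \o f) ->
  (\int[mu]_(x in D) f x)%:E = (\int[mu]_(x in D) (f x)%:E)%E.
Proof. by move=> mD intf; rewrite /Rintegral fineK//; exact: integrable_fin_num. Qed.

Lemma ge0_integralZf (D : set (measurableTypeR R)) k f : measurable D -> 0 <= k ->
  continuous f -> (forall x, D x -> 0 <= f x) ->
  (\int[mu]_(x in D) (k * f x)%:E = k%:E * \int[mu]_(x in D) (f x)%:E)%E.
Proof.
move=> mD k0 cf f0; by rewrite -ge0_integralZl//; exact: measurable_EFin_continuous.
Qed.

Lemma Rintegral_FTC2 (f F : R -> R) a b : a <= b -> continuous f ->
  (forall x, is_derive x 1 F (f x)) ->
  \int[mu]_(x in `[a, b]) f x = F b - F a.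
Proof.
rewrite le_eqVlt => /predU1P[->|ab] cf dF.
  by rewrite set_itv1 Rintegral_set1 subrr.
rewrite /Rintegral (@continuous_FTC2 _ f F)//.
- exact: continuous_subspaceT.
- split.
  + by move=> x _; have [] := dF x.
  + by apply: cvg_at_right_filter; apply: is_derive_continuous (dF a).
  + by apply: cvg_at_left_filter; apply: is_derive_continuous (dF b).
- by move=> x _; rewrite derive1E; have [_ ->] := dF x.
Qed.

Lemma Rintegral_split f a b c : a <= b -> b <= c ->
  mu.-integrable `[a, c] (EFin \o f) ->
  \int[mu]_(x in `[a, c]) f x =
  \int[mu]_(x in `[a, b]) f x + \int[mu]_(x in `[b, c]) f x.
Proof.
move=> ab bc intf.
apply/eqP; rewrite addrC -subr_eq; apply/eqP.
rewrite Rintegral_itvB// Rintegral_itv_obnd_cbnd//.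
by apply: integrableS intf => //; apply: subset_itvr; rewrite bnd_simp.
Qed.

Lemma continuous_primitive f : continuous f ->
  exists F, F 0 = 0 /\ forall x, is_derive x 1 F (f x).
Proof.
move=> cf.
pose F x := \int[mu]_(t in `[0, x]) f t - \int[mu]_(t in `[x, 0]) f t.
exists F; split.
  by rewrite /F subrr.
(* A base point to the left of both [x] and 0: near [x] the oriented integral [F] is the integral
   from [c] minus a constant, whatever the sign of [x]. *)
move=> x; pose c := Num.min x 0 - 1.
have cx : c < x by rewrite /c ltrBlDr; case: (lerP x 0); lra.
have c0 : c < 0 by rewrite /c ltrBlDr; case: (lerP x 0); lra.
pose H y := \int[mu]_(t in `[c, y]) f t.
have [Hd HE] : derivable H x 1 /\ derive1 H x = f x.
  apply: (@continuous_FTC1_closed _ f c x (x + 1)) => //.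
  - by rewrite ltrDl.
  - exact: continuous_integrable_itv.
  - exact: cf.
have FE y : c < y -> F y = H y - H 0.
  move=> cy; rewrite /F /H; have [y0|y0] := leP 0 y.
    rewrite (@Rintegral_split f c 0 y)//; [|exact: ltW|exact: continuous_integrable_itv].
    rewrite [X in _ = X - _]addrC addrK.
    move: y0; rewrite le_eqVlt => /predU1P[<-|y0].
      by rewrite set_itv1 Rintegral_set1 subr0.
    by rewrite (_ : `[y, 0]%classic = set0) ?Rintegral_set0 ?subr0// set_itv_ge// -ltNge.
  rewrite (@Rintegral_split f c y 0) ?ltW//; last exact: continuous_integrable_itv.
  rewrite (_ : `[0, y]%classic = set0) ?Rintegral_set0; last by rewrite set_itv_ge// -ltNge.
  by rewrite sub0r opprD addNKr.
have near_FE : \forall y \near x, H y - H 0 = F y.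
  by near=> y; rewrite FE//; near: y; exact: lt_nbhsr.
apply: (near_eq_is_derive near_FE).
have dH := DeriveDef Hd (etrans (esym (derive1E H x)) HE).
have := is_derive_subf dH (is_derive_cstf (H 0) x).
by move=> /is_derive_congr; apply; rewrite subr0.
Unshelve. all: by end_near. Qed.

End Calculus.

(** * The weight and the key inequality *)

Section ArcWeight.
Context {R : realType}.
Implicit Types (a t A T : R).

Definition pw a t : R := (1 + t ^+ 2) `^ a.

Lemma sq1_gt0 t : 0 < 1 + t ^+ 2.
Proof. by rewrite ltr_wpDr// sqr_ge0. Qed.

Lemma pw_gt0 a t : 0 < pw a t.
Proof. exact/powR_gt0/sq1_gt0. Qed.

Lemma sq1_ge0 t : 0 <= 1 + t ^+ 2.
Proof. exact/ltW/sq1_gt0. Qed.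

Lemma pw_ge0 a t : 0 <= pw a t.
Proof. exact/ltW/pw_gt0. Qed.

Lemma pw0 a : pw a 0 = 1.
Proof. by rewrite /pw expr0n/= addr0 powR1. Qed.

Lemma pw_mul a b t : pw a t * pw b t = pw (a + b) t.
Proof. by rewrite /pw powRD// (gt_eqF (sq1_gt0 t)) implybT. Qed.

Lemma pwS a t : pw (a + 1) t = pw a t * (1 + t ^+ 2).
Proof. by rewrite -pw_mul [in X in _ * X]/pw powRr1// ltW// sq1_gt0. Qed.

Lemma pw_le1 a t : a <= 0 -> pw a t <= 1.
Proof.
move=> a0; rewrite -(powRr0 (1 + t ^+ 2)) /pw ler_powR//.
by rewrite lerDl sqr_ge0.
Qed.

Lemma pwN a t : pw a (- t) = pw a t.
Proof. by rewrite /pw sqrrN. Qed.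

Lemma is_derive_pw a t :
  is_derive t 1 (pw a) (2 * a * t * pw (a - 1) t).
Proof.
have d1 := is_derive_addf (is_derive_cstf 1 t) (is_derive_expf 2 (is_derive_idf t)).
have := is_derive_compf (fun s => s `^ a) (fun t => 1 + t ^+ 2)
  (is_derive1_powR a (sq1_gt0 t)) d1.
by move=> /is_derive_congr; apply; rewrite /pw /=; ring.
Qed.

Lemma continuous_pw a : continuous (pw a).
Proof. by move=> t; apply: is_derive_continuous (is_derive_pw a t). Qed.

Definition gw t := pw (- (5 / 4)) t.

Lemma gw_gt0 t : 0 < gw t. Proof. exact: pw_gt0. Qed.

Lemma gw_ge0 t : 0 <= gw t. Proof. exact: pw_ge0. Qed.

Lemma continuous_gw : continuous gw. Proof. exact: continuous_pw. Qed.

Lemma is_derive_gw t : is_derive t 1 gw (- (5 / 2) * t * pw (- (9 / 4)) t).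
Proof.
apply: is_derive_eq (is_derive_pw _ _) _; rewrite (_ : _ - 1 = - (9 / 4)); last lra.
by field.
Qed.

(** This bounds the derivative g - (5/2) t^2 (1 + t^2)^(-9/4) of t g(t) from below by -(3/2) g. *)
Lemma sqr_pw94_le t : t ^+ 2 * pw (- (9 / 4)) t <= gw t.
Proof.
rewrite /gw (_ : - (5 / 4) = - (9 / 4) + 1); last lra.
rewrite pwS mulrC ler_pM2l ?pw_gt0//; lra.
Qed.

Section KeyInequality.
Variables (A : R) (G K : R -> R).
Hypothesis A0 : 0 < A.
Hypotheses (dG : forall t, is_derive t 1 G (gw t))
  (dK : forall t, is_derive t 1 K (Num.sqrt (1 - t / A) * gw t))
  (G0 : G 0 = 0) (K0 : K 0 = 0).

(** The primitive of 1 - sqrt(1 - s) vanishing at 0. With r = sqrt(1 - s) it satisfies r - 1 + s/2 +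
    (1 - r) s = (3/2) M(s), so that the lower bound for the derivative of [N] obtained from
    [sqr_pw94_le] is exactly 0. *)
Let M (s : R) : R := 2 / 3 * ((1 - s) * Num.sqrt (1 - s)) - 2 / 3 + s.

(* [N] is nondecreasing on [0,A]; beyond [A] its counterpart is the function
   [B] in the proof of [key_inequality]. *)
Let N t := K t - G t + A^-1 * (1 - pw (- (1 / 4)) t) + M (t / A) * (t * gw t).

Let M_ge0 (s : R) : s <= 1 -> 0 <= M s.
Proof.
move=> s1; rewrite /M; set r := Num.sqrt _.
have r0 : 0 <= r by exact: sqrtr_ge0.
have e : 1 - s = r ^+ 2 by rewrite sqr_sqrtr// subr_ge0.
have -> : s = 1 - r ^+ 2 by rewrite -e; ring.
rewrite (_ : _ + _ = 1 / 3 * ((1 - r) ^+ 2 * (1 + 2 * r))); last by field.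
apply: mulr_ge0; first lra.
by apply: mulr_ge0; [exact: sqr_ge0|lra].
Qed.

Let dM (s : R) : s < 1 -> is_derive s 1 M (1 - Num.sqrt (1 - s)).
Proof.
move=> s1; have s0 : 0 < 1 - s by rewrite subr_gt0.
have d1 := is_derive_subf (is_derive_cstf 1 s) (is_derive_idf s).
have d2 := is_derive_compf _ (fun s => 1 - s) (is_derive1_sqrt s0) d1.
have d3 := is_derive_scalef (2 / 3) (is_derive_mulf d1 d2).
have := is_derive_addf (is_derive_subf d3 (is_derive_cstf (2 / 3) s)) (is_derive_idf s).
move=> /is_derive_congr; apply.
have r0 : Num.sqrt (1 - s) != 0 by rewrite gt_eqF// sqrtr_gt0.
have e : 1 - s = Num.sqrt (1 - s) ^+ 2 by rewrite sqr_sqrtr// ltW.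
set r := Num.sqrt _ in r0 e *.
rewrite e; field.
exact: r0.
Qed.

(** The term (1 - (1 + t^2)^(-1/4))/A is the integral of s g(s) over [0,t] divided by 2A; its limit
    1/A is the loss on the left-hand side. In [B] the square root is replaced by 0 and K by nothing,
    so that N(A) = K(A) + B(A); from N(A) >= 0 and B(A) <= B(T) one gets K(A) >= - B(T). As for [N],
    the bound on (t g)' makes the derivative of [B] nonnegative with exact cancellation. *)
Lemma key_inequality T : A <= T -> G T - A^-1 <= K A.
Proof.
move=> AT.
have contM : continuous M.
  apply: continuous_addf; last exact: continuous_idf.
  apply: continuous_subf; last exact: continuous_cstf.
  apply: continuous_mulf; first exact: continuous_cstf.
  have c1 := continuous_subf (continuous_cstf 1) (continuous_idf (R := R)).
  by apply: continuous_mulf => //; exact: continuous_compf _ (fun s => 1 - s) (@sqrt_continuous R) c1.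
have contN : continuous N.
  apply: continuous_addf; last apply: continuous_mulf.
  - apply: continuous_addf; last first.
      apply: continuous_mulf; first exact: continuous_cstf.
      by apply: continuous_subf; [exact: continuous_cstf|exact: continuous_pw].
    by apply: continuous_subf => t; [exact: is_derive_continuous (dK t)|exact: is_derive_continuous (dG t)].
  - apply: (continuous_compf M (fun t => t / A)) => //.
    by apply: continuous_mulf; [exact: continuous_idf|exact: continuous_cstf].
  - by apply: continuous_mulf; [exact: continuous_idf|exact: continuous_gw].
have N0 : 0 <= N A.
  have <- : N 0 = 0.
    by rewrite /N K0 G0 pw0; ring.
  pose dN t := Num.sqrt (1 - t / A) * gw t - gw t
    + A^-1 * (- (2 * (- (1 / 4)) * t * gw t))
    + ((1 - Num.sqrt (1 - t / A)) / A * (t * gw t) +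
       M (t / A) * (gw t + t * (- (5 / 2) * t * pw (- (9 / 4)) t))).
  apply: (@derive_ge0_le _ N dN); first exact: ltW.
  - exact: continuous_subspaceT.
  - move=> t /andP[t0 tA]; rewrite /N.
    have tA1 : t / A < 1 by rewrite ltr_pdivrMr// mul1r.
    have d1 := is_derive_mulf (is_derive_idf t) (is_derive_cstf A^-1 t).
    have d2 := is_derive_compf M (fun t => t / A) (dM tA1) d1.
    have d3 := is_derive_gw t.
    have d4 := is_derive_pw (- (1 / 4)) t.
    have d5 := is_derive_mulf d2 (is_derive_mulf (is_derive_idf t) d3).
    have d6 := is_derive_scalef A^-1 (is_derive_subf (is_derive_cstf 1 t) d4).
    have := is_derive_addf (is_derive_addf (is_derive_subf (dK t) (dG t)) d6) d5.
    move=> /is_derive_congr; apply.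
    rewrite /dN.
    rewrite (_ : - (1 / 4) - 1 = - (5 / 4)); last lra.
    rewrite -/(gw t); ring.
  - move=> t /andP[t0 tA]; rewrite /dN.
    have M0 : 0 <= M (t / A) by apply: M_ge0; rewrite ler_pdivrMr// mul1r ltW.
    have := ler_wpM2l M0 (sqr_pw94_le t).
    move: M0; rewrite /M.
    set r := Num.sqrt _; set g := gw t; set p := pw _ t; nra.
pose B t := A^-1 * (1 - pw (- (1 / 4)) t) - G t + (t / A - 2 / 3) * (t * gw t).
have BAT : B A <= B T.
  pose dB t := A^-1 * (- (2 * (- (1 / 4)) * t * gw t)) - gw t +
    (A^-1 * (t * gw t) +
     (t / A - 2 / 3) * (gw t + t * (- (5 / 2) * t * pw (- (9 / 4)) t))).
  have dBt t : is_derive t 1 B (dB t).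
    have d1 := is_derive_subf (is_derive_mulf (is_derive_idf t) (is_derive_cstf A^-1 t))
      (is_derive_cstf (2 / 3) t).
    have d3 := is_derive_gw t.
    have d4 := is_derive_pw (- (1 / 4)) t.
    have d5 := is_derive_mulf d1 (is_derive_mulf (is_derive_idf t) d3).
    have d6 := is_derive_scalef A^-1 (is_derive_subf (is_derive_cstf 1 t) d4).
    have := is_derive_addf (is_derive_subf d6 (dG t)) d5.
    move=> /is_derive_congr; apply.
    rewrite /dB.
    rewrite (_ : - (1 / 4) - 1 = - (5 / 4)); last lra.
    rewrite -/(gw t); ring.
  apply: (@derive_ge0_le _ B dB) => //.
    by apply: continuous_subspaceT => t; apply: is_derive_continuous (dBt t).
  move=> t /andP[At tT]; rewrite /dB.
  have tA : 0 <= t / A - 2 / 3.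
    have : 1 <= t / A by rewrite ler_pdivlMr// mul1r ltW.
    lra.
  have := ler_wpM2l tA (sqr_pw94_le t).
  set g := gw t; set p := pw _ t; nra.
(* The factor t/A - 2/3 of [B] is also 1/3 at t = A, so that [N] and [B] match there. *)
have M1 : M (A / A) = 1 / 3.
  by rewrite /M divff ?gt_eqF// subrr mul0r mulr0; lra.
(* After this substitution what remains to be seen is g(T)/A + (2/3) T g(T) >= 0. *)
have T2 : pw (- (1 / 4)) T = gw T * (1 + T ^+ 2).
  by rewrite -pwS; congr pw; lra.
have AV : 0 < A^-1 by rewrite invr_gt0.
have T0 : 0 < T by exact: lt_le_trans AT.
have p1 : 0 <= T * gw T by rewrite mulr_ge0 ?ltW ?gw_gt0.
have p2 : 0 <= A^-1 * gw T by rewrite mulr_ge0 ?ltW ?gw_gt0.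
move: N0 BAT; rewrite /N /B M1 divff ?gt_eqF// T2.
set g := gw T in p1 p2 *; set g' := gw A.
set B1 := A^-1 * (1 - _ A); set a := A^-1 in p2 *; rewrite -/a in AV.
nra.
Qed.

End KeyInequality.
End ArcWeight.

(** * Integrals over the half-line *)

Section HalfLine.
Context {R : realType}.
Local Notation mu := (@lebesgue_measure R).
Implicit Types (f h F H : R -> R).

(** Compact intervals exhausting the open half-line: they stay away from 0, where the integrand of
    Gamma may be singular. *)
Let Fn (n : nat) : set R := `[n.+1%:R^-1, n.+1%:R].

Let ndFn : nondecreasing_seq Fn.
Proof.
move=> m n mn; rewrite subsetEset => x; rewrite /Fn/= !in_itv/= => /andP[h1 h2].
apply/andP; split; [apply: le_trans h1|apply: (le_trans h2)].
  by rewrite lef_pV2 ?posrE// ler_nat ltnS.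
by rewrite ler_nat ltnS.
Qed.

Let bigFn : \bigcup_n Fn n = `]0, +oo[%classic.
Proof.
apply/seteqP; split => x /=.
  move=> [n _]; rewrite /Fn/= !in_itv/= andbT => /andP[h1 _].
  by apply: lt_le_trans h1; rewrite invr_gt0.
rewrite in_itv/= andbT => x0.
exists (maxn (Num.truncn x) (Num.truncn x^-1)) => //; rewrite /Fn/= in_itv/=.
apply/andP; split.
  rewrite -[leRHS]invrK lef_pV2 ?posrE ?invr_gt0//.
  apply/ltW/(lt_le_trans (truncnS_gt _)).
  by rewrite ler_nat ltnS leq_maxr.
apply/ltW/(lt_le_trans (truncnS_gt _)).
by rewrite ler_nat ltnS leq_maxl.
Qed.

Let subFn n : Fn n `<=` `]0, +oo[.
Proof. by rewrite -bigFn; exact: bigcup_sup. Qed.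

Let ge0_Rintegral_cvg_0y f : (forall x : R, 0 < x -> 0 <= f x) ->
  mu.-integrable `]0, +oo[ (EFin \o f) ->
  \int[mu]_(x in Fn n) f x @[n --> \oo] --> \int[mu]_(x in `]0, +oo[) f x.
Proof.
move=> f0 intf; apply: fine_cvg; rewrite fineK; last exact: integrable_fin_num.
rewrite -bigFn; apply: ge0_nondecreasing_set_cvg_integral => //.
- by move=> i; exact: measurable_itv.
- move=> i; apply: (measurable_funS _ (@subFn i)) => //.
  exact: measurable_int intf.
- move=> i x /subFn/=; rewrite in_itv/= andbT => x0; rewrite lee_fin; exact: f0.
Qed.

(** Monotone convergence covers nonnegative integrands; in general f is the difference of f + |f|
    and |f|. *)
Lemma Rintegral_cvg_0y f : mu.-integrable `]0, +oo[ (EFin \o f) ->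
  \int[mu]_(x in `[n.+1%:R^-1, n.+1%:R]) f x @[n --> \oo] -->
  \int[mu]_(x in `]0, +oo[) f x.
Proof.
move=> intf; have intn := integrable_norm intf.
have ints : mu.-integrable `]0, +oo[ (EFin \o (fun x => f x + `|f x|)).
  exact: integrable_addf.
have e (A : set R) : measurable A -> A `<=` `]0, +oo[ -> \int[mu]_(x in A) f x =
    \int[mu]_(x in A) (f x + `|f x|) - \int[mu]_(x in A) `|f x|.
  move=> mA sA; by rewrite RintegralD ?addrK//; [exact: integrableS intf|exact: integrableS intn].
rewrite e//.
have eFn n := e _ (@measurable_itv R `[n.+1%:R^-1, n.+1%:R]) (@subFn n).
under eq_fun => n do rewrite eFn.
apply: cvgB; apply: ge0_Rintegral_cvg_0y => // x _.
by rewrite -lerBlDl sub0r -normrN ler_norm.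
Qed.

Lemma Rintegral_FTC_0y f F (l l0 : R) :
  mu.-integrable `]0, +oo[ (EFin \o f) ->
  (forall x : R, 0 < x -> {for x, continuous f}) ->
  (forall x : R, 0 < x -> is_derive x 1 F (f x)) ->
  F n.+1%:R @[n --> \oo] --> l -> F (n.+1%:R^-1) @[n --> \oo] --> l0 ->
  \int[mu]_(x in `]0, +oo[) f x = l - l0.
Proof.
move=> intf cf dF Fl Fl0.
have h := Rintegral_cvg_0y intf.
suff e n : \int[mu]_(x in `[n.+1%:R^-1, n.+1%:R]) f x = F n.+1%:R - F (n.+1%:R^-1).
  move: h; under eq_fun do rewrite e.
  move=> h; have <- := cvg_lim (@Rhausdorff R) h.
  exact: (cvg_lim (@Rhausdorff R) (cvgB Fl Fl0)).
(* For n = 0 the interval is the single point 1. *)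
have [n0|n0] := eqVneq n 0%N.
  by rewrite n0 invr1 set_itv1 Rintegral_set1 subrr.
have nn : (n.+1%:R^-1 : R) < n.+1%:R.
  apply: (@lt_trans _ _ 1); last by rewrite ltr1n ltnS lt0n.
  by rewrite invf_lt1// ltr1n ltnS lt0n.
have n1 : 0 < (n.+1%:R^-1 : R) by rewrite invr_gt0.
rewrite /Rintegral (@continuous_FTC2 _ f F)//.
- apply: continuous_in_subspaceT => x /set_mem/=; rewrite in_itv/= => /andP[x1 _].
  by apply: cf; exact: lt_le_trans x1.
- split.
  + move=> x; rewrite in_itv/= => /andP[x1 _].
    by have [] := dF x (lt_trans n1 x1).
  + by apply: cvg_at_right_filter; exact: is_derive_continuous (dF _ n1).
  + by apply: cvg_at_left_filter; exact: is_derive_continuous (dF _ (lt_trans n1 nn)).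
- move=> x; rewrite in_itv/= => /andP[x1 _].
  by rewrite derive1E; have [_ ->] := dF x (lt_trans n1 x1).
Qed.

(** A primitive of the majorant with values in [0,M] bounds its integral over every interval of the
    exhaustion by M, and monotone convergence carries the bound to the half-line. *)
Lemma integrable_0y_dom f h H (M : R) :
  (forall x : R, 0 < x -> {for x, continuous f}) ->
  (forall x : R, 0 < x -> {for x, continuous h}) ->
  (forall x : R, 0 < x -> `|f x| <= h x) ->
  (forall x : R, 0 < x -> is_derive x 1 H (h x)) ->
  (forall x : R, 0 < x -> 0 <= H x <= M) ->
  mu.-integrable `]0, +oo[ (EFin \o f).
Proof.
move=> cf ch fh dH HM.
have mcont (k : R -> R) : (forall x : R, 0 < x -> {for x, continuous k}) ->
    measurable_fun (`]0, +oo[%classic : set (measurableTypeR R)) k.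
  move=> ck; apply: open_continuous_measurable_fun; first exact: interval_open.
  by move=> x; rewrite inE/= in_itv/= andbT; exact: ck.
apply: (@le_integrable_f _ _ f h); [exact: measurable_itv|exact: mcont| |].
  by move=> x /=; rewrite in_itv/= andbT; exact: fh.
apply/integrableP; split; first by apply/measurable_EFinP; exact: mcont.
apply: (@le_lt_trans _ _ M%:E); last exact: ltry.
have h0 x : 0 < x -> 0 <= h x by move=> x0; exact: le_trans (fh _ x0).
rewrite -bigFn.
have mh n : measurable_fun (Fn n) (abse \o (EFin \o h)).
  apply/measurableT_comp => //; apply/measurable_EFinP.
  by apply: (measurable_funS _ (@subFn n)) => //; exact: mcont.
have cv := ge0_nondecreasing_set_cvg_integral ndFn (fun i => measurable_itv _) mh
  (fun i x _ => abse_ge0 _) (mu := mu).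
rewrite -(cvg_lim _ cv)//; apply: lime_le.
  by apply/cvg_ex; eexists; exact: cv.
apply: nearW => n.
have n1 : 0 < (n.+1%:R^-1 : R) by rewrite invr_gt0.
have n2 : 0 < (n.+1%:R : R) by rewrite ltr0n.
have [n0|n0] := eqVneq n 0%N.
  rewrite n0 /Fn invr1 set_itv1 integral_set1 lee_fin.
  by have /andP[] := HM _ n2; exact: le_trans.
have nn : (n.+1%:R^-1 : R) < n.+1%:R.
  apply: (@lt_trans _ _ 1); last by rewrite ltr1n ltnS lt0n.
  by rewrite invf_lt1// ltr1n ltnS lt0n.
have -> : (\int[mu]_(x in Fn n) (abse \o (EFin \o h)) x = \int[mu]_(x in Fn n) (h x)%:E)%E.
  apply: eq_integral => x /set_mem/subFn/=; rewrite in_itv/= andbT => x0.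
  by rewrite /= ger0_norm// h0.
rewrite (@continuous_FTC2 _ h H)//.
- rewrite -EFinB lee_fin.
  have /andP[_ h1] := HM _ n2; have /andP[h2 _] := HM _ n1.
  by rewrite lerBlDr (le_trans h1)// lerDl.
- apply: continuous_in_subspaceT => x /set_mem/=; rewrite in_itv/= => /andP[x1 _].
  by apply: ch; exact: lt_le_trans x1.
- split.
  + move=> x; rewrite in_itv/= => /andP[x1 _].
    by have [] := dH x (lt_trans n1 x1).
  + by apply: cvg_at_right_filter; exact: is_derive_continuous (dH _ n1).
  + by apply: cvg_at_left_filter; exact: is_derive_continuous (dH _ n2).
- move=> x; rewrite in_itv/= => /andP[x1 _].
  by rewrite derive1E; have [_ ->] := dH x (lt_trans n1 x1).
Qed.

End HalfLine.

(** * Integrability of powers of 1 + t^2, and moments of [slope] *)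

Section Weights.
Context {R : realType}.
Local Notation mu := (@lebesgue_measure R).
Local Notation D := (`]0, +oo[%classic : set R).

(** From (1 + t)^2 <= 2 (1 + t^2) one has (1 + t^2)^(-3/4) <= 2^(3/4) (1 + t)^(-3/2); the majorant
    [h] rounds 2^(3/4) up to 2 and has the bounded primitive [H]. *)
Lemma integrable_pw (a : R) : a <= - (3 / 4) ->
  mu.-integrable `]0, +oo[ (EFin \o pw a).
Proof.
move=> a34.
pose h (t : R) := 2 * (1 + t) `^ (- (3 / 2)).
pose H (t : R) := 4 - 4 * (1 + t) `^ (- (1 / 2)).
have dpow b (t : R) : 0 < t ->
    is_derive t 1 (fun t : R => (1 + t) `^ b) (b * (1 + t) `^ (b - 1)).
  move=> t0; have t1 : 0 < 1 + t by rewrite addr_gt0.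
  have := is_derive_compf (fun s => s `^ b) (fun t => 1 + t)
    (is_derive1_powR b t1) (is_derive_addf (is_derive_cstf 1 t) (is_derive_idf t)).
  by move=> /is_derive_congr; apply; rewrite add0r mulr1.
apply: (@integrable_0y_dom _ _ h H 4).
- by move=> x _; exact: continuous_pw.
- move=> x x0; exact: is_derive_continuous (is_derive_scalef 2 (dpow (- (3 / 2)) _ x0)).
- move=> x x0; rewrite ger0_norm ?pw_ge0//.
  apply: (@le_trans _ _ (pw (- (3 / 4)) x)).
    by rewrite ler_powR// lerDl sqr_ge0.
  have x1 : 0 < 1 + x by rewrite addr_gt0.
  rewrite /pw /h !powRN ler_pdivlMr ?powR_gt0// mulrC ler_pdivrMr ?powR_gt0 ?sq1_gt0//.
  rewrite (_ : 3 / 2 = 2 * (3 / 4)); last by field.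
  rewrite powRrM (powR_mulrn 2 (ltW x1)).
  apply: (@le_trans _ _ ((2 * (1 + x ^+ 2)) `^ (3 / 4))).
    by rewrite ge0_ler_powR ?nnegrE ?sqr_ge0 ?mulr_ge0 ?sq1_ge0//;
      have := sqr_ge0 (x - 1); nra.
  rewrite powRM ?sq1_ge0// ler_wpM2r ?powR_ge0//.
  rewrite -[leRHS](powRr1 (a := 2))// ler_powR//; lra.
- move=> x x0; have := is_derive_subf (is_derive_cstf 4 x)
    (is_derive_scalef 4 (dpow (- (1 / 2)) _ x0)).
  move=> /is_derive_congr; apply; rewrite /h (_ : - (1 / 2) - 1 = - (3 / 2)); last by field.
  by field.
- move=> x x0; rewrite /H.
  have h1 : (1 + x) `^ (- (1 / 2)) <= 1.
    by rewrite -[leRHS](powRr0 (1 + x)) ler_powR ?lerDl ?ltW//; lra.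
  have := powR_ge0 (1 + x) (- (1 / 2)); lra.
Qed.

(** This is c/2, since g is even. *)
Definition half_length : R := \int[mu]_(x in `]0, +oo[) gw x.

Lemma integrable_gw : mu.-integrable `]0, +oo[ (EFin \o gw).
Proof. by apply: integrable_pw; lra. Qed.

Section Primitive.
Variable G : R -> R.
Hypotheses (dG : forall t : R, is_derive t 1 G (gw t)) (G0 : G 0 = 0).

Lemma gw_primitive_le s t : s <= t -> G s <= G t.
Proof.
move=> st; apply: (derive_ge0_le (f := G) (df := gw)) => //.
  by apply: continuous_subspaceT => x; exact: is_derive_continuous (dG x).
by move=> x _; rewrite gw_ge0.
Qed.

Lemma gw_primitive_cvg : G n.+1%:R @[n --> \oo] --> half_length.
Proof.
have h := Rintegral_cvg_0y integrable_gw.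
have cG : continuous G by move=> x; exact: is_derive_continuous (dG x).
have h0 : G (n.+1%:R^-1) @[n --> \oo] --> (0 : R).
  by rewrite -G0; apply: continuous_cvg; [exact: cG|exact: cvg_harmonic].
have e n : G n.+1%:R =
    \int[mu]_(x in `[n.+1%:R^-1, n.+1%:R]) gw x + G (n.+1%:R^-1).
  rewrite (Rintegral_FTC2 (F := G)) ?subrK//; last exact: continuous_gw.
  apply: (@le_trans _ _ 1); last by rewrite ler1n.
  by rewrite invf_le1// ler1n.
rewrite -[half_length]addr0; under eq_fun do rewrite e.
exact: cvgD h h0.
Qed.

Lemma gw_primitive_le_half t : G t <= half_length.
Proof.
rewrite -(cvg_lim (@Rhausdorff R) gw_primitive_cvg).
apply: limr_ge; first by apply/cvg_ex; eexists; exact: gw_primitive_cvg.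
near=> n; apply: gw_primitive_le; near: n.
exact: near_ge_natS.
Unshelve. all: by end_near. Qed.

(** The limit of [key_inequality] as T tends to infinity. *)
Lemma key_inequality_half (A : R) (K : R -> R) : 0 < A -> K 0 = 0 ->
  (forall t : R, is_derive t 1 K (Num.sqrt (1 - t / A) * gw t)) ->
  half_length - A^-1 <= K A.
Proof.
move=> A0 K0 dK; rewrite lerBlDr -(cvg_lim (@Rhausdorff R) gw_primitive_cvg).
apply: limr_le; first by apply/cvg_ex; eexists; exact: gw_primitive_cvg.
near=> n; rewrite -lerBlDr; apply: key_inequality => //; near: n.
exact: near_ge_natS.
Unshelve. all: by end_near. Qed.

End Primitive.

Lemma half_length_gt0 : 0 < half_length.
Proof.
have [G [G0 dG]] := @continuous_primitive R gw (@continuous_gw R).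
apply: (@lt_le_trans _ _ (G 1)); last exact: gw_primitive_le_half.
have cG : {within `[0, 1], continuous G}.
  by apply: continuous_subspaceT => x; exact: is_derive_continuous (dG x).
have [c _] := @MVT_segment _ G gw 0 1 ler01 (fun x _ => dG x) cG.
by rewrite G0 !subr0 mulr1 => ->; exact: gw_gt0.
Qed.

Implicit Type v : R.

(** The substitution t = v^2/(1 + v^2) carries the half-line to (0,1) and t^(-1/2) (1 - t)^(-3/4) dt
    to 2 (1 + v^2)^(-3/4) dv. *)
Definition slope (v : R) : R := v ^+ 2 / (1 + v ^+ 2).

Lemma slope_ge0 v : 0 <= slope v.
Proof. by rewrite divr_ge0 ?sqr_ge0// sq1_ge0. Qed.

Lemma slope_lt1 v : slope v < 1.
Proof. by rewrite ltr_pdivrMr ?sq1_gt0// mul1r ltrDr. Qed.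

Lemma is_derive_slope v : is_derive v 1 slope (2 * v / (1 + v ^+ 2) ^+ 2).
Proof.
have d2 := is_derive_expf 2 (is_derive_idf v).
have d3 := is_derive_addf (is_derive_cstf 1 v) d2.
have n0 : 1 + v ^+ 2 != 0 by rewrite gt_eqF ?sq1_gt0.
have := is_derive_mulf d2 (is_derive_invf (fun v => 1 + v ^+ 2) n0 d3).
move=> /is_derive_congr; apply; rewrite /=.
by field; exact: n0.
Qed.

Lemma continuous_slope : continuous slope.
Proof. by move=> v; exact: is_derive_continuous (is_derive_slope v). Qed.

(** Half of the Beta integral B(n + 1/2, 1/4), by the substitution t = [slope v]. *)
Definition moment n : R := \int[mu]_(v in `]0, +oo[) (slope v ^+ n * pw (- (3 / 4)) v).

Lemma slopeX_norm n v : `|slope v ^+ n| <= 1.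
Proof.
by rewrite normrX ger0_norm ?slope_ge0// exprn_ile1 ?slope_ge0 ?(ltW (slope_lt1 v)).
Qed.

Lemma integrable_moment n :
  mu.-integrable `]0, +oo[ (EFin \o (fun v => slope v ^+ n * pw (- (3 / 4)) v)).
Proof.
apply: (@integrable_mulf _ _ 1); first exact: measurable_itv.
- apply: measurable_funTS; apply: continuous_measurable_fun.
  exact/continuous_expf/continuous_slope.
- by move=> x _; exact: slopeX_norm.
- exact: integrable_pw.
Qed.

(** In this form limits at infinity follow from the continuity of the square root at 0. *)
Lemma pw14_sqrt v : pw (- (1 / 4)) v = Num.sqrt (Num.sqrt (1 + v ^+ 2)^-1).
Proof.
have -> : (1 + v ^+ 2)^-1 = pw (-1) v by rewrite /pw powR_inv1 ?sq1_ge0.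
rewrite -!powR12_sqrt ?powR_ge0 ?pw_ge0// /pw -!powRrM.
by congr (_ `^ _); field.
Qed.

(** The function [F] vanishes at 0 and is at most (1 + v^2)^(-1/4), so it tends to 0 at infinity;
    the integral of its derivative, which is the difference of the two integrands, is therefore
    0. *)
Lemma moment_rec n :
  (2 * n%:R + 1) * moment n = (2 * n%:R + 3 / 2) * moment n.+1.
Proof.
pose F v := slope v ^+ n * (v * pw (- (3 / 4)) v).
have q : forall v, v * pw (- (3 / 4)) v <= Num.sqrt (Num.sqrt (1 + v ^+ 2)^-1).
  move=> v; rewrite -pw14_sqrt (_ : - (1 / 4) = 1 / 2 + - (3 / 4)); last by field.
  rewrite -pw_mul ler_wpM2r ?pw_ge0//.
  rewrite /pw mul1r powR12_sqrt ?sq1_ge0//.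
  by rewrite (le_trans (ler_norm v))// -sqrtr_sqr ler_wsqrtr// lerDr.
have cF : continuous F.
  apply: continuous_mulf; first exact/continuous_expf/continuous_slope.
  by apply: continuous_mulf; [exact: continuous_idf|exact: continuous_pw].
have F0 : F 0 = 0 by rewrite /F mul0r mulr0.
have i1 := integrable_scalef (2 * n%:R + 1) (measurable_itv _) (integrable_moment n).
have i2 := integrable_scalef (2 * n%:R + 3 / 2) (measurable_itv _) (integrable_moment n.+1).
have := @Rintegral_FTC_0y _ _ F 0 0 (integrable_subf (measurable_itv _) i1 i2).
rewrite RintegralB// RintegralZl; [|exact: measurable_itv|exact: integrable_moment].
rewrite RintegralZl; [|exact: measurable_itv|exact: integrable_moment].
rewrite subrr => e; apply/eqP; rewrite -subr_eq0; apply/eqP; apply: e.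
- move=> x _; apply: (continuous_subf); apply: continuous_mulf;
    try exact: continuous_cstf; apply: continuous_mulf; try exact: continuous_pw;
    exact/continuous_expf/continuous_slope.
- move=> x x0.
  have d1 := is_derive_expf n (is_derive_slope x).
  have d2 := is_derive_mulf (is_derive_idf x) (is_derive_pw (- (3 / 4)) x).
  have := is_derive_mulf d1 d2; move=> /is_derive_congr; apply.
  have n0 : 1 + x ^+ 2 != 0 by rewrite gt_eqF ?sq1_gt0.
  have -> : pw (- (3 / 4)) x = pw (- (3 / 4) - 1) x * (1 + x ^+ 2).
    by rewrite -pwS; congr pw; field.
  have x2 : x != 0 by rewrite gt_eqF.
  case: n {F q cF F0 i1 i2 d1} => [|n].
    by rewrite !mul0r !expr0 expr1 /slope; field; exact: n0.
  by rewrite !exprS [n.+1.-1]/= /slope; field; exact: n0.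
- have q0 : Num.sqrt (Num.sqrt (n.+1%:R^-1)) @[n --> \oo] --> (0 : R).
    have <- : Num.sqrt (Num.sqrt 0) = 0 :> R by rewrite !sqrtr0.
    by do 2 (apply: continuous_cvg; first exact: sqrt_continuous); exact: cvg_harmonic.
  apply: (@squeeze_cvgr _ _ _ _ (fun=> 0) (fun n => Num.sqrt (Num.sqrt (n.+1%:R^-1)))) => //.
    apply: nearW => k; rewrite /F mulr_ge0 ?mulr_ge0 ?pw_ge0 ?exprn_ge0 ?slope_ge0//=.
    rewrite (@le_trans _ _ (1 * (k.+1%:R * pw (- (3 / 4)) k.+1%:R)))//.
      rewrite ler_wpM2r ?mulr_ge0 ?pw_ge0//.
      by rewrite (le_trans (ler_norm _))// slopeX_norm.
    rewrite mul1r (le_trans (q _))// !ler_wsqrtr// lef_pV2 ?posrE ?sq1_gt0//.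
    have : (1 : R) <= k.+1%:R by rewrite ler1n.
    nra.
  exact: cvg_cst.
- by rewrite -F0; apply: continuous_cvg; [exact: cF|exact: cvg_harmonic].
Qed.

End Weights.

(** * A product of two Beta integrals, and the size of [damped] at infinity *)

Section BetaProduct.
Context {R : realType}.
Local Notation mu := (@lebesgue_measure R).
Local Notation D := (`]0, +oo[%classic : set R).

Lemma integral_0y_scale (c : R) (f : R -> R) : 0 < c -> continuous f ->
  (forall x, 0 <= x -> 0 <= f x) ->
  (\int[mu]_(x in `]0%R, +oo[) (f x)%:E =
   \int[mu]_(x in `]0%R, +oo[) (c * f (c * x))%:E)%E.
Proof.
move=> c0 cf f0.
have dc : derive1 ( *%R c) = (fun=> c).
  apply/funext => x; rewrite derive1E.
  have := is_derive_scalef c (is_derive_idf x).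
  by move=> [_ ->]; rewrite mulr1.
have cc : continuous ( *%R c) by exact: mulrl_continuous.
rewrite !integral_itv_obnd_cbnd; last 2 first.
- apply: (@measurable_EFin_continuous R _ (fun x => c * f (c * x))).
  by apply: continuous_mulf; [exact: continuous_cstf|exact: continuous_compf].
- exact: measurable_EFin_continuous.
have := @increasing_ge0_integration_by_substitutiony R ( *%R c) f 0.
rewrite mulr0 dc => ->.
- by apply: eq_integral => x _; rewrite /= fctE mulrC.
- by move=> x y _ _ xy; rewrite ltr_pM2l.
- by move=> x _; exact: cvg_cst.
- exact: is_cvg_cst.
- exact: is_cvg_cst.
- split; last by apply: cvg_at_right_filter; exact: cc.
  by move=> x _; have [] := is_derive_scalef c (is_derive_idf x).
- apply/cvgryPge => M; apply: filterS (nbhs_pinfty_ge (num_real (c^-1 * M))) => x.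
  by rewrite ler_pdivrMl.
- exact: continuous_subspaceT.
- by move=> x; rewrite in_itv/= andbT => /ltW; exact: f0.
Qed.

(** The number pi/2, kept as an integral because it arises in this form both from the double
    integral below and from the bound on A times [damped A]. *)
Definition arctan_total : R := \int[mu]_(v in `]0, +oo[) pw (- 1) v.

Lemma integrable_pw1 : mu.-integrable `]0, +oo[ (EFin \o (pw (- 1) : R -> R)).
Proof. by apply: integrable_pw; lra. Qed.

Lemma EFin_moment0 : (moment 0)%:E = (\int[mu]_(v in `]0%R, +oo[) (pw (- (3 / 4)) v)%:E)%E :> \bar R.
Proof.
rewrite /moment; under eq_Rintegral do rewrite expr0 mul1r.
by rewrite /Rintegral fineK//; exact/integrable_fin_num/integrable_pw.
Qed.

Lemma Rintegral_id_gw : (\int[mu]_(t in `]0%R, +oo[) (t * gw t)%:E = 2%:E :> \bar R)%E.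
Proof.
rewrite integral_itv_obnd_cbnd; last first.
  apply: (@measurable_EFin_continuous R _ (fun t => t * gw t)).
  by apply: continuous_mulf; [exact: continuous_idf|exact: continuous_gw].
pose F (t : R) := - (2 * pw (- (1 / 4)) t).
have dF (t : R) : is_derive t 1 F (t * gw t).
  have := is_derive_oppf (is_derive_scalef 2 (is_derive_pw (- (1 / 4)) t)).
  move=> /is_derive_congr; apply.
  by rewrite (_ : - (1 / 4) - 1 = - (5 / 4)); [rewrite -/(gw t)|]; field.
rewrite (@ge0_continuous_FTC2y _ _ F _ 0).
- by rewrite /F pw0 mulr1 -EFinB opprK add0r.
- by move=> x x0; rewrite mulr_ge0 ?gw_ge0.
- apply: continuous_subspaceT.
  by apply: continuous_mulf; [exact: continuous_idf|exact: continuous_gw].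
- have e1 : (1 + t ^+ 2)^-1 @[t --> +oo] --> (0 : R).
    apply/gtr0_cvgV0; first by near=> t; exact: sq1_gt0.
    apply/cvgryPge => M; near=> t; have t1 : 1 <= t.
      by near: t; apply: nbhs_pinfty_ge; exact: num_real.
    apply: (@le_trans _ _ t); last by nra.
    by near: t; apply: nbhs_pinfty_ge; exact: num_real.
  have e2 : Num.sqrt (Num.sqrt (1 + t ^+ 2)^-1) @[t --> +oo] --> (0 : R).
    have <- : Num.sqrt (Num.sqrt 0) = 0 :> R by rewrite !sqrtr0.
    by do 2 (apply: continuous_cvg; first exact: sqrt_continuous).
  have -> : F = (fun t => - (2 * Num.sqrt (Num.sqrt (1 + t ^+ 2)^-1))).
    by apply/funext => t; rewrite /F pw14_sqrt.
  rewrite -[X in _ --> X]oppr0 -[X in _ --> - X](mulr0 2).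
  by apply: cvgN; apply: cvgM; [exact: cvg_cst|exact: e2].
- by move=> x _; have [] := dF x.
- by apply: cvg_at_right_filter; exact: is_derive_continuous (dF _).
- by move=> x _; rewrite derive1E; have [_ ->] := dF x.
Unshelve. all: by end_near. Qed.

(* Both sides are the integral of (1 + t^2 + s^2)^(-5/4) over the quadrant,
   evaluated with s = sqrt (1 + t^2) v and with s = t v respectively. *)
Lemma half_length_moment0 : half_length * moment 0 = 2 * arctan_total.
Proof.
pose k (t v : R) := t * (1 + t ^+ 2 * (1 + v ^+ 2)) `^ (- (5 / 4)).
have pos (t v : R) : 0 < 1 + t ^+ 2 * (1 + v ^+ 2).
  by rewrite ltr_wpDr// mulr_ge0 ?sqr_ge0 ?sq1_ge0.
have inner (t : R) : 0 < t -> (\int[mu]_(v in `]0%R, +oo[) (k t v)%:E =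
    (pw (- (3 / 4)) t)%:E * half_length%:E)%E.
  move=> t0.
  pose f (s : R) := (1 + t ^+ 2 + s ^+ 2) `^ (- (5 / 4)).
  have f0 s : 0 <= s -> 0 <= f s by move=> _; exact: powR_ge0.
  have cf : continuous f.
    move=> s; have d2 := is_derive_expf 2 (is_derive_idf s).
    have d3 := is_derive_addf (is_derive_cstf (1 + t ^+ 2) s) d2.
    have s0 : 0 < 1 + t ^+ 2 + s ^+ 2 by rewrite ltr_wpDr ?sqr_ge0 ?sq1_gt0.
    exact: is_derive_continuous (is_derive_compf (fun s => s `^ _)
      (fun s => 1 + t ^+ 2 + s ^+ 2) (is_derive1_powR _ s0) d3).
  have c0 : 0 < pw (1 / 2) t by exact: pw_gt0.
  transitivity (\int[mu]_(s in `]0%R, +oo[) (f s)%:E)%E.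
    rewrite (integral_0y_scale t0 cf f0); apply: eq_integral => v _.
    by rewrite /f /k; congr (_ * _ `^ _)%:E; ring.
  rewrite (integral_0y_scale c0 cf f0).
  rewrite /half_length (EFin_Rintegral (measurable_itvR _) integrable_gw).
  rewrite -(ge0_integralZf (measurable_itvR _) (pw_ge0 _ t) (@continuous_gw R) (fun x _ => gw_ge0 x)).
  apply: eq_integral => v _; congr EFin.
  rewrite /f (_ : 1 + t ^+ 2 + _ = (1 + t ^+ 2) * (1 + v ^+ 2)).
    rewrite powRM ?sq1_ge0// -/(pw _ t) -/(gw v) mulrA pw_mul.
    by congr (pw _ t * _); field.
  by rewrite exprMn /pw mul1r powR12_sqrt ?sq1_ge0// sqr_sqrtr ?sq1_ge0//; ring.
(* Scaling t by sqrt(1 + v^2) reduces this integral to that of t g(t), which is 2. *)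
have outer v : (\int[mu]_(t in `]0%R, +oo[) (k t v)%:E = (2 * pw (- 1) v)%:E)%E.
  have c0 : 0 < pw (1 / 2) v by exact: pw_gt0.
  have cid : continuous (fun t : R => t * gw t).
    by apply: continuous_mulf; [exact: continuous_idf|exact: continuous_gw].
  have id0 (x : R) : 0 <= x -> 0 <= x * gw x by move=> x0; rewrite mulr_ge0 ?gw_ge0.
  rewrite mulrC EFinM -[in RHS]Rintegral_id_gw (integral_0y_scale c0 cid id0).
  have cs : continuous (fun t => pw (1 / 2) v * (pw (1 / 2) v * t * gw (pw (1 / 2) v * t))).
    apply: continuous_mulf; first exact: continuous_cstf.
    by apply: (continuous_compf (fun t => t * gw t)) => //; exact: mulrl_continuous.
  have s0 (t : R) : (`]0, +oo[%classic : set R) t ->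
      0 <= pw (1 / 2) v * (pw (1 / 2) v * t * gw (pw (1 / 2) v * t)).
    by rewrite /= in_itv/= andbT => /ltW t0; rewrite !mulr_ge0 ?pw_ge0.
  rewrite -(ge0_integralZf (measurable_itvR _) (pw_ge0 (- 1) v) cs s0).
  apply: eq_integral => t _; congr EFin.
  have c2 : pw (1 / 2) v ^+ 2 = 1 + v ^+ 2.
    by rewrite expr2 pw_mul (_ : 1 / 2 + 1 / 2 = 0 + 1) ?pwS ?/pw ?powRr0 ?mul1r//; field.
  rewrite /gw /pw exprMn -/(pw (1 / 2) v) c2 /k [in RHS](mulrC (1 + v ^+ 2)).
  set z := _ `^ (- (5 / 4)); rewrite powR_inv1 ?sq1_ge0//.
  have -> : (1 + v ^+ 2)^-1 * (pw (1 / 2) v * (pw (1 / 2) v * t * z)) =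
    (1 + v ^+ 2)^-1 * (pw (1 / 2) v ^+ 2 * (t * z)) by ring.
  by rewrite c2 mulKf// gt_eqF ?sq1_gt0.
have key : (\int[mu]_(t in `]0%R, +oo[) \int[mu]_(v in `]0%R, +oo[) (k t v)%:E =
    \int[mu]_(v in `]0%R, +oo[) \int[mu]_(t in `]0%R, +oo[) (k t v)%:E)%E.
  (* The indicators restrict the kernel to the quadrant, where it is nonnegative, so that Tonelli's
     theorem applies on the whole plane. *)
  pose K (z : measurableTypeR R * measurableTypeR R) : \bar R :=
    (\1_D z.1 * \1_D z.2 * k z.1 z.2)%:E.
  have mK : measurable_fun setT K.
    apply/measurable_EFinP; apply: measurable_funM.
      by apply: measurable_funM; apply: measurableT_comp => //; exact: measurable_indic.
    apply: measurable_funM => //.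
    apply: (measurableT_comp (measurable_powR _)); apply: measurable_funD => //.
    apply: measurable_funM; first exact: measurable_funX.
    by apply: measurable_funD => //; exact: measurable_funX.
  have K0 z : (0 <= K z)%E.
    rewrite lee_fin /K !indicE; case: (boolP (z.1 \in D)) => [|_]; last by rewrite !mul0r.
    rewrite inE/= in_itv/= andbT => z0.
    by rewrite mulr_ge0 ?mulr_ge0 ?powR_ge0 ?ler0n ?ltW.
  have := fubini_tonelli (m1 := mu) (m2 := mu) K mK K0.
  have e1 : (fun t => \int[mu]_(v in `]0%R, +oo[) (k t v)%:E)%E \_ D =
      (fun t => \int[mu]_v K (t, v))%E.
    apply/funext => t; rewrite patchE; case: ifPn => tD; last first.
      by rewrite integral0_eq// => v _; rewrite /K indicE/= (negbTE tD) !mul0r.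
    rewrite integral_mkcond; apply: eq_integral => v _; rewrite patchE /K !indicE/= tD mul1r.
    by case: ifPn => vD; rewrite ?mul1r ?mul0r.
  have e2 : (fun v => \int[mu]_(t in `]0%R, +oo[) (k t v)%:E)%E \_ D =
      (fun v => \int[mu]_t K (t, v))%E.
    apply/funext => v; rewrite patchE; case: ifPn => vD; last first.
      by rewrite integral0_eq// => t _; rewrite /K !indicE/= (negbTE vD) mulr0 mul0r.
    rewrite integral_mkcond; apply: eq_integral => t _; rewrite patchE /K !indicE/= vD mulr1.
    by case: ifPn => tD; rewrite ?mul1r ?mul0r.
  move=> H; etransitivity; first exact: integral_mkcond.
  rewrite e1; etransitivity; first exact: H.
  by rewrite -e2; symmetry; exact: integral_mkcond.
apply: EFin_inj; rewrite [in LHS]EFinM EFin_moment0.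
have -> : (2 * arctan_total)%:E = (\int[mu]_(v in `]0%R, +oo[) (2 * pw (- 1) v)%:E)%E.
  rewrite -(RintegralZf 2 (measurable_itvR _) integrable_pw1).
  apply: EFin_Rintegral; first exact: measurable_itvR.
  exact: (integrable_scalef 2 (measurable_itvR _) integrable_pw1).
rewrite -(ge0_integralZf (measurable_itvR _) (ltW half_length_gt0)
  (@continuous_pw R (- (3 / 4))) (fun x _ => pw_ge0 _ x)).
transitivity (\int[mu]_(t in `]0%R, +oo[) \int[mu]_(v in `]0%R, +oo[) (k t v)%:E)%E.
  apply: eq_integral => t; rewrite inE/= in_itv/= andbT => t0.
  by rewrite mulrC EFinM; exact: esym (inner t t0).
by rewrite key; apply: eq_integral => v _; exact: outer.
Qed.

(** It will turn out to be [moment 0] times the hypergeometric function with parameters 1/2, 1, 3/4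
    at -A^2. *)
Definition damped (A : R) : R :=
  \int[mu]_(v in `]0, +oo[) (pw (- (3 / 4)) v / (1 + A ^+ 2 * slope v)).

Lemma damped_denom_gt0 (A v : R) : 0 < 1 + A ^+ 2 * slope v.
Proof. by rewrite ltr_wpDr// mulr_ge0 ?sqr_ge0 ?slope_ge0. Qed.

Lemma continuous_damped_kernel (A : R) : continuous (fun v => (1 + A ^+ 2 * slope v)^-1).
Proof.
apply: continuous_invf; last by move=> v; rewrite gt_eqF ?damped_denom_gt0.
apply: continuous_addf; first exact: continuous_cstf.
by apply: continuous_mulf; [exact: continuous_cstf|exact: continuous_slope].
Qed.

Lemma damped_kernel_le1 (A v : R) : `|(1 + A ^+ 2 * slope v)^-1| <= 1.
Proof.
rewrite ger0_norm ?invr_ge0 ?(ltW (damped_denom_gt0 _ _))//.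
by rewrite invf_le1 ?damped_denom_gt0// lerDl mulr_ge0 ?sqr_ge0 ?slope_ge0.
Qed.

Lemma integrable_damped (A : R) : mu.-integrable `]0, +oo[
  (EFin \o (fun v : R => pw (- (3 / 4)) v / (1 + A ^+ 2 * slope v))).
Proof.
have -> : (fun v : R => pw (- (3 / 4)) v / (1 + A ^+ 2 * slope v)) =
    (fun v => (1 + A ^+ 2 * slope v)^-1 * pw (- (3 / 4)) v).
  by apply/funext => v; rewrite mulrC.
apply: (@integrable_mulf _ _ 1); first exact: measurable_itvR.
- by apply: measurable_continuous; exact: continuous_damped_kernel.
- by move=> v _; exact: damped_kernel_le1.
- exact: integrable_pw.
Qed.

(** As [slope] is below 1, the kernel is at least 1/(1 + A^2). *)
Lemma damped_gt0 (A : R) : (0 : R) < moment 0 -> 0 < damped A.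
Proof.
move=> m0; apply: (@lt_le_trans _ _ ((1 + A ^+ 2)^-1 * moment 0)).
  by rewrite mulr_gt0// invr_gt0 sq1_gt0.
rewrite /moment; under eq_Rintegral do rewrite expr0 mul1r.
have i0 : mu.-integrable `]0, +oo[ (EFin \o (pw (- (3 / 4)) : R -> R)) by exact: integrable_pw.
rewrite -(RintegralZf _ (measurable_itvR _) i0).
apply: le_Rintegral; [exact: measurable_itvR| |exact: integrable_damped|].
  exact: integrable_scalef (measurable_itvR _) i0.
move=> v _; rewrite mulrC ler_wpM2l ?pw_ge0// lef_pV2 ?posrE ?sq1_gt0 ?damped_denom_gt0//.
by rewrite lerD2l ler_piMr ?sqr_ge0// ltW// slope_lt1.
Qed.

(** The integrand of [damped A] is (1 + v^2)^(1/4) / (1 + v^2 + A^2 v^2). Dropping v^2 in the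
    denominator and putting x = A v leaves (1 + k^4 x^2)^(1/4) / (1 + x^2), as A = k^(-2). With p =
    (1 + x^2)^(1/4), the inequality (1 + k p)^4 >= 1 + (k p)^4 bounds the numerator by 1 + k p. The
    parameter k avoids roots of A. *)
Lemma damped_le (k : R) : 0 < k ->
  k ^- 2 * damped (k ^- 2) <= arctan_total + k * moment 0.
Proof.
move=> k0; set A := k ^- 2.
have A0 : 0 < A by rewrite invr_gt0 exprn_gt0.
pose f (x : R) := pw (1 / 4) (A^-1 * x) * pw (- 1) x.
have cf : continuous f.
  apply: continuous_mulf; last exact: continuous_pw.
  by apply: (continuous_compf (pw (1 / 4))); [exact: continuous_pw|exact: mulrl_continuous].
have f0 (x : R) : 0 <= x -> 0 <= f x by move=> _; rewrite mulr_ge0 ?pw_ge0.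
have i0 : mu.-integrable `]0, +oo[ (EFin \o (pw (- (3 / 4)) : R -> R)) by exact: integrable_pw.
have fle (x : R) : f x <= pw (- 1) x + k * pw (- (3 / 4)) x.
  rewrite (_ : - (3 / 4) = 1 / 4 + - 1); last by field.
  rewrite -pw_mul mulrA -[X in X + _]mul1r -mulrDl ler_wpM2r ?pw_ge0//.
  set p := pw (1 / 4) x; have p0 : 0 <= p by exact: pw_ge0.
  have kp : 0 <= k * p by rewrite mulr_ge0// ltW.
  have p4 : p ^+ 4 = 1 + x ^+ 2.
    rewrite /p /pw -powR_mulrn ?powR_ge0// -powRrM (_ : 1 / 4 * 4 = 1) ?powRr1 ?sq1_ge0//.
    by field.
  have -> : 1 + k * p = ((1 + k * p) ^+ 4) `^ (1 / 4).
    rewrite -powR_mulrn ?addr_ge0// -powRrM (_ : 4 * (1 / 4) = 1) ?powRr1 ?addr_ge0//.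
    by field.
  rewrite ge0_ler_powR ?nnegrE ?sq1_ge0 ?exprn_ge0 ?addr_ge0//.
  rewrite exprMn /A invrK.
  have -> : (k ^+ 2) ^+ 2 * x ^+ 2 = (k * p) ^+ 4 - k ^+ 4.
    by rewrite [(k * p) ^+ 4]exprMn p4; ring.
  have k4 : 0 <= k ^+ 4 by rewrite exprn_ge0// ltW.
  move: (k * p) kp => z z0.
  have z2 : 0 <= z ^+ 2 by rewrite sqr_ge0.
  have z3 : 0 <= z ^+ 3 by rewrite exprn_ge0.
  have -> : (1 + z) ^+ 4 = 1 + 4 * z + 6 * z ^+ 2 + 4 * z ^+ 3 + z ^+ 4 by ring.
  lra.
have ifl : mu.-integrable `]0, +oo[ (EFin \o (fun x => pw (- 1) x + k * pw (- (3 / 4)) x)).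
  apply: integrable_addf; [exact: measurable_itvR|exact: integrable_pw1|].
  exact: integrable_scalef (measurable_itvR _) i0.
have intf : mu.-integrable `]0, +oo[ (EFin \o f).
  apply: le_integrable_f ifl; [exact: measurable_itvR|exact: measurable_continuous|].
  move=> x; rewrite /= in_itv/= andbT => x0.
  by rewrite ger0_norm; [exact: fle|exact/f0/ltW].
have sc : \int[mu]_(x in `]0, +oo[) f x = \int[mu]_(x in `]0, +oo[) (A * f (A * x)).
  by rewrite /Rintegral (integral_0y_scale A0 cf f0).
(* The scaled function is nonnegative and its integral equals the finite integral of [f]. *)
have iAf : mu.-integrable `]0, +oo[ (EFin \o (fun x => A * f (A * x))).
  apply/integrableP; split.
    apply: measurable_EFin_continuous; apply: continuous_mulf; first exact: continuous_cstf.
    by apply: (continuous_compf f) => //; exact: mulrl_continuous.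
  have := integrable_fin_num (measurable_itvR _) intf.
  rewrite /= (integral_0y_scale A0 cf f0) => fin.
  suff -> : (\int[mu]_(x in `]0%R, +oo[) `|A * f (A * x)|%:E =
    \int[mu]_(x in `]0%R, +oo[) (A * f (A * x))%:E)%E by rewrite ltey_eq fin.
  apply: (@eq_integral _ _ _ mu) => x; rewrite inE/= in_itv/= andbT => x0.
  by rewrite /= ger0_norm// mulr_ge0 ?f0 ?mulr_ge0 ?ltW.
apply: (@le_trans _ _ (\int[mu]_(x in `]0, +oo[) f x)).
  rewrite sc -(RintegralZf _ (measurable_itvR _) (integrable_damped A)).
  apply: le_Rintegral => //.
    exact: integrable_scalef (measurable_itvR _) (integrable_damped A).
  move=> v _; rewrite (ler_wpM2l (ltW A0))// /f mulKf ?gt_eqF//.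
  rewrite (_ : - (3 / 4) = 1 / 4 + - 1); last by field.
  rewrite -pw_mul -mulrA ler_wpM2l ?pw_ge0// /pw !powR_inv1 ?sq1_ge0//.
  rewrite -invfM lef_pV2 ?posrE ?mulr_gt0 ?sq1_gt0 ?damped_denom_gt0//.
  have n0 : 1 + v ^+ 2 != 0 by rewrite gt_eqF ?sq1_gt0.
  have -> : (1 + v ^+ 2) * (1 + A ^+ 2 * slope v) = 1 + (A * v) ^+ 2 + v ^+ 2.
    by rewrite /slope; field; exact: n0.
  by rewrite lerDl sqr_ge0.
have -> : k * moment 0 = \int[mu]_(x in `]0, +oo[) (k * pw (- (3 / 4)) x).
  rewrite (RintegralZf _ (measurable_itvR _) i0) /moment; congr (_ * _).
  by apply: eq_Rintegral => v _; rewrite expr0 mul1r.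
rewrite /arctan_total -RintegralD//.
- exact: le_Rintegral.
- exact: integrable_pw1.
- exact: integrable_scalef (measurable_itvR _) i0.
Qed.

End BetaProduct.

(** * Hypergeometric coefficients as moments *)

Section GammaRecursion.
Context {R : realType}.
Local Notation mu := (@lebesgue_measure R).
Implicit Types a t : R.

Lemma powR_le_expR b : exists2 C : R, 0 < C &
  forall x : R, 1 <= x -> x `^ b <= C * expR x.
Proof.
(* A natural exponent above [b]: the power is then at most [N!] times one term of the exponential
   series. *)
pose N := (Num.truncn b).+1; exists (N`!%:R); first by rewrite ltr0n fact_gt0.
move=> x x1; have x0 : 0 <= x by exact: le_trans x1.
apply: (@le_trans _ _ (x ^+ N)).
  by rewrite -powR_mulrn// ler_powR// ltW// truncnS_gt.
have := expR_ge1Dxn (Num.truncn b) x0; rewrite -/N => h.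
rewrite mulrC -ler_pdivrMr ?ltr0n ?fact_gt0//.
by apply: le_trans h; rewrite lerDr.
Qed.

Definition gamma_integrand a t : R := t `^ (a - 1) * expR (- t).

Lemma is_derive_expRN t : is_derive t 1 (fun t : R => expR (- t)) (- expR (- t)).
Proof.
have := is_derive_compf expR (fun t : R => - t) (is_derive_expR _) (is_derive_oppf (is_derive_idf t)).
by move=> /is_derive_congr; apply; rewrite mulrN1.
Qed.

Lemma continuous_gamma_integrand a t : 0 < t -> {for t, continuous (gamma_integrand a)}.
Proof.
move=> t0; have := is_derive_mulf (is_derive1_powR (a - 1) t0) (is_derive_expRN t).
exact: is_derive_continuous.
Qed.

(** The majorant [h] is K times the derivative of (t/(1 + t))^a / a, which is bounded; it treats the
    singularity at 0 and the decay at infinity together. The factor e in [K] arises because (1 +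
    t)^(a + 1) is compared with exp(1 + t). *)
Lemma integrable_gamma a : 0 < a ->
  mu.-integrable `]0, +oo[ (EFin \o gamma_integrand a).
Proof.
move=> a0; have [C C0 hC] := powR_le_expR (a + 1).
pose K := C * expR 1.
have K0 : 0 < K by rewrite mulr_gt0 ?expR_gt0.
pose h t : R := K * ((t / (1 + t)) `^ (a - 1) * (1 + t) ^- 2).
pose H t : R := K * (a^-1 * (t / (1 + t)) `^ a).
have t1 t : 0 < t -> 0 < 1 + t by move=> t0; rewrite addr_gt0.
have dq t : 0 < t -> is_derive t 1 (fun t : R => t / (1 + t)) ((1 + t) ^- 2).
  move=> t0; have n0 : 1 + t != 0 by rewrite gt_eqF ?t1.
  have := is_derive_mulf (is_derive_idf t) (is_derive_invf (fun t => 1 + t) n0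
    (is_derive_addf (is_derive_cstf 1 t) (is_derive_idf t))).
  by move=> /is_derive_congr; apply; field.
have q0 t : 0 < t -> 0 < t / (1 + t) by move=> t0; rewrite divr_gt0 ?t1.
apply: (@integrable_0y_dom _ _ h H (K * a^-1)).
- by move=> t; exact: continuous_gamma_integrand.
- move=> t t0.
  have d1 := is_derive_compf (fun s => s `^ (a - 1)) (fun t => t / (1 + t))
    (is_derive1_powR (a - 1) (q0 t t0)) (dq t t0).
  have n0 : (1 + t) ^+ 2 != 0 by rewrite expf_neq0// gt_eqF ?t1.
  have d2 := is_derive_invf (fun t => (1 + t) ^+ 2) n0 (is_derive_expf 2
    (is_derive_addf (is_derive_cstf 1 t) (is_derive_idf t))).
  exact: is_derive_continuous (is_derive_scalef K (is_derive_mulf d1 d2)).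
- move=> t t0; have t10 := t1 t t0.
  rewrite ger0_norm ?mulr_ge0 ?powR_ge0 ?expR_ge0// /gamma_integrand /h.
  have -> : K * ((t / (1 + t)) `^ (a - 1) * (1 + t) ^- 2) =
      t `^ (a - 1) * (K * (1 + t) `^ (- (a + 1))).
    rewrite powRM ?invr_ge0 ?(ltW t0) ?(ltW t10)//.
    have -> : (1 + t) `^ (- (a + 1)) = (1 + t)^-1 `^ (a - 1) * (1 + t) ^- 2.
      rewrite -powR_inv1 ?(ltW t10)// -powRrM -powR_invn ?(ltW t10)//.
      rewrite -powRD ?(gt_eqF t10) ?implybT//.
      by congr (_ `^ _); ring.
    ring.
  rewrite ler_wpM2l ?powR_ge0//.
  rewrite powRN ler_pdivlMr ?powR_gt0// expRN ler_pdivrMl ?expR_gt0//.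
  rewrite /K mulrCA -expRD [t + 1]addrC; apply: hC.
  by rewrite lerDl ltW.
- move=> t t0; have := is_derive_compf (fun s => s `^ a) (fun t => t / (1 + t))
    (is_derive1_powR a (q0 t t0)) (dq t t0).
  move=> /(is_derive_scalef a^-1) /(is_derive_scalef K).
  move=> /is_derive_congr; apply; rewrite /h.
  by rewrite -mulrA mulKf// gt_eqF.
- move=> t t0; apply/andP; split.
    apply: (mulr_ge0 (ltW K0)); apply: mulr_ge0; last exact: powR_ge0.
    by rewrite invr_ge0 ltW.
  rewrite /H ler_pM2l// ler_piMr ?invr_ge0 ?(ltW a0)//.
  apply: (@le_trans _ _ (1 `^ a)); last by rewrite powR1.
  rewrite ge0_ler_powR ?nnegrE ?(ltW a0) ?(ltW (q0 _ t0))//.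
  by rewrite ler_pdivrMr ?t1// mul1r lerDr.
Qed.

Lemma GammaS a : 0 < a -> Gamma (a + 1) = a * Gamma a.
Proof.
move=> a0; have a10 : 0 < a + 1 by rewrite addr_gt0.
pose F t : R := t `^ a * expR (- t).
have i1 := integrable_scalef a (measurable_itvR _) (integrable_gamma a0).
have i2 := integrable_gamma a10.
have := @Rintegral_FTC_0y _ _ F 0 0 (integrable_subf (measurable_itvR _) i1 i2).
rewrite RintegralB// RintegralZf//; last exact: integrable_gamma.
rewrite subrr => e; apply/esym/eqP; rewrite -subr_eq0; apply/eqP; apply: e.
- move=> t t0; apply: cvgB; last exact: continuous_gamma_integrand.
  by apply: cvgM; [exact: cvg_cst|exact: continuous_gamma_integrand].
- move=> t t0; have := is_derive_mulf (is_derive1_powR a t0) (is_derive_expRN t).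
  move=> /is_derive_congr; apply; rewrite /gamma_integrand addrK; ring.
- have [C C0 hC] := powR_le_expR (a + 1).
  have h0 : C * n.+1%:R^-1 @[n --> \oo] --> (0 : R).
    by rewrite -(mulr0 C); apply: cvgM; [exact: cvg_cst|exact: cvg_harmonic].
  apply: (@squeeze_cvgr _ _ _ _ (fun=> 0) (fun n => C * n.+1%:R^-1)) => //; last exact: cvg_cst.
  apply: nearW => n; rewrite /F mulr_ge0 ?powR_ge0 ?expR_ge0//=.
  have n0 : 0 < n.+1%:R :> R by rewrite ltr0n.
  rewrite ler_pdivlMr// expRN mulrAC ler_pdivrMr ?expR_gt0//.
  have := hC n.+1%:R; rewrite ler1n => /(_ isT).
  by rewrite powRD ?(gt_eqF n0) ?implybT// powRr1 ?(ltW n0)//.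
- have h0 : (n.+1%:R^-1 : R) `^ a @[n --> \oo] --> (0 : R).
    apply: (cvg_at_rightP _ _ _).1 (powR_cvg0 a0) _ _; split.
      by move=> n; rewrite invr_gt0 ltr0n.
    exact: cvg_harmonic.
  apply: (@squeeze_cvgr _ _ _ _ (fun=> 0) (fun n => (n.+1%:R^-1) `^ a)) => //; last exact: cvg_cst.
  apply: nearW => n; rewrite /F mulr_ge0 ?powR_ge0 ?expR_ge0//=.
  by rewrite ler_piMr ?powR_ge0// -expR0 ler_expR oppr_le0 invr_ge0.
Qed.

Lemma Gamma_gt0 a : 0 < a -> 0 < Gamma a.
Proof.
move=> a0.
have pos (s : R) : 0 < s -> 0 < gamma_integrand a s.
  by move=> s0; rewrite mulr_gt0 ?powR_gt0 ?expR_gt0.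
have intg := integrable_gamma a0.
have sub : `[1, 2]%classic `<=` (`]0, +oo[%classic : set R).
  by move=> x /=; rewrite !in_itv/= andbT => /andP[x1 _]; exact: lt_le_trans x1.
(* On [1,2] the monotone function t^(a - 1) is at least the smaller of its end values 1 and 2^(a -
   1). *)
pose c := Num.min 1 (2 `^ (a - 1)) * expR (- 2).
have c0 : 0 < c by rewrite mulr_gt0 ?expR_gt0// lt_min ltr01 powR_gt0.
have : (c%:E <= (Gamma a)%:E)%E.
  rewrite /Gamma EFin_Rintegral//.
  apply: (@le_trans _ _ (\int[mu]_(x in `[1%R, 2%R]) (gamma_integrand a x)%:E)%E).
    apply: (@le_trans _ _ (\int[mu]_(x in `[1%R, 2%R]) c%:E)%E).
      rewrite integral_cst; last exact: measurable_itvR.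
      by rewrite /= lebesgue_measure_itv/= lte_fin ltr1n/= -EFinB -EFinM lee_fin; lra.
    apply: ge0_le_integral => //.
    - by move=> x _; rewrite lee_fin ltW.
    - by apply: (measurable_funS _ sub (measurable_int _ intg)); exact: measurable_itvR.
    - move=> x /=; rewrite in_itv/= => /andP[x1 x2]; rewrite lee_fin.
      rewrite /c /gamma_integrand ler_pM ?expR_ge0 ?ler_expR ?lerN2//.
      rewrite ge_min; have [a1|a1] := leP 1 a.
        rewrite (_ : 1 <= _) // -[leLHS](powRr0 x) ler_powR// subr_ge0//.
      apply/orP; right.
      have x0 : 0 < x by exact: lt_le_trans x1.
      have e (y : R) : y `^ (a - 1) = (y `^ (1 - a))^-1 by rewrite -powRN opprB.
      rewrite !e lef_pV2 ?posrE ?powR_gt0//.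
      by rewrite ge0_ler_powR ?nnegrE ?(ltW x0) ?subr_ge0 ?(ltW a1).
  apply: ge0_subset_integral => //; try exact: measurable_itvR.
    by have := measurable_int _ intg.
  by move=> x /=; rewrite in_itv/= andbT => x0; rewrite lee_fin ltW// pos.
by rewrite lee_fin; exact: lt_le_trans.
Qed.

Lemma pochhammer0 a : 0 < a -> pochhammer a 0 = 1.
Proof. by move=> a0; rewrite /pochhammer addr0 divff// gt_eqF ?Gamma_gt0. Qed.

Lemma pochhammerS a n : 0 < a ->
  pochhammer a n.+1 = (a + n%:R) * pochhammer a n.
Proof.
move=> a0; rewrite /pochhammer mulrA -GammaS; last by rewrite ltr_wpDr.
by rewrite -addrA natr1.
Qed.

Lemma pochhammer1 n : pochhammer (1 : R) n = n`!%:R.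
Proof.
elim: n => [|n ih]; first by rewrite pochhammer0.
by rewrite pochhammerS// ih factS natrM -natr1 addrC.
Qed.

Lemma moment0_gt0 : (0 : R) < moment 0.
Proof.
apply: (lt_le_trans half_length_gt0); rewrite /half_length /moment.
apply: le_Rintegral; [exact: measurable_itvR|exact: integrable_gw|exact: integrable_moment|].
move=> x _; rewrite expr0 mul1r /gw ler_powR ?lerDl ?sqr_ge0//; lra.
Qed.

Lemma arctan_total_gt0 : (0 : R) < arctan_total.
Proof.
have := mulr_gt0 half_length_gt0 moment0_gt0.
by rewrite half_length_moment0 pmulr_rgt0.
Qed.

Lemma momentS n : moment n.+1 = (n%:R + 1 / 2) / (n%:R + 3 / 4) * moment n :> R.
Proof.
have n0 : (0 : R) <= n%:R by [].
have e := @moment_rec R n.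
have d : n%:R + 3 / 4 != 0 :> R by lra.
apply: (@mulfI _ (2 * n%:R + 3 / 2)); first by lra.
by rewrite -e; field.
Qed.

Lemma moment_gt0 n : (0 : R) < moment n.
Proof.
elim: n => [|n ih]; first exact: moment0_gt0.
by rewrite momentS mulr_gt0// divr_gt0// ltr_wpDl.
Qed.

(** The upper parameter 1 cancels n!, and (1/2)_n / (3/4)_n obeys the recursion of the moments. *)
Lemma hyp2f1_coef_half n :
  hyp2f1_coef (1 / 2) 1 (3 / 4) n = moment n / moment 0 :> R.
Proof.
rewrite /hyp2f1_coef pochhammer1.
have f0 : n`!%:R != 0 :> R by rewrite pnatr_eq0 -lt0n fact_gt0.
rewrite mulrAC mulfK//.
elim: n {f0} => [|n ih].
  by rewrite !pochhammer0 ?divff ?gt_eqF ?moment0_gt0//; lra.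
rewrite !pochhammerS; [|lra..]; rewrite invfM mulrACA ih momentS mulrA.
by rewrite [1 / 2 + _]addrC [3 / 4 + _]addrC.
Qed.

(** Again the parameter 1 cancels n!; raising the other two parameters by 1 shifts the recursion of
    the moments by one index. *)
Lemma hyp2f1_coef_three_halves n :
  hyp2f1_coef 1 (3 / 2) (7 / 4) n = moment n.+1 / moment 1 :> R.
Proof.
rewrite /hyp2f1_coef pochhammer1.
have f0 : n`!%:R != 0 :> R by rewrite pnatr_eq0 -lt0n fact_gt0.
rewrite [_`!%:R * _]mulrC mulrAC mulfK//.
elim: n {f0} => [|n ih].
  by rewrite !pochhammer0 ?divff ?gt_eqF ?moment_gt0//; lra.
rewrite !pochhammerS; [|lra..]; rewrite invfM mulrACA ih (momentS n.+1) mulrA.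
by congr (_ / _ * _ / _); rewrite -natr1; lra.
Qed.

End GammaRecursion.

(** * Analytic continuation on the slit plane *)

Section ComplexPowerSeries.
Context {R : realType}.
Implicit Types (z l w : R[i]) (c : nat -> R[i]).

Lemma normcE_real z : `|z| = (normc z)%:C.
Proof. by []. Qed.

Lemma normc_ge0 z : 0 <= normc z.
Proof. by case: z => a b; exact: sqrtr_ge0. Qed.

Lemma normcX z n : normc (z ^+ n) = normc z ^+ n.
Proof. by elim: n => [|n ih]; rewrite ?expr0 ?normc1// !exprS normcM ih. Qed.

Lemma normcR (x : R) : normc x%:C = `|x|.
Proof. by rewrite /= expr0n/= addr0 sqrtr_sqr. Qed.

Lemma normc_triangle z w : normc (z + w) <= normc z + normc w.
Proof. exact: le_normcD. Qed.

Lemma normc_opp z : normc (- z) = normc z.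
Proof. exact: normcN. Qed.

Lemma Re_le_normc z : `|complex.Re z| <= normc z.
Proof. by rewrite -lecR; exact: normc_ge_Re. Qed.

Lemma Im_le_normc z : `|complex.Im z| <= normc z.
Proof. by case: z => a b /=; rewrite -sqrtr_sqr ler_wsqrtr// lerDr sqr_ge0. Qed.

Lemma normc_le_ReIm (a b : R) : normc (a +i* b) <= `|a| + `|b|.
Proof.
rewrite /= -[leRHS]ger0_norm ?addr_ge0// -sqrtr_sqr ler_wsqrtr//.
rewrite sqrrD !real_normK ?num_real// lerD2r lerDl.
by rewrite mulrn_wge0// mulr_ge0.
Qed.

(** The norm of [R[i]] takes values in [R[i]], where a positive element has imaginary part 0;
    convergence can thus be tested with real bounds. *)
Lemma power_series_sumP c z l : has_power_series_sum c z l <->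
  forall e : R, 0 < e -> exists N, forall n, (N <= n)%N ->
    normc (l - \sum_(0 <= k < n) c k * z ^+ k) < e.
Proof.
rewrite /has_power_series_sum; split.
  move=> /cvgrPdist_lt h e e0.
  have e0' : 0 < e%:C by rewrite ltcR.
  have [N _ hN] := h _ e0'.
  by exists N => n Nn; have := hN n Nn; rewrite /= normcE_real ltcR.
move=> h; apply/cvgrPdist_lt => -[e e'] /=; rewrite ltcE/= => /andP[/eqP -> e0].
have [N hN] := h e e0; exists N => // n /= Nn.
by rewrite normcE_real complexr0 ltcR; exact: hN.
Qed.

Lemma has_power_series_sum_unique c z l l' :
  has_power_series_sum c z l -> has_power_series_sum c z l' -> l = l'.
Proof.
move=> /power_series_sumP h /power_series_sumP h'.
apply/eqP; rewrite -subr_eq0; apply/eqP/eq0_normc/eqP.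
rewrite eq_le normc_ge0 andbT; apply/ler_addgt0Pr => e e0; rewrite add0r.
have e20 : 0 < e / 2 by rewrite divr_gt0.
have [N hN] := h _ e20; have [N' hN'] := h' _ e20.
set s := \sum_(0 <= k < maxn N N') c k * z ^+ k.
have -> : l - l' = (l - s) - (l' - s) by rewrite opprB addrA subrK.
apply: (le_trans (normc_triangle _ _)); rewrite normc_opp [leRHS]splitr ltW// ltrD//.
  exact/hN/leq_maxl.
exact/hN'/leq_maxr.
Qed.

Lemma has_power_series_sumB c d z l m : has_power_series_sum c z l ->
  has_power_series_sum d z m ->
  has_power_series_sum (fun k => c k - d k) z (l - m).
Proof.
move=> /power_series_sumP h /power_series_sumP h'; apply/power_series_sumP => e e0.
have e20 : 0 < e / 2 by rewrite divr_gt0.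
have [N hN] := h _ e20; have [N' hN'] := h' _ e20.
exists (maxn N N') => n; rewrite geq_max => /andP[Nn Nn'].
under eq_bigr do rewrite mulrBl.
rewrite sumrB.
set s := \sum_(_ <= _ < _) (c _ * _); set s' := \sum_(_ <= _ < _) (d _ * _).
have -> : l - m - (s - s') = (l - s) - (m - s') by ring.
apply: (le_lt_trans (normc_triangle _ _)); rewrite normc_opp [ltRHS]splitr.
by rewrite ltrD ?hN ?hN'.
Qed.

Lemma has_power_series_sumZ c z l w : has_power_series_sum c z l ->
  has_power_series_sum (fun k => w * c k) z (w * l).
Proof.
move=> /power_series_sumP h; apply/power_series_sumP => e e0.
have w0 : 0 < normc w + 1 by rewrite ltr_wpDl ?normc_ge0.
have [N hN] := h _ (divr_gt0 e0 w0).
exists N => n Nn; under eq_bigr do rewrite -mulrA.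
rewrite -mulr_sumr -mulrBr normcM; have := hN n Nn.
set x := normc (l - _); have x0 : 0 <= x by exact: normc_ge0.
rewrite ltr_pdivlMr// => h1; apply: le_lt_trans h1.
by rewrite mulrC ler_wpM2l// lerDl.
Qed.

(** A term is the difference of two consecutive remainders, hence of modulus at most 2 from some
    index on; [M] adds the finitely many earlier terms. *)
Lemma power_series_coef_bounded c (rho : R) l : 0 < rho ->
  has_power_series_sum c rho%:C l -> exists M : R, forall k, normc (c k) * rho ^+ k <= M.
Proof.
move=> rho0 /power_series_sumP h.
have [N hN] := h 1 ltr01.
pose M := \sum_(0 <= k < N) (normc (c k) * rho ^+ k) + 2.
have t0 k : 0 <= normc (c k) * rho ^+ k by rewrite mulr_ge0 ?normc_ge0 ?exprn_ge0// ltW.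
exists M => k; have [kN|Nk] := ltnP k N.
  rewrite /M (bigD1_seq k)/= ?iota_uniq ?mem_index_iota// -addrA lerDl.
  by rewrite addr_ge0// sumr_ge0// => j _; exact: t0.
apply: (@le_trans _ _ 2); last by rewrite /M lerDr sumr_ge0.
have -> : normc (c k) * rho ^+ k = normc (c k * rho%:C ^+ k).
  by rewrite normcM normcX normcR gtr0_norm.
have -> : c k * rho%:C ^+ k = (l - \sum_(0 <= j < k) c j * rho%:C ^+ j) -
    (l - \sum_(0 <= j < k.+1) c j * rho%:C ^+ j).
  by rewrite big_nat_recr//=; ring.
apply: (le_trans (normc_triangle _ _)); rewrite normc_opp.
have -> : (2 : R) = 1 + 1 by [].
by apply: lerD; apply/ltW/hN => //; exact: leq_trans (leqnSn _).
Qed.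

(** An identity theorem that uses only real points on one side of the centre, which is where two
    continuations are known to agree at the end of an interval. Once the lower coefficients vanish,
    |c_k| s^k is O(theta) for every small theta. *)
Lemma power_series_zero c (rho : R) : 0 < rho ->
  (forall x : R, 0 < x < rho -> has_power_series_sum c x%:C 0) ->
  forall k, c k = 0.
Proof.
move=> rho0 h; pose s := rho / 2.
have s0 : 0 < s by rewrite divr_gt0.
have sr : s < rho by rewrite /s; lra.
have hs : 0 < s < rho by rewrite s0.
have [M hM] := power_series_coef_bounded s0 (h s hs).
move=> k; elim/ltn_ind: k => k ih.
apply/eq0_normc/eqP; rewrite eq_le normc_ge0 andbT.
have M0 : 0 <= M.
  by apply: le_trans (hM 0%N); rewrite expr0 mulr1 normc_ge0.
have sk : 0 < s ^+ k by rewrite exprn_gt0.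
(* Evaluating at theta s and dividing by theta^k leaves c_k plus a tail of size O(theta). *)
have key (theta : R) : 0 < theta -> theta <= 1 / 2 ->
    normc (c k) * s ^+ k <= (2 * M + 1) * theta.
  move=> th0 th1.
  have xr : 0 < theta * s < rho by rewrite mulr_gt0//=; nra.
  (* The partial sum is taken so long that its error is below theta^(k+1), the order of the tail. *)
  have [N hN] := (power_series_sumP _ _ _).1 (h _ xr) _ (exprn_gt0 k.+1 th0).
  have := hN (maxn N k.+1) (leq_maxl _ _); rewrite sub0r normc_opp.
  rewrite (@big_cat_nat _ _ _ k.+1)//= ?leq_maxr// big_nat_recr//=.
  rewrite [X in X + _ + _]big1_seq; last first.
    by move=> j; rewrite mem_index_iota => /andP[_ jk]; rewrite ih// mul0r.
  rewrite add0r; set T := \sum_(_ <= _ < _) _ => hlt.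
  have hT : normc T <= 2 * M * theta ^+ k.+1.
    (* The bound telescopes: for theta <= 1/2 one has p <= 2 (p - theta p), with p a power of
       theta. *)
    have tail m : normc (\sum_(k.+1 <= j < k.+1 + m) c j * (theta * s)%:C ^+ j) <=
        2 * M * (theta ^+ k.+1 - theta ^+ (k.+1 + m)).
      elim: m => [|m ihm].
        by rewrite addn0 big_geq// normc0 subrr mulr0.
      rewrite addnS big_nat_recr ?leq_addr//=; apply: (le_trans (normc_triangle _ _)).
      have h2 : normc (c (k.+1 + m)%N * (theta * s)%:C ^+ (k.+1 + m)) <=
          M * theta ^+ (k.+1 + m).
        rewrite normcM normcX normcR ger0_norm ?(ltW (mulr_gt0 th0 s0))//.
        by rewrite exprMn mulrCA mulrC ler_wpM2r ?hM// exprn_ge0// ltW.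
      apply: (le_trans (lerD ihm h2)); rewrite [theta ^+ (k.+1 + m).+1]exprS.
      set p := theta ^+ (k.+1 + m); set q := theta ^+ k.+1.
      have p0 : 0 <= M * p by rewrite mulr_ge0// exprn_ge0// ltW.
      have := ler_wpM2r p0 th1; nra.
    rewrite /T -(subnKC (leq_maxr N k.+1)); apply: (le_trans (tail _)).
    by rewrite ler_wpM2l ?mulr_ge0// gerBl exprn_ge0// ltW.
  have e1 : normc (c k * (theta * s)%:C ^+ k) = normc (c k) * s ^+ k * theta ^+ k.
    rewrite normcM normcX normcR ger0_norm ?(ltW (mulr_gt0 th0 s0))// exprMn; ring.
  have : normc (c k) * s ^+ k * theta ^+ k <= theta ^+ k.+1 + 2 * M * theta ^+ k.+1.
    rewrite -e1 (_ : c k * _ = c k * (theta * s)%:C ^+ k + T - T); last by rewrite addrK.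
    by apply: (le_trans (normc_triangle _ _)); rewrite normc_opp lerD// ltW.
  rewrite exprSr => h1; rewrite -(ler_pM2r (exprn_gt0 k th0)).
  apply: (le_trans h1); rewrite le_eqVlt; apply/orP; left; apply/eqP; ring.
suff : normc (c k) * s ^+ k <= 0 by rewrite pmulr_lle0.
apply/ler_addgt0Pr => e e0; rewrite add0r.
pose theta := Num.min (1 / 2) (e / (2 * M + 1)).
have M1 : 0 < 2 * M + 1 by lra.
have th0 : 0 < theta by rewrite lt_min !divr_gt0.
apply: (le_trans (key theta th0 _)); first by rewrite ge_min lexx.
by rewrite mulrC -ler_pdivlMr// ge_min lexx orbT.
Qed.

Lemma has_power_series_sum0 c z l : (forall k, c k = 0) ->
  has_power_series_sum c z l -> l = 0.
Proof.
move=> c0 h; apply: (has_power_series_sum_unique h); apply/power_series_sumP => e e0.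
by exists 0%N => n _; rewrite big1 ?subrr ?normc0// => k _; rewrite c0 mul0r.
Qed.

Lemma slit_planeN (x : R) : 0 <= x -> slit_plane (- x)%:C.
Proof. by move=> x0 [y [y1 [e]]]; lra. Qed.

(* The supremum of the x such that F = G on [-x,0] is infinite: at a finite
   supremum the two expansions agree on one side, hence everywhere near it. *)
Lemma analytic_eq_Nray (F G : R[i] -> R[i]) :
  analytic_on slit_plane F -> analytic_on slit_plane G ->
  (forall z, `|z| < 1 -> F z = G z) ->
  forall x : R, 0 <= x -> F (- x)%:C = G (- x)%:C.
Proof.
move=> aF aG FG A A0; apply: contrapT => FGA.
pose S := [set x : R | 0 <= x /\ forall y, 0 <= y <= x -> F (- y)%:C = G (- y)%:C].
have Slt x : S x -> x < A.
  by move=> [x0 hx]; rewrite ltNge; apply/negP => Ax; apply: FGA; apply: hx; rewrite A0.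
have S1 : S (1 / 2).
  split; first by lra.
  move=> y /andP[y0 y1]; apply: FG.
  by rewrite normcE_real ltcR normcR normrN ger0_norm//; lra.
have hS : has_sup S by split; [exists (1 / 2)|exists A => x /Slt/ltW].
set s := sup S.
have s1 : 1 / 2 <= s by exact: ub_le_sup hS.2 _ S1.
have s0 : 0 < s by lra.
have below y : 0 <= y -> y < s -> F (- y)%:C = G (- y)%:C.
  move=> y0 ys; have sy0 : 0 < s - y by rewrite subr_gt0.
  have [x Sx] := sup_adherent sy0 hS.
  rewrite -/s subKr => yx; apply: Sx.2.
  by rewrite y0 ltW.
have [r [r0 [c hc]]] := aF _ (slit_planeN (ltW s0)).
have [r' [r0' [c' hc']]] := aG _ (slit_planeN (ltW s0)).
pose t := Num.min r r'.
have t0 : 0 < t by rewrite lt_min r0.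
have sumB z : normc (z - (- s)%:C) < t ->
    has_power_series_sum (fun k => c k - c' k) (z - (- s)%:C) (F z - G z).
  rewrite lt_min => /andP[h h'].
  by apply: has_power_series_sumB; [apply: hc|apply: hc']; rewrite normcE_real ltcR.
(* Agreement is known for y < s, that is, at the positive displacements s - y from the centre -s. *)
have eR (y : R) : (- y)%:C - (- s)%:C = (s - y)%:C :> R[i].
  by rewrite -rmorphB opprK addrC.
have d0 : forall k, c k - c' k = 0.
  apply: (@power_series_zero _ (Num.min t s)); first by rewrite lt_min t0.
  move=> x /andP[x0]; rewrite lt_min => /andP[xt xs].
  have := sumB (- (s - x))%:C; rewrite eR subKr normcR gtr0_norm// => /(_ xt).
  by rewrite below ?subrr ?subr_ge0 ?gtrBl ?(ltW xs).
have near y : `|s - y| < t -> F (- y)%:C = G (- y)%:C.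
  move=> h; apply/eqP; rewrite -subr_eq0; apply/eqP.
  by apply: (has_power_series_sum0 d0); apply: sumB; rewrite eR normcR.
have : S (s + t / 2).
  split; first by rewrite addr_ge0 ?divr_ge0 ?ltW.
  move=> y /andP[y0 y1]; have [ys|sy] := ltP y s; first exact: below.
  by apply: near; rewrite distrC ger0_norm ?subr_ge0//; lra.
move=> /(ub_le_sup hS.2); rewrite -/s; lra.
Qed.

End ComplexPowerSeries.

(** * Stieltjes transforms as analytic continuations *)

Section Stieltjes.
Context {R : realType}.
Local Notation mu := (@lebesgue_measure R).
Local Notation Re := complex.Re.
Local Notation Im := complex.Im.
Implicit Types (phi psi : R -> R[i]) (z w : R[i]) (j n k : nat).

(** A class of complex integrands that is closed under sums and products and whose real and
    imaginary parts are integrable against every [weight j]. *)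
Definition bounded_continuous phi := [/\ continuous (fun v => Re (phi v)),
  continuous (fun v => Im (phi v)) & exists M : R, forall v, normc (phi v) <= M].

Lemma bcD phi psi : bounded_continuous phi -> bounded_continuous psi ->
  bounded_continuous (fun v => phi v + psi v).
Proof.
move=> [r1 i1 [M1 h1]] [r2 i2 [M2 h2]]; split.
- under eq_fun do rewrite raddfD/=; exact: continuous_addf.
- under eq_fun do rewrite raddfD/=; exact: continuous_addf.
- by exists (M1 + M2) => v; apply: le_trans (normc_triangle _ _) (lerD (h1 v) (h2 v)).
Qed.

Lemma ReM z w : Re (z * w) = Re z * Re w - Im z * Im w.
Proof. by case: z w => a b [c d]. Qed.

Lemma ImM z w : Im (z * w) = Re z * Im w + Im z * Re w.
Proof. by case: z w => a b [c d]. Qed.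

Lemma bcM phi psi : bounded_continuous phi -> bounded_continuous psi ->
  bounded_continuous (fun v => phi v * psi v).
Proof.
move=> [r1 i1 [M1 h1]] [r2 i2 [M2 h2]]; split.
- under eq_fun do rewrite ReM; apply: continuous_subf; exact: continuous_mulf.
- under eq_fun do rewrite ImM; apply: continuous_addf; exact: continuous_mulf.
- by exists (M1 * M2) => v; rewrite normcM ler_pM ?normc_ge0.
Qed.

Lemma bc_cst z : bounded_continuous (fun=> z).
Proof. by split; [exact: continuous_cstf|exact: continuous_cstf|exists (normc z)]. Qed.

Lemma bcX phi n : bounded_continuous phi -> bounded_continuous (fun v => phi v ^+ n).
Proof.
move=> h; elim: n => [|n ih]; first exact: bc_cst.
by under eq_fun do rewrite exprS; exact: bcM.
Qed.

Lemma bc_slope : bounded_continuous (fun v => (slope v)%:C).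
Proof.
split; [exact: continuous_slope|exact: continuous_cstf|exists 1 => v].
by rewrite normcR ger0_norm ?slope_ge0// ltW// slope_lt1.
Qed.

Lemma ReV z : Re z^-1 = Re z / (Re z ^+ 2 + Im z ^+ 2).
Proof. by case: z. Qed.

Lemma ImV z : Im z^-1 = - (Im z / (Re z ^+ 2 + Im z ^+ 2)).
Proof. by case: z => a b /=. Qed.

Lemma bcV phi (d : R) : 0 < d -> (forall v, d <= normc (phi v)) ->
  bounded_continuous phi -> bounded_continuous (fun v => (phi v)^-1).
Proof.
move=> d0 hd [r1 i1 _].
have n0 v : Re (phi v) ^+ 2 + Im (phi v) ^+ 2 != 0.
  have := lt_le_trans d0 (hd v); case: (phi v) => a b /=.
  by rewrite sqrtr_gt0 => /lt0r_neq0.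
have cn : continuous (fun v => Re (phi v) ^+ 2 + Im (phi v) ^+ 2).
  by apply: continuous_addf; exact: continuous_expf.
split.
- under eq_fun do rewrite ReV; apply: continuous_mulf => //; exact: continuous_invf.
- under eq_fun do rewrite ImV; apply: continuous_oppf; apply: continuous_mulf => //.
  exact: continuous_invf.
- by exists d^-1 => v; rewrite normcV lef_pV2 ?posrE// (lt_le_trans d0).
Qed.

(** The case j = 0 serves the parameters 1/2, 1, 3/4, and j = 1 the parameters 1, 3/2, 7/4, whose
    coefficients are the shifted moments. *)
Definition weight j v : R := slope v ^+ j * pw (- (3 / 4)) v.

Lemma weight_ge0 j v : 0 <= weight j v.
Proof. by rewrite mulr_ge0 ?exprn_ge0 ?slope_ge0 ?pw_ge0. Qed.

Lemma integrable_weight j (f : R -> R) (M : R) : continuous f ->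
  (forall v, `|f v| <= M) ->
  mu.-integrable `]0, +oo[ (EFin \o (fun v => f v * weight j v)).
Proof.
move=> cf fM; apply: (@integrable_mulf _ _ M); first exact: measurable_itvR.
- exact: measurable_continuous.
- by move=> v _; exact: fM.
- exact: integrable_moment.
Qed.

Definition cint j phi : R[i] :=
  (\int[mu]_(v in `]0, +oo[) (Re (phi v) * weight j v)) +i*
  (\int[mu]_(v in `]0, +oo[) (Im (phi v) * weight j v)).

Lemma integrable_Re j phi : bounded_continuous phi ->
  mu.-integrable `]0, +oo[ (EFin \o (fun v => Re (phi v) * weight j v)).
Proof.
move=> [r _ [M h]]; apply: (@integrable_weight _ _ M) => // v.
exact: le_trans (Re_le_normc _) (h v).
Qed.

Lemma integrable_Im j phi : bounded_continuous phi ->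
  mu.-integrable `]0, +oo[ (EFin \o (fun v => Im (phi v) * weight j v)).
Proof.
move=> [_ r [M h]]; apply: (@integrable_weight _ _ M) => // v.
exact: le_trans (Im_le_normc _) (h v).
Qed.

Lemma cintD j phi psi : bounded_continuous phi -> bounded_continuous psi ->
  cint j (fun v => phi v + psi v) = cint j phi + cint j psi.
Proof.
move=> h1 h2; rewrite /cint; apply/eqP; rewrite eq_complex /=; apply/andP.
split; apply/eqP; under eq_Rintegral do rewrite raddfD/= mulrDl.
  by rewrite RintegralD//; exact: integrable_Re.
by rewrite RintegralD//; exact: integrable_Im.
Qed.

Lemma cintZ j phi z : bounded_continuous phi ->
  cint j (fun v => z * phi v) = z * cint j phi.
Proof.
move=> h; have iR := integrable_Re j h; have iI := integrable_Im j h.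
case: z => a b; rewrite /cint; apply/eqP; rewrite eq_complex /=; apply/andP.
split; apply/eqP.
  under eq_Rintegral do rewrite ReM/= mulrBl -!mulrA.
  rewrite RintegralB//; [|exact: integrable_scalef (measurable_itvR _) _..].
  by rewrite !RintegralZf//; exact: measurable_itvR.
under eq_Rintegral do rewrite ImM/= mulrDl -!mulrA.
rewrite RintegralD//; [|exact: integrable_scalef (measurable_itvR _) _..].
by rewrite !RintegralZf//; exact: measurable_itvR.
Qed.

Lemma cint0 j : cint j (fun=> 0) = 0.
Proof.
rewrite /cint; apply/eqP; rewrite eq_complex /=.
under eq_Rintegral do rewrite mul0r.
by rewrite Rintegral_cst ?mul0r ?eqxx//; exact: measurable_itvR.
Qed.

Lemma bc_sum (phi : nat -> R -> R[i]) n : (forall k, bounded_continuous (phi k)) ->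
  bounded_continuous (fun v => \sum_(0 <= k < n) phi k v).
Proof.
move=> h; elim: n => [|n ih].
  by under eq_fun do rewrite big_geq//; exact: bc_cst.
by under eq_fun do rewrite big_nat_recr//=; exact: bcD.
Qed.

Lemma cint_sum j (phi : nat -> R -> R[i]) n : (forall k, bounded_continuous (phi k)) ->
  cint j (fun v => \sum_(0 <= k < n) phi k v) = \sum_(0 <= k < n) cint j (phi k).
Proof.
move=> h; elim: n => [|n ih].
  by rewrite big_geq//; under eq_fun do rewrite big_geq//; exact: cint0.
under eq_fun do rewrite big_nat_recr//=.
by rewrite cintD ?big_nat_recr//= ?ih//; exact: bc_sum.
Qed.

Lemma moment_weight j : moment j = \int[mu]_(v in `]0, +oo[) weight j v.
Proof. by []. Qed.

(** The factor 2 comes from estimating the real and imaginary parts separately. *)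
Lemma normc_cint j phi (M : R) : bounded_continuous phi ->
  (forall v, normc (phi v) <= M) -> normc (cint j phi) <= 2 * (M * moment j).
Proof.
move=> h hM; apply: (le_trans (normc_le_ReIm _ _)).
have bnd (f : R -> R) : continuous f -> (forall v, `|f v| <= M) ->
    `|\int[mu]_(v in `]0, +oo[) (f v * weight j v)| <= M * moment j.
  move=> cf fM; have intf := integrable_weight j cf fM.
  apply: (le_trans (le_normr_Rintegral (measurable_itvR _) intf)).
  rewrite moment_weight -(RintegralZf M (measurable_itvR _) (integrable_moment j)).
  apply: le_Rintegral; first exact: measurable_itvR.
  - exact: integrable_norm intf.
  - exact: integrable_scalef (measurable_itvR _) (integrable_moment j).
  - by move=> v _; rewrite normrM [`|weight _ _|]ger0_norm ?weight_ge0// ler_wpM2r ?weight_ge0.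
have [r i _] := h.
by rewrite mulr_natl mulr2n lerD// bnd// => v;
  [apply: le_trans (Re_le_normc _) (hM v)|apply: le_trans (Im_le_normc _) (hM v)].
Qed.

Lemma real_denomE (x t : R) : 1 - x%:C * t%:C = (1 - x * t)%:C.
Proof. by apply/eqP; rewrite eq_complex /= !(mulr0, mul0r, subr0, addr0) !eqxx. Qed.

Definition stieltjes j z : R[i] := cint j (fun v => (1 - z * (slope v)%:C)^-1).

(** With t = [slope v], the integrand t^k / (1 - z t)^(k+1) is the k-th Taylor coefficient at z of
    1/(1 - z t). *)
Definition stieltjes_coef j z k : R[i] :=
  cint j (fun v => (slope v)%:C ^+ k * ((1 - z * (slope v)%:C)^-1) ^+ k.+1).

Lemma bc_denom z : bounded_continuous (fun v => 1 - z * (slope v)%:C).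
Proof.
under eq_fun do rewrite -mulNr.
by apply: bcD; [exact: bc_cst|apply: bcM; [exact: bc_cst|exact: bc_slope]].
Qed.

(* The expansion of 1/(1 - z t) around z0 is a geometric series in
   t (z - z0)/(1 - z0 t), whose ratio is at most |z - z0|/d. *)
Lemma stieltjes_power_series j z0 (d : R) :
  (forall v, d <= normc (1 - z0 * (slope v)%:C)) ->
  forall z, normc (z - z0) < d ->
  has_power_series_sum (stieltjes_coef j z0) (z - z0) (stieltjes j z).
Proof.
move=> hd z zd; have d0 : 0 < d by exact: le_lt_trans (normc_ge0 _) zd.
set rho := normc (z - z0) / d.
have rho0 : 0 <= rho by rewrite divr_ge0 ?normc_ge0 ?(ltW d0).
have rho1 : rho < 1 by rewrite ltr_pdivrMr// mul1r.
(* A lower bound for |1 - z t|, by the triangle inequality, which makes the integrand at z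
   bounded. *)
set eta := d - normc (z - z0).
have eta0 : 0 < eta by rewrite subr_gt0.
pose a v : R[i] := 1 - z0 * (slope v)%:C.
pose b v : R[i] := (slope v)%:C * (z - z0) / a v.
pose q v : R[i] := 1 - z * (slope v)%:C.
have nslope (v : R) : normc (slope v)%:C <= 1.
  by rewrite normcR ger0_norm ?slope_ge0// ltW// slope_lt1.
have a0 v : a v != 0.
  apply/eqP => av; have := lt_le_trans d0 (hd v).
  by rewrite -/(a v) av normc0 ltxx.
have hq v : eta <= normc (q v).
  have -> : q v = a v - (slope v)%:C * (z - z0) by rewrite /q /a; ring.
  have := normc_triangle (a v - (slope v)%:C * (z - z0)) ((slope v)%:C * (z - z0)).
  rewrite subrK normcM => h; rewrite /eta lerBlDr.
  apply: (le_trans (hd v)); apply: (le_trans h); rewrite lerD2l.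
  by rewrite ler_piMl ?normc_ge0 ?nslope.
have q0 v : q v != 0.
  apply/eqP => qv; have := lt_le_trans eta0 (hq v).
  by rewrite qv normc0 ltxx.
have hb v : normc (b v) <= rho.
  rewrite /b !normcM normcV; apply: ler_pM; rewrite ?mulr_ge0 ?normc_ge0 ?invr_ge0//.
    by rewrite normc_ge0.
    by rewrite ler_piMl ?normc_ge0 ?nslope.
  by rewrite lef_pV2 ?posrE ?hd// (lt_le_trans d0 (hd v)).
have bca : bounded_continuous (fun v => (a v)^-1).
  by apply: (bcV d0 hd); exact: bc_denom.
have bcq : bounded_continuous (fun v => (q v)^-1).
  by apply: (bcV eta0 hq); exact: bc_denom.
have bcb : bounded_continuous b.
  by apply: bcM => //; apply: bcM; [exact: bc_slope|exact: bc_cst].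
pose term k v : R[i] := (slope v)%:C ^+ k * ((a v)^-1) ^+ k.+1.
have bct k : bounded_continuous (term k).
  by apply: bcM; apply: bcX => //; exact: bc_slope.
(* The geometric sum is kept finite with its exact remainder: only finite sums are integrated, and
   convergence reduces to a uniform bound on the remainder. *)
have geo n v : (q v)^-1 = \sum_(0 <= k < n) (z - z0) ^+ k * term k v + b v ^+ n * (q v)^-1.
  elim: n => [|n ih]; first by rewrite big_geq// add0r expr0 mul1r.
  rewrite big_nat_recr//= {1}ih -addrA; congr (_ + _).
  have -> : (z - z0) ^+ n * term n v = b v ^+ n * (a v)^-1.
    by rewrite /term /b !exprMn exprSr; ring.
  rewrite exprSr -mulrA -mulrDr; congr (_ * _).
  have qa : q v = a v * (1 - b v).
    by rewrite mulrBr mulr1 /b mulrCA divff// mulr1 /q /a; ring.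
  have b1 : 1 - b v != 0.
    by apply/eqP => h; move: (q0 v); rewrite qa h mulr0 eqxx.
  by rewrite qa; field; rewrite a0 b1.
have dec n : stieltjes j z - \sum_(0 <= k < n) stieltjes_coef j z0 k * (z - z0) ^+ k =
    cint j (fun v => b v ^+ n * (q v)^-1).
  rewrite /stieltjes; under eq_fun do rewrite -/(q _) (geo n).
  have bt k : bounded_continuous (fun v => (z - z0) ^+ k * term k v).
    by apply: bcM => //; exact: bc_cst.
  rewrite cintD; [|exact: bc_sum|by apply: bcM => //; exact: bcX].
  rewrite cint_sum//; under eq_bigr do rewrite cintZ//.
  have -> : \sum_(0 <= k < n) stieltjes_coef j z0 k * (z - z0) ^+ k =
      \sum_(0 <= k < n) (z - z0) ^+ k * cint j (term k).
    by apply: eq_bigr => k _; rewrite mulrC.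
  by rewrite addrC addKr.
apply/power_series_sumP => e e0.
have m0 : 0 < moment j :> R by exact: moment_gt0.
have C0 : 0 < 2 * (eta^-1 * moment j) by rewrite !mulr_gt0 ?invr_gt0.
have cv : (fun n => rho ^+ n) @ \oo --> (0 : R).
  by apply: cvg_expr; rewrite ger0_norm.
move/cvgrPdist_lt : cv => /(_ _ (divr_gt0 e0 C0))[N _ hN].
exists N => n Nn; rewrite dec.
have bn v : normc (b v ^+ n * (q v)^-1) <= rho ^+ n * eta^-1.
  rewrite normcM normcX normcV ler_pM ?exprn_ge0 ?invr_ge0 ?normc_ge0//.
    by rewrite lerXn2r ?nnegrE ?normc_ge0.
  by rewrite lef_pV2 ?posrE ?hq// (lt_le_trans eta0 (hq v)).
apply: (le_lt_trans (normc_cint j _ bn)).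
  by apply: bcM => //; exact: bcX.
have := hN n Nn; rewrite /= sub0r normrN ger0_norm ?exprn_ge0//.
rewrite ltr_pdivlMr//; apply: le_lt_trans; rewrite le_eqVlt; apply/orP; left; apply/eqP; ring.
Qed.

(** Let z = x + i y. If y = 0 then x < 1, and 1 - x t is at least min(1, 1 - x) for t in [0,1).
    Otherwise, for t at most 1/(2 (|x| + 1)) the real part of 1 - z t is at least 1/2, and for
    larger t the imaginary part has modulus |y| t. *)
Lemma slit_plane_dist z : slit_plane z ->
  exists2 d : R, 0 < d & forall v : R, d <= normc (1 - z * (slope v)%:C).
Proof.
case: z => x y sz.
have [y0|y0] := eqVneq y 0.
  have x1 : x < 1.
    rewrite ltNge; apply/negP => x1; apply: sz; exists x; split => //.
    by rewrite y0 complexr0.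
  exists (Num.min 1 (1 - x)); first by rewrite lt_min ltr01 subr_gt0.
  move=> v; rewrite y0 complexr0 real_denomE normcR.
  have t0 := slope_ge0 v; have t1 := ltW (slope_lt1 v).
  apply: le_trans (ler_norm _).
  rewrite ge_min; apply/orP; have [x0|x0] := leP x 0; [left|right]; nra.
pose d := Num.min (1 / 2) (`|y| / (2 * (`|x| + 1))).
have x1 : 0 < 2 * (`|x| + 1) by rewrite mulr_gt0// ltr_wpDl.
have y1 : 0 < `|y| by rewrite normr_gt0.
exists d; first by rewrite lt_min divr_gt0//= divr_gt0.
move=> v; have t0 := slope_ge0 v; set t := slope v in t0 *.
have [ht|ht] := leP (t * (2 * (`|x| + 1))) 1.
  apply: (@le_trans _ _ (1 / 2)); first by rewrite ge_min lexx.
  apply: (le_trans _ (Re_le_normc _)); rewrite /= mulr0 subr0.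
  apply: le_trans (ler_norm _).
  have := ler_norm x; have := normr_ge0 x; nra.
apply: (@le_trans _ _ (`|y| / (2 * (`|x| + 1)))); first by rewrite ge_min lexx orbT.
apply: (le_trans _ (Im_le_normc _)); rewrite /= mulr0 ?add0r ?sub0r normrN normrM.
rewrite ler_wpM2l// ger0_norm// -[leLHS]mul1r ler_pdivrMr//; exact: ltW.
Qed.

(** The expansion of the transform at 0 has the moments from index j on as coefficients, and its
    expansions at the other points of the slit plane give analyticity. *)
Lemma is_hyp2f1_stieltjes j (a b c : R) :
  (forall n, hyp2f1_coef a b c n = moment (j + n) / moment j) ->
  is_hyp2f1 a b c (fun z => ((moment j)^-1)%:C * stieltjes j z).
Proof.
move=> hc; split.
  move=> z0 /slit_plane_dist[d d0 hd]; exists d; split => //.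
  exists (fun k => ((moment j)^-1)%:C * stieltjes_coef j z0 k) => z.
  rewrite normcE_real ltcR => zd; apply: has_power_series_sumZ.
  exact: stieltjes_power_series hd _ zd.
move=> z; rewrite normcE_real -(rmorph1 (real_complex R)) ltcR => z1.
have hd (v : R) : 1 <= normc (1 - 0 * (slope v)%:C) by rewrite mul0r subr0 normc1.
have := @stieltjes_power_series j 0 1 hd z; rewrite subr0 => /(_ z1).
move=> /has_power_series_sumZ => /(_ ((moment j)^-1)%:C).
congr (has_power_series_sum _ _ _); apply/funext => k.
rewrite hc mulrC rmorphM/=; congr (_ * _).
rewrite /stieltjes_coef /cint.
under [X in X +i* _]eq_Rintegral do rewrite mul0r subr0 invr1 expr1n mulr1 -rmorphXn/=.
under [X in _ +i* X]eq_Rintegral do rewrite mul0r subr0 invr1 expr1n mulr1 -rmorphXn/= mul0r.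
rewrite Rintegral_cst ?mul0r; last exact: measurable_itvR.
rewrite complexr0; congr (_%:C); rewrite /moment; apply: eq_Rintegral => v _.
by rewrite /weight mulrA -exprD addnC.
Qed.

(** The transform witnesses that a continuation exists, and the one picked by choice agrees with it
    on the negative ray by [analytic_eq_Nray]. *)
Lemma HYP2F1_stieltjes j (a b c : R) (x : R) : 0 <= x ->
  (forall n, hyp2f1_coef a b c n = moment (j + n) / moment j) ->
  HYP2F1 a b c (- x)%:C = ((moment j)^-1)%:C * stieltjes j (- x)%:C.
Proof.
move=> x0 hc; have h := is_hyp2f1_stieltjes hc.
rewrite /HYP2F1; case: xgetP => [F _ [aF sF]|/(_ _ h)//].
have [aG sG] := h.
apply: (analytic_eq_Nray aF aG) => // z z1.
exact: has_power_series_sum_unique (sF z z1) (sG z z1).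
Qed.

Lemma stieltjes_Nray j (A : R) : stieltjes j (- A ^+ 2)%:C =
  (\int[mu]_(v in `]0, +oo[) (weight j v / (1 + A ^+ 2 * slope v)))%:C.
Proof.
rewrite /stieltjes /cint.
have e (v : R) : 1 - (- A ^+ 2)%:C * (slope v)%:C = (1 + A ^+ 2 * slope v)%:C :> R[i].
  by rewrite real_denomE mulNr opprK.
under [X in X +i* _]eq_Rintegral do rewrite e -fmorphV/= mulrC.
under [X in _ +i* X]eq_Rintegral do rewrite e -fmorphV/= mul0r.
by rewrite Rintegral_cst ?mul0r ?complexr0//; exact: measurable_itvR.
Qed.

End Stieltjes.

(** * The hypergeometric quotient and its limit *)

Section Threshold.
Context {R : realType}.
Local Notation mu := (@lebesgue_measure R).

(** Integrate A^2 t / (1 + A^2 t) = 1 - 1/(1 + A^2 t) with t = [slope v]. *)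
Lemma weight1_damped (A : R) :
  A ^+ 2 * \int[mu]_(v in `]0, +oo[) (weight 1 v / (1 + A ^+ 2 * slope v)) =
  moment 0 - damped A.
Proof.
have i1 : mu.-integrable `]0, +oo[
    (EFin \o (fun v : R => weight 1 v / (1 + A ^+ 2 * slope v))).
  have -> : (fun v : R => weight 1 v / (1 + A ^+ 2 * slope v)) =
      (fun v => (1 + A ^+ 2 * slope v)^-1 * weight 1 v).
    by apply/funext => v; rewrite mulrC.
  apply: (@integrable_weight _ _ _ 1); first exact: continuous_damped_kernel.
  by move=> v; exact: damped_kernel_le1.
rewrite -(RintegralZf (A ^+ 2) (measurable_itvR _) i1).
apply/eqP; rewrite eq_sym subr_eq; apply/eqP.
rewrite -(RintegralD (measurable_itvR _) (integrable_scalef (A ^+ 2) (measurable_itvR _) i1) (integrable_damped A)).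
apply: eq_Rintegral => v _; rewrite /weight expr0 expr1.
have d0 := lt0r_neq0 (damped_denom_gt0 A v).
by field; exact: d0.
Qed.

(** Normalising the two transforms contributes moment 0 / moment 1 = 3/2, which turns the factor 1/3
    into 1/2. *)
Lemma hyp_ratio (A : R) : 0 < A ->
  (1 / 3 * A)%:C * (HYP2F1 1 (3 / 2) (7 / 4) (- A ^+ 2)%:C
                    / HYP2F1 (1 / 2) 1 (3 / 4) (- A ^+ 2)%:C) =
  ((moment 0 - damped A) / (2 * (A * damped A)))%:C.
Proof.
move=> A0.
rewrite (@HYP2F1_stieltjes _ 1 _ _ _ _ (sqr_ge0 A)); last first.
  by move=> n; rewrite hyp2f1_coef_three_halves.
rewrite (@HYP2F1_stieltjes _ 0 _ _ _ _ (sqr_ge0 A)); last first.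
  by move=> n; rewrite hyp2f1_coef_half.
rewrite !stieltjes_Nray -!rmorphM -fmorphV -!rmorphM; congr (_%:C).
have -> : \int[mu]_(v in `]0, +oo[) (weight 0 v / (1 + A ^+ 2 * slope v)) = damped A.
  by rewrite /damped; apply: eq_Rintegral => v _; rewrite /weight expr0 mul1r.
rewrite -weight1_damped momentS.
set I := Rintegral _ _ _.
have m0 : moment 0 != 0 :> R by rewrite gt_eqF ?moment_gt0.
have D0 : damped A != 0 by rewrite gt_eqF// damped_gt0// moment_gt0.
have A1 := lt0r_neq0 A0.
by field; rewrite ?m0 ?D0 ?A1.
Qed.

(* The ratio at A is half of (moment 0 - D)/(A D) with D = damped A, and A D
   tends to arctan_total as A tends to infinity. *)
Lemma hyp_ratio_sup :
  ((half_length)^-1%:E <= ereal_sup [set y%:E | y in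
     [set y : R | exists A : R, (0 < A)%R /\
        y%:C = ((1 / 3 * A)%:C * (HYP2F1 1 (3 / 2) (7 / 4) (- A ^+ 2)%:C
                 / HYP2F1 (1 / 2) 1 (3 / 4) (- A ^+ 2)%:C))%R]])%E.
Proof.
have m0 : (0 : R) < moment 0 by exact: moment_gt0.
have P0 := @arctan_total_gt0 R; have L0 := @half_length_gt0 R.
set P := @arctan_total R in P0 *; set m := @moment R 0 in m0 *.
have cL : half_length^-1 = m / (2 * P).
  by rewrite /P -half_length_moment0 invfM mulrCA mulfV ?mulr1 ?gt_eqF.
rewrite cL; set S := ereal_sup _.
have low (k : R) : 0 < k -> (((m - k ^+ 2 * (P + k * m)) / (2 * (P + k * m)))%:E <= S)%E.
  move=> k0; have A0 : 0 < k ^- 2 by rewrite invr_gt0 exprn_gt0.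
  set A := k ^- 2 in A0.
  apply: (@le_trans _ _ ((m - damped A) / (2 * (A * damped A)))%:E); last first.
    apply: ereal_sup_ubound; exists ((m - damped A) / (2 * (A * damped A))) => //.
    by exists A; split => //; rewrite hyp_ratio.
  have D0 : 0 < damped A by exact: damped_gt0.
  have hD := damped_le k0; rewrite -/A in hD.
  have Q0 : 0 < P + k * m by rewrite ltr_wpDr// mulr_ge0 ?ltW.
  have AD0 : 0 < A * damped A by rewrite mulr_gt0.
  have kA : k ^+ 2 * A = 1 by rewrite /A mulfV// gt_eqF// exprn_gt0.
  have e : damped A = k ^+ 2 * (A * damped A) by rewrite mulrA kA mul1r.
  rewrite lee_fin {1}e; set X := A * damped A in hD AD0 *.
  have -> : (m - k ^+ 2 * X) / (2 * X) = m / 2 * X^-1 - k ^+ 2 / 2.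
    by field; exact: lt0r_neq0.
  have -> : (m - k ^+ 2 * (P + k * m)) / (2 * (P + k * m)) = m / 2 * (P + k * m)^-1 - k ^+ 2 / 2.
    by field; exact: lt0r_neq0.
  rewrite lerD2r ler_wpM2l ?divr_ge0 ?(ltW m0)//.
  by rewrite lef_pV2 ?posrE.
apply/lee_addgt0Pr => e e0.
(* The lower bound [low] is continuous in k at 0, where its value is the threshold; a small k > 0
   comes within e of it. *)
pose f (k : R) := (m - k ^+ 2 * (P + k * m)) / (2 * (P + k * m)).
have cf : f x @[x --> (0 : R)] --> f 0.
  apply: cvgM.
    apply: cvgB; first exact: cvg_cst.
    apply: cvgM; first exact: exprn_continuous.
    by apply: cvgD; [exact: cvg_cst|apply: cvgM; [exact: cvg_id|exact: cvg_cst]].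
  apply: cvgV; first by rewrite mul0r addr0 gt_eqF// mulr_gt0.
  apply: cvgM; first exact: cvg_cst.
  by apply: cvgD; [exact: cvg_cst|apply: cvgM; [exact: cvg_id|exact: cvg_cst]].
move/cvgrPdist_le : cf => /(_ _ e0) /nbhs_ballP[r /= r0 hr].
have r20 : 0 < r / 2 by rewrite divr_gt0.
have := hr (r / 2); rewrite /ball /= sub0r normrN gtr0_norm// => /(_ _).
have -> : f 0 = m / (2 * P) by rewrite /f expr0n/= !mul0r subr0 addr0.
move=> h; have {h}/ler_normlP[_ h] : `|m / (2 * P) - f (r / 2)| <= e by apply: h; lra.
apply: (@le_trans _ _ ((f (r / 2))%:E + e%:E)%E).
  by rewrite -EFinD lee_fin; lra.
by rewrite leeD2r// low.
Qed.

End Threshold.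

(** * Absolutely continuous functions *)

Section AbsolutelyContinuous.
Context {R : realType}.
Local Notation mu := (@lebesgue_measure R).
Implicit Types (f g v U k K phi : R -> R).

(** Composition with it extends a function on [0,1] by its end values, so that continuity can be
    stated on the whole line. *)
Definition clamp (x : R) : R := Num.max 0 (Num.min 1 x).

Lemma clamp_id x : 0 <= x <= 1 -> clamp x = x.
Proof. by case/andP => x0 x1; rewrite /clamp min_r// max_r. Qed.

Lemma clamp01 x : 0 <= clamp x <= 1.
Proof. by rewrite /clamp le_max lexx/= ge_max ler01/= ge_min lexx. Qed.

Lemma continuous_clamp : continuous clamp.
Proof.
move=> x; apply: (@continuous_max R R (fun=> 0) (fun x => Num.min 1 x)).
  exact: cvg_cst.
by apply: (@continuous_min R R (fun=> 1) id); [exact: cvg_cst|exact: cvg_id].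
Qed.

Lemma continuous_comp_clamp f : {within `[0, 1], continuous f} ->
  continuous (fun x => f (clamp x)).
Proof.
move=> /subspace_continuousP cf x.
have cx : `[0, 1]%classic (clamp x) by rewrite /= in_itv/= clamp01.
apply: cvg_comp (cf _ cx) => P hP.
have : \forall y \near x, `[0, 1]%classic (clamp y) -> P (clamp y) := continuous_clamp hP.
by apply: filterS => y /= h; apply: h; rewrite /= in_itv/= clamp01.
Qed.

Lemma uniformly_continuous01 f : continuous f -> forall e : R, 0 < e ->
  exists2 d : R, 0 < d & forall x y : R, 0 <= x <= 1 -> `|x - y| < d -> `|f x - f y| < e.
Proof.
move=> cf e e0.
(* Compactness in covering form: a radius d that works near each point works on all of [0,1] for d
   small enough. *)
have := (compact_near_coveringP _).1 (@segment_compact R 0 1) R (0%R : R)^'+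
  (fun d x => forall y, `|x - y| < d -> `|f x - f y| < e) _.
case=> [x _|d /= d0 hd].
  have e20 : 0 < e / 2 by rewrite divr_gt0.
  have /cvgrPdist_lt /(_ _ e20)/nbhs_ballP[r /= r0 hr] := cf x.
  have r20 : 0 < r / 2 by rewrite divr_gt0.
  exists (ball x (r / 2), [set d : R | d < r / 2]).
    split; first by apply/nbhs_ballP; exists (r / 2).
    exact: nbhs_right_lt.
  move=> [z d] /= [xz dr] y zy.
  have hz : `|f x - f z| < e / 2.
    by apply: hr; rewrite /ball/=; move: xz; rewrite /ball/=; lra.
  have hy : `|f x - f y| < e / 2.
    apply: hr; rewrite /ball/=; move: xz; rewrite /ball/= => xz.
    have -> : x - y = (x - z) + (z - y) by ring.
    by apply: le_lt_trans (ler_normD _ _) _; lra.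
  have -> : f z - f y = (f x - f y) - (f x - f z) by ring.
  by apply: le_lt_trans (ler_normB _ _) _; lra.
have d20 : 0 < d / 2 by rewrite divr_gt0.
exists (d / 2) => // x y x01.
apply: (hd (d / 2)) => //=; first by rewrite sub0r normrN gtr0_norm//; lra.
Qed.

Lemma integrable_sub01 v a b : 0 <= a -> b <= 1 ->
  mu.-integrable `[0, 1] (EFin \o v) -> mu.-integrable `[a, b] (EFin \o v).
Proof.
move=> a0 b1 iv; apply: integrableS iv => //; apply: subset_itv; by rewrite bnd_simp.
Qed.

Lemma integrable_mul_continuous v f a b : continuous f ->
  mu.-integrable `[a, b] (EFin \o v) ->
  mu.-integrable `[a, b] (EFin \o (fun x => f x * v x)).
Proof.
move=> cf iv; have [ab|ba] := leP a b; last first.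
  by rewrite set_itv_ge ?bnd_simp -?ltNge//; exact: integrable_set0.
have cnf : continuous (fun x => `|f x|).
  by move=> x; apply: cvg_norm; exact: cf.
have [c _ hc] := @EVT_max R _ _ _ ab (continuous_subspaceT cnf).
apply: (@integrable_mulf _ _ `|f c| f v (measurable_itvR _)) => //.
exact: measurable_continuous.
Qed.

Definition prim v (x : R) : R := \int[mu]_(t in `[0, clamp x]) v t.

Lemma prim_continuous v : mu.-integrable `[0, 1] (EFin \o v) -> continuous (prim v).
Proof.
move=> iv; apply: (@continuous_comp_clamp (fun x => \int[mu]_(t in `[0, x]) v t)).
exact: parameterized_integral_continuous.
Qed.

Lemma prim0 v : prim v 0 = 0.
Proof. by rewrite /prim clamp_id ?lexx ?ler01// set_itv1 Rintegral_set1. Qed.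

Lemma primE v x : 0 <= x <= 1 -> prim v x = \int[mu]_(t in `[0, x]) v t.
Proof. by move=> x01; rewrite /prim clamp_id. Qed.

Lemma prim_sub v x y : mu.-integrable `[0, 1] (EFin \o v) -> 0 <= x -> x <= y -> y <= 1 ->
  prim v y - prim v x = \int[mu]_(t in `[x, y]) v t.
Proof.
move=> iv x0 xy y1; rewrite !primE ?x0 ?(le_trans x0)//= ?(le_trans xy)//.
rewrite (@Rintegral_split _ v 0 x y)//; last exact: integrable_sub01.
by rewrite addrAC subrr add0r.
Qed.

(** Both sides are additive over subdivisions, so the bound passes from short intervals to all, and
    then e tends to 0. Steps of length d/2 are taken because the hypothesis asks for y - x < d
    strictly. This replaces differentiation almost everywhere in the chain rule below. *)
Lemma constant_of_increments (Phi m : R -> R) : (forall x, 0 <= m x) ->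
  mu.-integrable `[0, 1] (EFin \o m) ->
  (forall e : R, 0 < e -> exists2 d : R, 0 < d & forall x y : R, 0 <= x -> x <= y -> y <= 1 ->
     y - x < d -> `|Phi y - Phi x| <= e * \int[mu]_(t in `[x, y]) m t) ->
  forall x y : R, 0 <= x -> x <= y -> y <= 1 -> Phi y = Phi x.
Proof.
move=> m0 im inc.
have step (e : R) : 0 < e -> forall x y : R, 0 <= x -> x <= y -> y <= 1 ->
    `|Phi y - Phi x| <= e * \int[mu]_(t in `[x, y]) m t.
  move=> e0; have [d d0 hd] := inc e e0.
  have d20 : 0 < d / 2 by rewrite divr_gt0.
  suff ind n : forall x y : R, 0 <= x -> x <= y -> y <= 1 -> y - x <= n%:R * (d / 2) ->
      `|Phi y - Phi x| <= e * \int[mu]_(t in `[x, y]) m t.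
    move=> x y x0 xy y1.
    apply: (ind (Num.truncn ((d / 2)^-1)).+1) => //.
    apply: (@le_trans _ _ 1); first by lra.
    by rewrite -ler_pdivrMr// mul1r ltW// truncnS_gt.
  elim: n => [|n ih] x y x0 xy y1.
    rewrite mul0r => yx; have -> : y = x by lra.
    by rewrite subrr normr0 set_itv1 Rintegral_set1 mulr0.
  move=> yx; set z := Num.max x (y - d / 2).
  have xz : x <= z by rewrite le_max lexx.
  have zy : z <= y by rewrite ge_max xy/=; lra.
  have yz : y - z < d.
    have : y - d / 2 <= z by rewrite le_max lexx orbT.
    lra.
  have zx : z - x <= n%:R * (d / 2).
    rewrite lerBlDr ge_max; apply/andP; split.
      by rewrite lerDr mulr_ge0// ltW.
    by move: yx; rewrite -natr1 mulrDl mul1r; lra.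
  have z0 := le_trans x0 xz.
  rewrite (@Rintegral_split _ m x z y)//; last exact: integrable_sub01.
  have -> : Phi y - Phi x = (Phi y - Phi z) + (Phi z - Phi x) by ring.
  rewrite addrC mulrDr; apply: le_trans (ler_normD _ _) _; apply: lerD.
    by apply: ih => //; exact: le_trans zy y1.
  exact: hd.
move=> x y x0 xy y1; apply/eqP; rewrite -subr_eq0 -normr_le0.
set I := \int[mu]_(t in `[x, y]) m t.
have I0 : 0 <= I by apply: Rintegral_ge0 => t _; exact: m0.
rewrite leNgt; apply/negP => p0.
have I1 : 0 < I + 1 by rewrite ltr_wpDl.
have := step (`|Phi y - Phi x| / (I + 1)) (divr_gt0 p0 I1) x y x0 xy y1.
rewrite -/I -mulrA ler_pMr// ler_pdivlMl// mulr1; lra.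
Qed.

Lemma mul_oscillation_le v f (a e x y : R) : continuous f ->
  mu.-integrable `[x, y] (EFin \o v) ->
  (forall t, x <= t <= y -> `|a - f t| <= e) ->
  `|a * \int[mu]_(t in `[x, y]) v t - \int[mu]_(t in `[x, y]) (f t * v t)| <=
  e * \int[mu]_(t in `[x, y]) `|v t|.
Proof.
move=> cf iv fe.
have ifv := integrable_mul_continuous cf iv.
have iav := integrable_scalef a (measurable_itvR _) iv.
have inv : mu.-integrable `[x, y] (EFin \o (fun t => `|v t|)) by exact: (integrable_norm iv).
have iD := integrable_subf (measurable_itvR _) iav ifv.
rewrite -(RintegralZf a (measurable_itvR _) iv) -(RintegralB (measurable_itvR _) iav ifv).
apply: (le_trans (le_normr_Rintegral (measurable_itvR _) iD)).
rewrite -(RintegralZf e (measurable_itvR _) inv).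
apply: (le_Rintegral (measurable_itvR _) (integrable_norm iD)).
  exact: integrable_scalef (measurable_itvR _) inv.
by move=> t /=; rewrite in_itv/= => txy; rewrite -mulrBl normrM ler_wpM2r// fe.
Qed.

(** The mean value theorem for K between U(x) and U(y) gives a value that U takes on [x,y] by the
    intermediate value theorem; no derivative of U enters. *)
Lemma increment_intermediate k K U (x y : R) : continuous U ->
  (forall t : R, is_derive t 1 K (k t)) -> x <= y ->
  exists2 s : R, x <= s <= y & K (U y) - K (U x) = k (U s) * (U y - U x).
Proof.
move=> cU dK xy.
have mid (s0 : R) : Num.min (U x) (U y) <= s0 <= Num.max (U x) (U y) ->
    exists2 s : R, x <= s <= y & U s = s0.
  move=> /(IVT xy (continuous_subspaceT cU))[s sxy Us].
  by exists s => //; move: sxy; rewrite in_itv.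
have cK : continuous K by move=> t; exact: is_derive_continuous (dK t).
have [Uxy|Uyx] := leP (U x) (U y).
  have [z zxy ->] := MVT_segment Uxy (fun t _ => dK t) (continuous_subspaceT cK).
  have [|s sxy Us] := mid z; last by exists s; rewrite ?Us.
  by rewrite min_l// max_r//; move: zxy; rewrite in_itv.
have [z zxy e1] := MVT_segment (ltW Uyx) (fun t _ => dK t) (continuous_subspaceT cK).
have [|s sxy Us] := mid z; last first.
  by exists s; first exact: sxy; rewrite Us -[LHS]opprB e1 -mulrN opprB.
by rewrite min_r ?max_l ?(ltW Uyx)//; move: zxy; rewrite in_itv.
Qed.

(* On a short interval [K(U)] increases by [k] at an intermediate point times
   the increment of [U], so that [K(U)] minus the integral of [v * k(U)] has
   increments o(1) times the integral of [|v|]. *)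
Lemma prim_chain_rule v k K (c : R) : mu.-integrable `[0, 1] (EFin \o v) ->
  continuous k -> (forall t : R, is_derive t 1 K (k t)) ->
  forall x y : R, 0 <= x -> x <= y -> y <= 1 ->
  \int[mu]_(t in `[x, y]) (k (c + prim v t) * v t) =
  K (c + prim v y) - K (c + prim v x).
Proof.
move=> iv ck dK.
have cU : continuous (fun t => c + prim v t).
  by apply: continuous_addf; [exact: continuous_cstf|exact: prim_continuous].
have ckU : continuous (fun t => k (c + prim v t)) by exact: continuous_compf ck cU.
have iw := integrable_mul_continuous ckU iv.
set w := (fun x => k (c + prim v x) * v x) in iw *.
suff h : forall x y : R, 0 <= x -> x <= y -> y <= 1 ->
    K (c + prim v y) - prim w y = K (c + prim v x) - prim w x.
  move=> x y x0 xy y1; rewrite -(prim_sub iw x0 xy y1).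
  move/eqP: (h x y x0 xy y1); rewrite subr_eq => /eqP ->.
  by move: (prim w y) (prim w x) (K _) => p q r; ring.
apply: (@constant_of_increments _ (fun t => `|v t|)) => //.
  exact: (integrable_norm iv).
move=> e e0; have [d d0 hd] := uniformly_continuous01 ckU e0.
exists d => // x y x0 xy y1 yx.
have [s /andP[xs sy] hs] := increment_intermediate cU dK xy.
have -> : K (c + prim v y) - prim w y - (K (c + prim v x) - prim w x) =
    k (c + prim v s) * \int[mu]_(t in `[x, y]) v t - \int[mu]_(t in `[x, y]) w t.
  rewrite -(prim_sub iv x0 xy y1) -(prim_sub iw x0 xy y1).
  by move: hs => /= hs; rewrite opprD addrACA opprK opprB hs; congr (_ * _ + _); ring.
apply: mul_oscillation_le ckU (integrable_sub01 x0 y1 iv) _ => t /andP[xt ty].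
apply/ltW/hd; first by rewrite (le_trans x0 xs) (le_trans sy y1).
by rewrite ltr_norml; apply/andP; split; lra.
Qed.

(** Polarisation: the chain rule for t^2/2 is applied to primitives of v, of dphi and of v + dphi,
    and the cross terms give the product rule. *)
Lemma prim_by_parts v (phi dphi : R -> R) : mu.-integrable `[0, 1] (EFin \o v) ->
  continuous dphi -> (forall t : R, is_derive t 1 phi (dphi t)) ->
  \int[mu]_(t in `[0, 1]) (prim v t * dphi t) =
  prim v 1 * phi 1 - \int[mu]_(t in `[0, 1]) (v t * phi t).
Proof.
move=> iv cd dphi'.
have cphi : continuous phi by move=> t; exact: is_derive_continuous (dphi' t).
have idp : mu.-integrable `[0, 1] (EFin \o dphi) by exact: continuous_integrable_itv.
have cV := prim_continuous iv.
have phiE (t : R) : 0 <= t <= 1 -> prim dphi t = phi t - phi 0.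
  by move=> /andP[t0 t1]; rewrite primE ?t0// (@Rintegral_FTC2 _ dphi phi).
have sqr w (c : R) : mu.-integrable `[0, 1] (EFin \o w) ->
    \int[mu]_(t in `[0, 1]) ((c + prim w t) * w t) =
    ((c + prim w 1) ^+ 2 - c ^+ 2) / 2.
  move=> iw.
  have h := @prim_chain_rule w id (fun t => t ^+ 2 / 2) c iw continuous_idf.
  rewrite (h _ 0 1) ?lexx ?ler01//; first by rewrite prim0 addr0 mulrBl.
  move=> t; have := is_derive_mulf (is_derive_expf 2 (is_derive_idf t)) (is_derive_cstf (2^-1 : R) t).
  by move=> /is_derive_congr; apply; field.
have is_ : mu.-integrable `[0, 1] (EFin \o (fun t => v t + dphi t)).
  by apply: integrable_addf => //; exact: measurable_itvR.
have i1 : mu.-integrable `[0, 1] (EFin \o (fun t => v t * phi t)).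
  have -> : (fun t => v t * phi t) = (fun t => phi t * v t) by apply/funext => t; rewrite mulrC.
  exact: integrable_mul_continuous.
have i2 : mu.-integrable `[0, 1] (EFin \o (fun t => prim v t * dphi t)).
  exact: integrable_mul_continuous.
have i3 : mu.-integrable `[0, 1] (EFin \o (fun t => (0 + prim v t) * v t)).
  apply: integrable_mul_continuous => //.
  by apply: continuous_addf; [exact: continuous_cstf|].
have i4 : mu.-integrable `[0, 1] (EFin \o (fun t => (phi 0 + prim dphi t) * dphi t)).
  apply: integrable_mul_continuous => //.
  by apply: continuous_addf; [exact: continuous_cstf|exact: prim_continuous].
have e := sqr _ (phi 0) is_; have e1 := sqr _ 0 iv; have e2 := sqr _ (phi 0) idp.
have ps (t : R) : 0 <= t <= 1 -> prim (fun t => v t + dphi t) t = prim v t + prim dphi t.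
  move=> t01; have /andP[t0 t1] := t01; rewrite !primE// RintegralD//.
  - exact: integrable_sub01 iv.
  - exact: integrable_sub01 idp.
have : \int[mu]_(t in `[0, 1]) ((phi 0 + prim (fun t => v t + dphi t) t) * (v t + dphi t)) =
   \int[mu]_(t in `[0, 1]) ((0 + prim v t) * v t) +
   \int[mu]_(t in `[0, 1]) ((phi 0 + prim dphi t) * dphi t) +
   (\int[mu]_(t in `[0, 1]) (prim v t * dphi t) +
    \int[mu]_(t in `[0, 1]) (v t * phi t)).
  rewrite -!RintegralD//.
  - apply: eq_Rintegral => t; rewrite inE /= in_itv/= => t01.
    by rewrite ps// phiE//; ring.
  - by apply: integrable_addf => //; exact: measurable_itvR.
  - by apply: integrable_addf => //; exact: measurable_itvR.
rewrite e e1 e2 ps ?lexx ?ler01// phiE ?lexx ?ler01//.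
move=> h; move: h; set A := \int[mu]_(_ in _) _; set B := \int[mu]_(_ in _) _.
by move=> h; nra.
Qed.

End AbsolutelyContinuous.

(** * Test functions and weak derivatives *)

Section Smooth.
Context {R : realType}.
Implicit Types (f g phi : R -> R) (n m : nat).

(** The derivatives are existential witnesses, so that an induction on n only exhibits the next
    derivative and never computes an iterated one. *)
Fixpoint differentiable_upto n f : Prop :=
  if n is n'.+1 then
    exists2 df, forall x : R, is_derive x 1 f (df x) & differentiable_upto n' df
  else True.

Definition smooth f := forall n, differentiable_upto n f.

Lemma differentiable_uptoW n f : differentiable_upto n.+1 f -> differentiable_upto n f.
Proof.
elim: n f => [//|n ih] f [df dfE hdf]; exists df => //; exact: ih.
Qed.

Lemma differentiable_upto_cst n c : differentiable_upto n (fun=> c).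
Proof.
elim: n c => [//|n ih] c; exists (fun=> 0); last exact: ih.
by move=> x; exact: is_derive_cstf.
Qed.

Lemma differentiable_upto_add n f g : differentiable_upto n f ->
  differentiable_upto n g -> differentiable_upto n (fun x => f x + g x).
Proof.
elim: n f g => [//|n ih] f g [df dfE hf] [dg dgE hg].
exists (fun x => df x + dg x); last exact: ih.
by move=> x; exact: is_derive_addf.
Qed.

Lemma differentiable_upto_mul n f g : differentiable_upto n f ->
  differentiable_upto n g -> differentiable_upto n (fun x => f x * g x).
Proof.
elim: n f g => [//|n ih] f g hf hg.
have hf' := differentiable_uptoW hf; have hg' := differentiable_uptoW hg.
case: hf hg => [df dfE hf] [dg dgE hg].
exists (fun x => df x * g x + f x * dg x).
  by move=> x; exact: is_derive_mulf.
by apply: differentiable_upto_add; exact: ih.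
Qed.

Lemma smooth_cst c : smooth (fun=> c).
Proof. by move=> n; exact: differentiable_upto_cst. Qed.

Lemma smooth_add f g : smooth f -> smooth g -> smooth (fun x => f x + g x).
Proof. by move=> sf sg n; exact: differentiable_upto_add. Qed.

Lemma smooth_mul f g : smooth f -> smooth g -> smooth (fun x => f x * g x).
Proof. by move=> sf sg n; exact: differentiable_upto_mul. Qed.

Lemma smooth_affine f (a b : R) : smooth f -> smooth (fun x => f (a * x + b)).
Proof.
move=> sf n; elim: n f {sf}(sf n) => [//|n ih] f [df dfE hf].
exists (fun x => a * df (a * x + b)); last first.
  by apply: differentiable_upto_mul; [exact: differentiable_upto_cst|exact: ih].
move=> x; have := is_derive_compf f (fun x => a * x + b)
  (dfE _) (is_derive_addf (is_derive_scalef a (is_derive_idf x)) (is_derive_cstf b x)).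
by move=> /is_derive_congr; apply; ring.
Qed.

Lemma smooth_primitive f F : smooth f -> (forall x : R, is_derive x 1 F (f x)) -> smooth F.
Proof. by move=> sf dF [//|n]; exists f. Qed.

Lemma derive1_is_derive f df : (forall x : R, is_derive x 1 f (df x)) -> derive1 f = df.
Proof. by move=> h; apply/funext => x; rewrite derive1E; have [_ ->] := h x. Qed.

Lemma smooth_derive1n f : smooth f -> forall n (x : R), derivable (derive1n n f) x 1.
Proof.
move=> sf n; elim: n f {sf}(sf n.+1) => [|n ih] f [df dfE hf] x.
  by rewrite derive1n0; have [] := dfE x.
by rewrite derive1Sn (derive1_is_derive dfE); exact: ih.
Qed.

Lemma is_derive_flat_at0 f (C : R) : f 0 = 0 -> (forall x, `|f x| <= C * x ^+ 2) ->
  is_derive (0 : R) 1 f 0.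
Proof.
move=> f0 hf.
have lim : h^-1 *: (f (h *: 1 + 0) - f 0) @[h --> 0^'] --> (0 : R).
  apply/cvgr0Pnorm_le => /= e e0; have C1 : 0 < `|C| + 1 by rewrite ltr_wpDl.
  near=> h.
  have h0 : h != 0 by near: h; exact: nbhs_dnbhs_neq.
  rewrite f0 subr0 addr0 /GRing.scale/= mulr1 normrM normrV ?unitfE//.
  rewrite ler_pdivrMl ?normr_gt0//; apply: (le_trans (hf h)).
  have hs : `|h| < e / (`|C| + 1).
    near: h; apply: dnbhs0_lt; exact: divr_gt0.
  rewrite -real_normK ?num_real// expr2 mulrA mulrC ler_wpM2l//.
  move: hs; rewrite ltr_pdivlMr// => /ltW; apply: le_trans.
  by rewrite mulrC ler_wpM2l// (le_trans (ler_norm C))// lerDl.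
by split; [apply/cvg_ex; exists 0|exact: cvg_lim lim].
Unshelve. all: by end_near. Qed.

(** The factors x^(-m) make the family closed, up to linear combinations, under differentiation; one
    induction then gives smoothness for all m. *)
Definition flat m (x : R) : R := if 0 < x then x ^- m * expR (- x^-1) else 0.

Lemma flat_ge0 m x : 0 <= flat m x.
Proof.
by rewrite /flat; case: ifPn => // x0; rewrite mulr_ge0 ?expR_ge0// invr_ge0 exprn_ge0 ?ltW.
Qed.

(** The term of order m + 2 of the exponential series at 1/x leaves two spare powers of x, which
    yield the derivative 0 at the origin. *)
Lemma flat_le m : exists C : R, forall x, `|flat m x| <= C * x ^+ 2.
Proof.
exists (m.+2)`!%:R => x; rewrite ger0_norm ?flat_ge0// /flat.
case: ifPn => [x0|_]; last by rewrite mulr_ge0 ?sqr_ge0.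
have ix0 : 0 <= x^-1 by rewrite invr_ge0 ltW.
have := expR_ge1Dxn m.+1 ix0.
rewrite expRN -exprVn => h.
have f0 : 0 < (m.+2)`!%:R :> R by rewrite ltr0n fact_gt0.
have h1 : x^-1 ^+ m.+2 <= (m.+2)`!%:R * expR x^-1.
  by rewrite mulrC -ler_pdivrMr//; apply: le_trans h; rewrite lerDr.
rewrite ler_pdivrMr ?expR_gt0//.
have -> : x^-1 ^+ m = x ^+ 2 * x^-1 ^+ m.+2.
  by rewrite (exprS _ m.+1) (exprS _ m); field; rewrite gt_eqF.
by rewrite [leRHS]mulrAC [leRHS]mulrC ler_wpM2l ?sqr_ge0.
Qed.

Lemma is_derive_flat m (x : R) :
  is_derive x 1 (flat m) (- m%:R * flat m.+1 x + flat m.+2 x).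
Proof.
have [x0|x0|->] := ltgtP x 0.
- have -> : - m%:R * flat m.+1 x + flat m.+2 x = 0.
    by rewrite /flat !ltNge (ltW x0)/= mulr0 addr0.
  apply: near_eq_is_derive (is_derive_cstf 0 x).
  by near=> y; rewrite /flat ltNge ltW//; near: y; exact: lt_nbhsl.
- have n0 : x != 0 by rewrite gt_eqF.
  apply: (@near_eq_is_derive R R R (fun y : R => (y^-1) ^+ m * expR (- y^-1))).
    near=> y; have y0 : 0 < y by near: y; exact: lt_nbhsr.
    by rewrite /flat y0 exprVn.
  have di := is_derive_invf (fun y => y) n0 (is_derive_idf x).
  have := is_derive_mulf (is_derive_expf m di)
    (is_derive_compf expR (fun y => - y^-1) (is_derive_expR _) (is_derive_oppf di)).
  move=> /is_derive_congr; apply; rewrite /flat x0 -!exprVn.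
  case: m => [|m]; last by rewrite !exprS; field.
  by rewrite !exprS !expr0; field.
- have -> : - m%:R * flat m.+1 0 + flat m.+2 0 = 0.
    by rewrite /flat !ltxx mulr0 addr0.
  have [C hC] := flat_le m; apply: is_derive_flat_at0 hC.
  by rewrite /flat ltxx.
Unshelve. all: by end_near. Qed.

Lemma smooth_flat m : smooth (flat m).
Proof.
move=> n; elim: n m => [//|n ih] m.
exists (fun x => - m%:R * flat m.+1 x + flat m.+2 x); first exact: is_derive_flat.
apply: differentiable_upto_add; last exact: ih.
by apply: differentiable_upto_mul; [exact: differentiable_upto_cst|exact: ih].
Qed.

Definition bump (x : R) : R := flat 0 (1 + x) * flat 0 (1 - x).

Lemma smooth_bump : smooth bump.
Proof.
rewrite /bump; apply: smooth_mul.
  by under eq_fun do rewrite addrC -[X in X + _]mul1r; exact: smooth_affine (@smooth_flat 0).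
by under eq_fun do rewrite addrC -mulN1r; exact: smooth_affine (@smooth_flat 0).
Qed.

Lemma bump_ge0 x : 0 <= bump x.
Proof. by rewrite mulr_ge0// flat_ge0. Qed.

Lemma bump_gt0 x : -1 < x < 1 -> 0 < bump x.
Proof.
move=> /andP[x1 x2]; have a : 0 < 1 + x by lra. have b : 0 < 1 - x by lra.
by rewrite /bump /flat a b !expr0 invr1 !mul1r mulr_gt0 ?expR_gt0.
Qed.

Lemma bump_out x : 1 <= `|x| -> bump x = 0.
Proof.
rewrite ler_normr => /orP[h|h]; rewrite /bump /flat.
  have -> : (0 < 1 - x) = false by apply/negbTE; rewrite -leNgt; lra.
  by rewrite mulr0.
have -> : (0 < 1 + x) = false by apply/negbTE; rewrite -leNgt; lra.
by rewrite mul0r.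
Qed.

Lemma smooth_continuous f : smooth f -> continuous f.
Proof. by move=> /(_ 1%N)[df h _] x; exact: is_derive_continuous (h x). Qed.

(* A smoothed step function [sig] and a smoothed positive part [ramp], up to
   the constant [c]. *)
Lemma smooth_ramp : exists ramp sig rho : R -> R, exists c : R,
  [/\ smooth ramp, smooth sig & smooth rho] /\
  [/\ forall x : R, is_derive x 1 ramp (sig x), forall x : R, is_derive x 1 sig (rho x),
      forall x, 0 <= rho x & forall x, 1 <= `|x| -> rho x = 0] /\
  [/\ forall x : R, x <= -1 -> sig x = 0, forall x, 1 <= x -> sig x = 1,
      forall x : R, x <= -1 -> ramp x = 0 & forall x, 1 <= x -> ramp x = x + c].
Proof.
have [S [_ dS]] := continuous_primitive (smooth_continuous smooth_bump).
have cst (F dF : R -> R) (a b : R) : (forall x : R, is_derive x 1 F (dF x)) -> a <= b ->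
    (forall x, a <= x <= b -> dF x = 0) -> F a = F b.
  move=> h ab h0; have cF : continuous F by move=> x; exact: is_derive_continuous (h x).
  have [z zab /eqP] := MVT_segment ab (fun t _ => h t) (continuous_subspaceT cF).
  by rewrite h0 ?mul0r ?subr_eq0; [move/eqP|move: zab; rewrite in_itv].
have cS : continuous S by move=> x; exact: is_derive_continuous (dS x).
have n11 : (-1 : R) < 1 by lra.
have [z zab eS] := MVT n11 (fun t _ => dS t) (continuous_subspaceT cS).
pose C := S 1 - S (-1).
have C0 : 0 < C.
  rewrite /C eS mulr_gt0//.
  by apply: bump_gt0; move: zab; rewrite in_itv.
pose sig x := C^-1 * (S x - S (-1)); pose rho x := C^-1 * bump x.
have dsig (x : R) : is_derive x 1 sig (rho x).
  have := is_derive_scalef C^-1 (is_derive_subf (dS x) (is_derive_cstf (S (-1)) x)).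
  by move=> /is_derive_congr; apply; rewrite subr0.
have srho : smooth rho by apply: smooth_mul; [exact: smooth_cst|exact: smooth_bump].
have ssig : smooth sig by exact: smooth_primitive dsig.
have [N [_ dN]] := continuous_primitive (smooth_continuous ssig).
pose ramp x := N x - N (-1).
have dramp (x : R) : is_derive x 1 ramp (sig x).
  have := is_derive_subf (dN x) (is_derive_cstf (N (-1)) x).
  by move=> /is_derive_congr; apply; rewrite subr0.
have rho0 x : 1 <= `|x| -> rho x = 0 by move=> h; rewrite /rho bump_out ?mulr0.
have sig0 (x : R) : x <= -1 -> sig x = 0.
  move=> h; have -> : sig x = sig (-1).
    apply: cst dsig h _ => y /andP[_ y1]; apply: rho0.
    by rewrite ler_normr; apply/orP; right; lra.
  by rewrite /sig subrr mulr0.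
have sig1 x : 1 <= x -> sig x = 1.
  move=> h; have <- : sig 1 = sig x.
    apply: cst dsig h _ => y /andP[y1 _]; apply: rho0.
    by rewrite ler_normr; apply/orP; left; lra.
  by rewrite /sig -/C mulVf// gt_eqF.
exists ramp, sig, rho, (ramp 1 - 1); split; first by split => //; exact: smooth_primitive dramp.
split; first by split => // x; rewrite /rho mulr_ge0 ?bump_ge0// invr_ge0 ltW.
split => // x h.
  have -> : ramp x = ramp (-1).
    by apply: cst dramp h _ => y /andP[_ y1]; exact: sig0.
  by rewrite /ramp subrr.
have e : ramp 1 - 1 = ramp x - x.
  have d (y : R) : is_derive y 1 (fun y => ramp y - y) (sig y - 1).
    exact: is_derive_subf (dramp y) (is_derive_idf y).
  apply: (cst (fun y => ramp y - y) (fun y => sig y - 1) 1 x d h) => y /andP[y1 _].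
  by rewrite sig1 ?subrr.
by rewrite e addrC subrK.
Qed.

End Smooth.

(** * Test functions and square-integrable functions on (0,1) *)

Section TestFunctions.
Context {R : realType}.
Local Notation mu := (@lebesgue_measure R).
Implicit Types (f v u phi : R -> R).

Lemma test_function_is_derive phi (x : R) : test_function phi ->
  is_derive x 1 phi (derive1 phi x).
Proof.
by move=> [h _]; split; [have := h 0%N x; rewrite derive1n0|rewrite derive1E].
Qed.

(** Off the closed support phi vanishes in a neighbourhood, hence so does its derivative. *)
Lemma test_function_derive1 phi : test_function phi -> test_function (derive1 phi).
Proof.
move=> [sm sp]; split=> [n x|]; first by have := sm n.+1 x; rewrite derive1Sn.
apply: subset_trans sp.
rewrite [X in _ `<=` X]((closure_id _).1 (@closed_closure _ [set x | phi x != 0])).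
apply: closure_subset => x /= dx; apply: contrapT => nx.
have [B hB] : exists2 B, nbhs x B & forall y, B y -> phi y = 0.
  move: nx; rewrite /closure/= => /existsNP[B /not_implyP[xB /set0P/negP]].
  rewrite negbK => /eqP e; exists B => // y By; apply: contrapT => /eqP py.
  by have : set0 y by rewrite -e; split.
move=> B0; move: dx; apply/negP; rewrite negbK; apply/eqP.
have : is_derive x 1 phi (0 : R).
  apply: near_eq_is_derive (is_derive_cstf 0 x).
  by apply: filterS hB => y /B0 ->.
by move=> [_]; rewrite derive1E.
Qed.

Lemma test_function_out phi x : test_function phi -> ~~ (0 < x < 1) -> phi x = 0.
Proof.
move=> [_ sp] nx; apply: contrapT => /eqP px.
have /sp : closure [set x | phi x != 0] x by exact: subset_closure.
by rewrite /= in_itv/= (negbTE nx).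
Qed.

Lemma test_function0 phi : test_function phi -> phi 0 = 0.
Proof. by move=> h; rewrite (test_function_out h)// ltxx. Qed.

Lemma test_function1 phi : test_function phi -> phi 1 = 0.
Proof. by move=> h; rewrite (test_function_out h)// ltxx andbF. Qed.

Lemma test_function_continuous phi : test_function phi -> continuous phi.
Proof. by move=> h x; exact: is_derive_continuous (test_function_is_derive x h). Qed.

Lemma smooth_test_function phi (a b : R) : smooth phi -> 0 < a -> b < 1 ->
  (forall x, phi x != 0 -> a <= x <= b) -> test_function phi.
Proof.
move=> sm a0 b1 hp; split; first by move=> n x; exact: smooth_derive1n.
apply: (@subset_trans _ `[a, b]).
  rewrite [X in _ `<=` X]((closure_id _).1 (@itv_closed _ R a b)).
  by apply: closure_subset => x /= /hp; rewrite in_itv.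
by apply: subset_itv; rewrite bnd_simp.
Qed.

Lemma Rintegral_oo_cc v : mu.-integrable `]0, 1[ (EFin \o v) ->
  mu.-integrable `[0, 1] (EFin \o v) /\
  \int[mu]_(x in `]0, 1[) v x = \int[mu]_(x in `[0, 1]) v x.
Proof.
move=> iv.
have iv' : mu.-integrable `[0, 1] (EFin \o v).
  have mv : measurable_fun (`[0, 1]%classic : set (measurableTypeR R)) v.
    have [/measurable_EFinP mv _] := integrableP _ _ _ iv.
    by have := measurable_fun_itv_cc mv.
  apply/integrableP; split; first exact/measurable_EFinP.
  have [_] := integrableP _ _ _ iv.
  rewrite (@integral_itv_bndoo _ 0 1 _ true false)//.
  exact: (measurable_int mu (integrable_abse iv)).
split => //; rewrite Rintegral_itv_bndo_bndc//.
apply: Rintegral_itv_obnd_cbnd.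
by apply: integrableS iv' => //; apply: subset_itvr; rewrite bnd_simp.
Qed.


Local Notation unit_itv := (`]0, 1[%classic : set (measurableTypeR R)).

Lemma patch_sqr f : (fun x => (f \_ `]0, 1[) x ^+ 2) = (fun x => f x ^+ 2) \_ `]0, 1[.
Proof. by apply/funext => x; rewrite !patchE; case: ifPn => // _; rewrite expr0n. Qed.

Lemma L2_measurable f : L2 f -> measurable_fun unit_itv f.
Proof.
rewrite /L2 inE => /andP[+ _]; rewrite inE/= => mf.
exact/(measurable_restrictT _ (measurable_itvR _)).
Qed.

Lemma L2_sqr f : L2 f -> mu.-integrable `]0, 1[ (EFin \o (fun x => f x ^+ 2)).
Proof.
move=> /Lfun2_integrable_sqr; rewrite patch_sqr -restrict_EFin.
by move=> /(integrable_restrict _ _ _ _).2; rewrite setTI; apply.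
Qed.

Lemma integrable_cst01 (c : R) : mu.-integrable `]0, 1[ (EFin \o (fun=> c : R)).
Proof.
have := continuous_integrable_itv 0 1 (@continuous_cstf R c).
by apply: integrableS => //; apply: subset_itv; rewrite bnd_simp.
Qed.

Lemma L2_integrable f : L2 f -> mu.-integrable `]0, 1[ (EFin \o f).
Proof.
move=> Lf; apply: (@le_integrable_f _ _ f (fun x => 1 + f x ^+ 2) (measurable_itvR _)).
- exact: L2_measurable.
- move=> x _; have := sqr_ge0 (`|f x| - 1); rewrite sqrrB real_normK ?num_real//.
  by have := sqr_ge0 (f x); nra.
- apply: integrable_addf; [exact: measurable_itvR| |exact: L2_sqr].
  exact: integrable_cst01.
Qed.

Lemma L2_bounded f (M : R) : measurable_fun unit_itv f ->
  (forall x : R, 0 < x < 1 -> `|f x| <= M) -> L2 f.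
Proof.
move=> mf fM; have mf0 : measurable_fun setT (f \_ unit_itv).
  exact/(measurable_restrictT _ (measurable_itvR _)).
rewrite /L2 inE; apply/andP; split; rewrite inE//= /finite_norm unlock /Lnorm/=.
apply: poweR_lty.
have ig : mu.-integrable setT (EFin \o ((fun x => f x ^+ 2) \_ unit_itv)).
  rewrite -restrict_EFin; apply/(integrable_restrict _ _ _ _).1; rewrite // setTI.
  apply: (@le_integrable_f _ _ _ (fun=> M ^+ 2) (measurable_itvR _)).
  - exact: measurable_funX.
  - move=> x /=; rewrite in_itv/= => x01; rewrite normrX.
    by rewrite lerXn2r ?nnegrE// ?fM// (le_trans (normr_ge0 (f x)))// fM.
  - exact: integrable_cst01.
apply: le_lt_trans (integrable_lty measurableT ig).
rewrite le_eqVlt; apply/orP; left; apply/eqP; apply: eq_integral => x _ /=.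
by rewrite -patch_sqr powR_mulrn// real_normK// num_real.
Qed.

Lemma L2_continuous f : continuous f -> L2 f.
Proof.
move=> cf; have [c _ hc] := @EVT_max R (fun x => `|f x|) _ _ ler01
  (continuous_subspaceT (fun x => cvg_norm (cf x))).
apply: (@L2_bounded f `|f c|); first exact: measurable_continuous.
by move=> x /andP[x0 x1]; apply: hc; rewrite in_itv/= !ltW.
Qed.

End TestFunctions.

(** * Weak derivatives of primitives, and vanishing second differences *)

Section WeakDerivatives.
Context {R : realType}.
Local Notation mu := (@lebesgue_measure R).
Implicit Types (f v u phi : R -> R).

Lemma integrable_cc_oo v : mu.-integrable `[0, 1] (EFin \o v) ->
  mu.-integrable `]0, 1[ (EFin \o v).
Proof. by apply: integrableS => //; apply: subset_itv; rewrite bnd_simp. Qed.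

Lemma Rintegral_oo_eq_cc v : mu.-integrable `[0, 1] (EFin \o v) ->
  \int[mu]_(x in `]0, 1[) v x = \int[mu]_(x in `[0, 1]) v x.
Proof. by move=> /integrable_cc_oo/Rintegral_oo_cc[]. Qed.

Lemma weak_derivative1_prim v (c : R) : mu.-integrable `[0, 1] (EFin \o v) ->
  is_weak_derivative 1 (fun x => c + prim v x) v.
Proof.
move=> iv phi tphi; rewrite derive1n1 expr1 mulN1r.
have ct : continuous phi by exact: test_function_continuous.
have cd : continuous (derive1 phi) by exact/test_function_continuous/test_function_derive1.
have dphi := fun x => test_function_is_derive x tphi.
have cp := prim_continuous iv.
have id := continuous_integrable_itv 0 1 cd.
have i1 : mu.-integrable `[0, 1] (EFin \o (fun x => v x * phi x)).
  have -> : (fun x => v x * phi x) = (fun x => phi x * v x) by apply/funext => x; rewrite mulrC.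
  exact: integrable_mul_continuous.
have i2 : mu.-integrable `[0, 1] (EFin \o (fun x => prim v x * derive1 phi x)).
  exact: integrable_mul_continuous.
have i3 := integrable_scalef c (measurable_itvR _) id.
have e : (fun x => (c + prim v x) * derive1 phi x) =
    (fun x => c * derive1 phi x + prim v x * derive1 phi x).
  by apply/funext => x; rewrite mulrDl.
rewrite (Rintegral_oo_eq_cc i1) Rintegral_oo_eq_cc e; last first.
  by apply: integrable_addf => //; exact: measurable_itvR.
rewrite RintegralD// (RintegralZf _ (measurable_itvR _) id).
rewrite (Rintegral_FTC2 ler01 cd dphi) (prim_by_parts iv cd dphi).
by rewrite (test_function0 tphi) (test_function1 tphi) subrr !mulr0 add0r sub0r.
Qed.

Lemma weak_derivative2_prim v (a b : R) : mu.-integrable `[0, 1] (EFin \o v) ->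
  is_weak_derivative 2 (fun x => a + prim (fun t => b + prim v t) x) v.
Proof.
move=> iv phi tphi.
have iV : mu.-integrable `[0, 1] (EFin \o (fun t => b + prim v t)).
  apply: continuous_integrable_itv; apply: continuous_addf.
    exact: continuous_cstf.
  exact: prim_continuous.
have := weak_derivative1_prim a iV (test_function_derive1 tphi).
rewrite -derive1Sn => ->.
have := weak_derivative1_prim b iv tphi; rewrite derive1n1 => ->.
by rewrite !mulrA -exprD.
Qed.

Lemma eq_on_closed01 f g : continuous f -> continuous g ->
  (forall x : R, 0 < x < 1 -> f x = g x) -> forall x : R, 0 <= x <= 1 -> f x = g x.
Proof.
move=> cf cg h x /andP[x0 x1]; apply: contrapT => /eqP; rewrite -subr_eq0 -normr_gt0 => e0.
have ch : continuous (fun y => f y - g y) by exact: continuous_subf.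
have /cvgrPdist_lt /(_ _ e0)/nbhs_ballP[r /= r0 hr] := ch x.
(* Moving x towards 1/2 by the fraction t gives an interior point at distance at most t/2 < r. *)
pose t := Num.min (1 / 2) r; have t0 : 0 < t by rewrite lt_min r0 andbT; lra.
have tr : t <= r by rewrite ge_min lexx orbT.
have t1 : t <= 1 / 2 by rewrite ge_min lexx.
have tx0 : 0 <= t * x by rewrite mulr_ge0// ltW.
have tx1 : t * x <= t by rewrite ler_piMr// ltW.
have px0 : 0 <= (1 - t) * x by rewrite mulr_ge0//; lra.
have px1 : (1 - t) * x <= 1 - t by rewrite ler_piMr//; lra.
have hy : 0 < (1 - t) * x + t / 2 < 1 by apply/andP; split; lra.
have := hr ((1 - t) * x + t / 2); rewrite (h _ hy).
rewrite subrr subr0 ltxx => H; suff : false by [].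
apply: H; rewrite /ball/= ltr_norml; apply/andP; split; lra.
Qed.

(* At an interior maximum [m] the second differences force [f] to take the
   same value at all points symmetric about [m], hence at an end point. *)
Lemma second_difference_le0 f : continuous f -> f 0 = 0 -> f 1 = 0 ->
  (forall p q : R, 0 < p -> p <= q -> q < 1 -> f p - 2 * f ((p + q) / 2) + f q = 0) ->
  forall x : R, 0 <= x <= 1 -> f x <= 0.
Proof.
move=> cf f0 f1 sd x x01.
have [m] := EVT_max ler01 (continuous_subspaceT cf).
rewrite in_itv/= => /andP[m0 m1] hm.
have {}hm (y : R) : 0 <= y <= 1 -> f y <= f m by move=> h; apply: hm; rewrite in_itv.
apply: (le_trans (hm x x01)); rewrite leNgt; apply/negP => fm0.
have m0' : 0 < m by rewrite lt_neqAle m0 andbT; apply/eqP => e; rewrite -e f0 ltxx in fm0.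
have m1' : m < 1 by rewrite lt_neqAle m1 andbT; apply/eqP => e; rewrite e f1 ltxx in fm0.
pose d := Num.min m (1 - m).
have d0 : 0 < d by rewrite lt_min m0'; lra.
have dm : d <= m by rewrite ge_min lexx.
have dm1 : d <= 1 - m by rewrite ge_min lexx orbT.
have sym (t : R) : 0 < t < 1 -> f (m - t * d) = f m /\ f (m + t * d) = f m.
  move=> /andP[t0 t1]; have td : t * d < d by rewrite gtr_pMl.
  have td0 : 0 < t * d by rewrite mulr_gt0.
  have := sd (m - t * d) (m + t * d).
  have -> : (m - t * d + (m + t * d)) / 2 = m by field.
  move=> /(_ _ _ _) h; have {}h := h ltac:(lra) ltac:(lra) ltac:(lra).
  have h1 : f (m - t * d) <= f m by apply: hm; lra.
  have h2 : f (m + t * d) <= f m by apply: hm; lra.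
  by split; lra.
(* Continuity extends the equality to t = 1, that is, to the end point nearest to m. *)
have cl (s : R) : (forall t : R, 0 < t < 1 -> f (m + s * t) = f m) -> f (m + s) = f m.
  move=> h; have := @eq_on_closed01 (fun t => f (m + s * t)) (fun=> f m) _ _ h 1.
  rewrite mulr1; apply; rewrite ?ler01 ?lexx//.
    apply: continuous_compf => //; apply: continuous_addf; first exact: continuous_cstf.
    by apply: continuous_mulf; [exact: continuous_cstf|exact: continuous_idf].
  exact: continuous_cstf.
have [hm1|hm1] := leP m (1 - m).
  have dE : d = m by rewrite /d min_l.
  have := cl (- m) _; rewrite subrr f0 => H; move: fm0; rewrite -H ?ltxx//.
  by move=> t t01; rewrite -[RHS](sym t t01).1 dE; congr f; ring.
have dE : d = 1 - m by rewrite /d min_r// ltW.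
have := cl (1 - m) _; rewrite subrKC f1 => H; move: fm0; rewrite -H ?ltxx//.
by move=> t t01; rewrite -[RHS](sym t t01).2 dE; congr f; ring.
Qed.

(** The difference of f and its chord vanishes at 0 and 1; [second_difference_le0] applies to it and
    to its opposite. *)
Lemma affine_of_second_difference f : continuous f ->
  (forall p q : R, 0 < p -> p <= q -> q < 1 -> f p - 2 * f ((p + q) / 2) + f q = 0) ->
  forall x : R, 0 <= x <= 1 -> f x = f 0 + x * (f 1 - f 0).
Proof.
move=> cf sd x x01.
pose g y := f y - (f 0 + y * (f 1 - f 0)).
have cg : continuous g.
  apply: continuous_subf => //; apply: continuous_addf; first exact: continuous_cstf.
  by apply: continuous_mulf; [exact: continuous_idf|exact: continuous_cstf].
have g0 : g 0 = 0 by rewrite /g; ring.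
have g1 : g 1 = 0 by rewrite /g; ring.
have gsd (p q : R) : 0 < p -> p <= q -> q < 1 -> g p - 2 * g ((p + q) / 2) + g q = 0.
  by move=> p0 pq q1; rewrite -(sd p q p0 pq q1) /g; field.
have := second_difference_le0 cg g0 g1 gsd x01.
have := @second_difference_le0 (fun y => - g y) _ _ _ _ x x01.
rewrite g0 g1 oppr0 => h.
have {}h : - g x <= 0.
  apply: h => //; first exact: continuous_oppf.
  by move=> p q p0 pq q1; rewrite -[RHS]oppr0 -(gsd p q p0 pq q1); ring.
by rewrite /g in h *; lra.
Qed.

End WeakDerivatives.

(** * The du Bois-Reymond lemma and the double integral representation *)

Section DuBoisReymond.
Context {R : realType}.
Local Notation mu := (@lebesgue_measure R).
Implicit Types (f v u phi : R -> R).

Lemma is_derive_affine f (df : R -> R) (a b x : R) :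
  (forall x : R, is_derive x 1 f (df x)) ->
  is_derive x 1 (fun x => f (a * x + b)) (a * df (a * x + b)).
Proof.
move=> d; have := is_derive_compf f (fun x => a * x + b)
  (d _) (is_derive_addf (is_derive_scalef a (is_derive_idf x)) (is_derive_cstf b x)).
by move=> /is_derive_congr; apply; ring.
Qed.

(** The rescaled kernel is nonnegative, lives where |x - p| <= r, and has total mass sig(1) -
    sig(-1) = 1 because that interval lies inside [0,1]. *)
Lemma mollify_le f (sig rho : R -> R) (p r e : R) : continuous f -> continuous rho ->
  (forall x : R, is_derive x 1 sig (rho x)) -> (forall x, 0 <= rho x) ->
  (forall x, 1 <= `|x| -> rho x = 0) -> (forall x : R, x <= -1 -> sig x = 0) ->
  (forall x, 1 <= x -> sig x = 1) -> 0 < r -> 0 < p - r -> p + r < 1 ->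
  (forall x : R, `|p - x| <= r -> `|f p - f x| <= e) ->
  `|f p - \int[mu]_(x in `[0, 1]) (f x * (r^-1 * rho (r^-1 * x + - (r^-1 * p))))| <= e.
Proof.
move=> cf crho dsig rho0 rhoo sig0 sig1 r0 pr0 pr1 fe.
have ir0 : 0 < r^-1 by rewrite invr_gt0.
pose k x := r^-1 * rho (r^-1 * x + - (r^-1 * p)).
have ck : continuous k.
  apply: continuous_mulf; first exact: continuous_cstf.
  apply: continuous_compf => //; apply: continuous_addf; last exact: continuous_cstf.
  by apply: continuous_mulf; [exact: continuous_cstf|exact: continuous_idf].
have argE (x : R) : r^-1 * x + - (r^-1 * p) = (x - p) / r by rewrite -mulrN -mulrDr mulrC.
have k1 : \int[mu]_(x in `[0, 1]) k x = 1.
  rewrite (Rintegral_FTC2 ler01 ck (fun x => is_derive_affine _ _ _ dsig)).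
  rewrite sig1 ?sig0 ?subr0// argE.
    by rewrite ler_pdivrMr//; lra.
  by rewrite ler_pdivlMr//; lra.
have ik : mu.-integrable `[0, 1] (EFin \o k) by exact: continuous_integrable_itv.
have ifk : mu.-integrable `[0, 1] (EFin \o (fun x => f x * k x)).
  exact: integrable_mul_continuous.
have ipk := integrable_scalef (f p) (measurable_itvR _) ik.
have iek := integrable_scalef e (measurable_itvR _) ik.
have -> : f p = \int[mu]_(x in `[0, 1]) (f p * k x).
  by rewrite (RintegralZf _ (measurable_itvR _) ik) k1 mulr1.
rewrite -(RintegralB (measurable_itvR _) ipk ifk).
have iD := integrable_subf (measurable_itvR _) ipk ifk.
apply: (le_trans (le_normr_Rintegral (measurable_itvR _) iD)).
have eE : e = \int[mu]_(x in `[0, 1]) (e * k x).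
  by rewrite (RintegralZf _ (measurable_itvR _) ik) k1 mulr1.
rewrite [leRHS]eE.
apply: (le_Rintegral (measurable_itvR _) (integrable_norm iD) iek) => x _ /=.
have k0 : 0 <= k x by rewrite mulr_ge0// ltW.
rewrite -mulrBl normrM [`|k x|]ger0_norm//.
have [h|h] := leP `|p - x| r; first by rewrite ler_wpM2r// fe.
have -> : k x = 0.
  rewrite /k rhoo ?mulr0// argE normrM [`|r^-1|]gtr0_norm// ler_pdivlMr// mul1r.
  by rewrite distrC ltW.
by rewrite !mulr0.
Qed.

(** Testing against the second difference of rescaled ramps gives the second difference of
    mollifications of f, which is therefore exactly 0; letting f replace its mollifications costs at
    most half of the supposed nonzero value. *)
Lemma second_difference_of_weak f : continuous f ->
  (forall phi, test_function phi -> \int[mu]_(x in `]0, 1[) (f x * derive1n 2 phi x) = 0) ->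
  forall p q : R, 0 < p -> p <= q -> q < 1 -> f p - 2 * f ((p + q) / 2) + f q = 0.
Proof.
move=> cf hf p q p0 pq q1; set m := (p + q) / 2.
have pm : p <= m by rewrite /m; lra.
have mq : m <= q by rewrite /m; lra.
have [ramp [sig [rho [c [[sramp ssig srho] [[dramp dsig rho0 rhoo] [sig0 sig1 ramp0 ramp1]]]]]]] :=
  @smooth_ramp R.
apply: contrapT => /eqP; rewrite -normr_gt0 => D0.
set D := `|_| in D0.
(* The weights 1, 2, 1 add up to 4, so errors of D/8 give D <= D/2. *)
have e0 : 0 < D / 8 by rewrite divr_gt0.
have [d d0 hd] := uniformly_continuous01 cf e0.
(* The first bound serves uniform continuity, the other two keep [p - r, q + r] inside (0,1). *)
pose r := Num.min (d / 2) (Num.min (p / 2) ((1 - q) / 2)).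
have r0 : 0 < r by rewrite !lt_min; apply/and3P; split; lra.
have rd : r <= d / 2 by rewrite ge_min lexx.
have rp : r <= p / 2 by rewrite ge_min ge_min lexx orbT.
have rq : r <= (1 - q) / 2 by rewrite ge_min ge_min lexx !orbT.
have crho := smooth_continuous srho.
pose K y := \int[mu]_(x in `[0, 1]) (f x * (r^-1 * rho (r^-1 * x + - (r^-1 * y)))).
have close (y : R) : p <= y <= q -> `|f y - K y| <= D / 8.
  move=> /andP[py yq]; apply: (mollify_le cf crho dsig) => //; [lra|lra|].
  by move=> x xy; apply/ltW/hd; [apply/andP; split; lra|lra].
pose lin (g : R -> R) x := g (r^-1 * x + - (r^-1 * p))
  + (-2) * g (r^-1 * x + - (r^-1 * m)) + g (r^-1 * x + - (r^-1 * q)).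
have dlin (g dg : R -> R) (x : R) : (forall x : R, is_derive x 1 g (dg x)) ->
    is_derive x 1 (lin g) (r^-1 * lin dg x).
  move=> dgE; have := is_derive_addf (is_derive_addf (is_derive_affine r^-1 (- (r^-1 * p)) x dgE)
    (is_derive_scalef (-2) (is_derive_affine r^-1 (- (r^-1 * m)) x dgE)))
    (is_derive_affine r^-1 (- (r^-1 * q)) x dgE).
  by move=> /is_derive_congr; apply; rewrite /lin; ring.
have argE (x y : R) : r^-1 * x + - (r^-1 * y) = (x - y) / r by rewrite -mulrN -mulrDr mulrC.
have tphi : test_function (lin ramp).
  apply: (@smooth_test_function _ _ (p - r) (q + r)); [|lra|lra|].
    apply: smooth_add; last exact: smooth_affine.
    apply: smooth_add; first exact: smooth_affine.
    by apply: smooth_mul; [exact: smooth_cst|exact: smooth_affine].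
  move=> x; apply: contraNT; rewrite negb_and -!ltNge => /orP[xl|xr]; apply/eqP.
    rewrite /lin !argE !ramp0 ?mulr0 ?addr0// ler_pdivrMr//; lra.
  (* To the right of all three ramps they are affine with slope 1, and their second difference
     vanishes because m is the midpoint. *)
  by rewrite /lin !argE !ramp1 ?ler_pdivlMr//; [rewrite /m; field; exact: lt0r_neq0|lra..].
have e1 : derive1 (lin ramp) = fun x => r^-1 * lin sig x.
  by apply: derive1_is_derive => x; exact: dlin.
have e2 : derive1n 2 (lin ramp) = fun x => r^-1 * (r^-1 * lin rho x).
  by rewrite derive1nS derive1n1 e1; apply: derive1_is_derive.
have ck (y : R) : continuous (fun x => r^-1 * rho (r^-1 * x + - (r^-1 * y))).
  apply: continuous_mulf; first exact: continuous_cstf.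
  apply: continuous_compf => //; apply: continuous_addf; last exact: continuous_cstf.
  by apply: continuous_mulf; [exact: continuous_cstf|exact: continuous_idf].
have iK (y : R) : mu.-integrable `[0, 1]
    (EFin \o (fun x => f x * (r^-1 * rho (r^-1 * x + - (r^-1 * y))))).
  by apply: continuous_integrable_itv; exact: continuous_mulf.
have i2 := integrable_scalef (-2) (measurable_itvR _) (iK m).
have i3 := integrable_addf (measurable_itvR _) (iK p) i2.
have i4 := integrable_addf (measurable_itvR _) i3 (iK q).
have KE : r^-1 * (K p - 2 * K m + K q) = 0.
  rewrite -(hf _ tphi) e2.
  have -> : (fun x => f x * (r^-1 * (r^-1 * lin rho x))) =
     (fun x => r^-1 * (f x * (r^-1 * rho (r^-1 * x + - (r^-1 * p))) +
       (-2) * (f x * (r^-1 * rho (r^-1 * x + - (r^-1 * m)))) +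
       f x * (r^-1 * rho (r^-1 * x + - (r^-1 * q))))).
    by apply/funext => x; rewrite /lin; ring.
  rewrite (Rintegral_oo_eq_cc (integrable_scalef _ (measurable_itvR _) i4)).
  rewrite (RintegralZf _ (measurable_itvR _) i4) (RintegralD (measurable_itvR _) i3 (iK q)).
  rewrite (RintegralD (measurable_itvR _) (iK p) i2) (RintegralZf _ (measurable_itvR _) (iK m)).
  by rewrite /K mulNr.
have {}KE : K p - 2 * K m + K q = 0.
  by move/eqP: KE; rewrite mulf_eq0 invr_eq0 gt_eqF//= => /eqP.
have [hp hm hq] : [/\ `|f p - K p| <= D / 8, `|f m - K m| <= D / 8 & `|f q - K q| <= D / 8].
  by split; apply: close; apply/andP; split.
have : D <= D / 2.
  rewrite {1}/D; move: hp hm hq KE; clearbody K D; clear.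
  by rewrite !ler_norml => /andP[? ?] /andP[? ?] /andP[? ?] ?; apply/andP; split; lra.
lra.
Qed.

Lemma weakly_affine f : continuous f ->
  (forall phi, test_function phi -> \int[mu]_(x in `]0, 1[) (f x * derive1n 2 phi x) = 0) ->
  forall x : R, 0 <= x <= 1 -> f x = f 0 + x * (f 1 - f 0).
Proof.
by move=> cf hf; apply: affine_of_second_difference => //; exact: second_difference_of_weak.
Qed.

Lemma prim_is_derive f (x : R) : continuous f -> 0 < x < 1 -> is_derive x 1 (prim f) (f x).
Proof.
move=> cf /andP[x0 x1]; have [F [F0 dF]] := continuous_primitive cf.
apply: near_eq_is_derive (dF x).
near=> y; have y0 : 0 <= y by apply/ltW; near: y; exact: lt_nbhsr.
have y1 : y <= 1 by apply/ltW; near: y; exact: lt_nbhsl.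
by rewrite primE ?y0// (Rintegral_FTC2 y0 cf dF) F0 subr0.
Unshelve. all: by end_near. Qed.

(** The second-order lemma also settles the first-order case: the double primitive [W] of v is
    weakly affine, so its derivative [prim v] is constant, and it vanishes at 0. *)
Lemma prim_eq0 v : mu.-integrable `[0, 1] (EFin \o v) ->
  (forall phi, test_function phi -> \int[mu]_(x in `]0, 1[) (v x * phi x) = 0) ->
  forall x : R, 0 <= x <= 1 -> prim v x = 0.
Proof.
move=> iv hv.
have cv := prim_continuous iv.
pose W := prim (fun t => 0 + prim v t).
have cV : continuous (fun t => 0 + prim v t).
  by apply: continuous_addf; [exact: continuous_cstf|].
have cW : continuous W by apply: prim_continuous; exact: continuous_integrable_itv.
have W0 : W 0 = 0 by exact: prim0.
have aff : forall x : R, 0 <= x <= 1 -> W x = x * W 1.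
  move=> x x01; suff h : forall phi, test_function phi ->
      \int[mu]_(x in `]0, 1[) (W x * derive1n 2 phi x) = 0.
    by have := @weakly_affine W cW h x x01; rewrite W0 subr0 add0r.
  move=> phi tphi.
  have := weak_derivative2_prim 0 0 iv tphi; rewrite hv// mulr0 => e.
  rewrite -[RHS]e.
  by apply: eq_Rintegral => y _; rewrite add0r.
have eq : forall x : R, 0 <= x <= 1 -> prim v x = W 1.
  apply: (eq_on_closed01 cv (@continuous_cstf _ (W 1))) => x x01.
  have := prim_is_derive cV x01; rewrite add0r => -[_ <-].
  suff [_ <-] : is_derive x 1 W (W 1) by [].
  apply: (@near_eq_is_derive R R R (fun y : R => y * W 1)).
    move/andP: x01 => [x0 x1]; near=> y.
    have y0 : 0 <= y by apply/ltW; near: y; exact: lt_nbhsr.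
    have y1 : y <= 1 by apply/ltW; near: y; exact: lt_nbhsl.
    by rewrite [RHS]aff ?y0.
  have := is_derive_mulf (is_derive_idf x) (is_derive_cstf (W 1) x).
  by move=> /is_derive_congr; apply; ring.
by move=> x x01; rewrite eq// -(eq 0) ?prim0// lexx ler01.
Unshelve. all: by end_near. Qed.

(** By Lebesgue differentiation v is almost everywhere the derivative of its primitive. *)
Lemma ae_eq0_of_prim v : mu.-integrable `]0, 1[ (EFin \o v) ->
  (forall x : R, 0 <= x <= 1 -> prim v x = 0) ->
  {ae mu, forall x, `]0, 1[%classic x -> v x = 0}.
Proof.
move=> iv h0; have [iv' _] := Rintegral_oo_cc iv.
pose w := v \_ (`[0, 1]%classic : set (measurableTypeR R)).
have iw : mu.-integrable setT (EFin \o w).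
  by rewrite -restrict_EFin; apply/(integrable_restrict _ _ _ _).1; rewrite // setTI.
have lw : locally_integrable setT w by exact: integrable_locally_restrict.
have := @FTC1 R w (BLeft 0) _ lw.
move=> /(_ (fun y => integrableS measurableT (measurable_itvR _) (subsetT _) iw)).
apply: filterS; first exact: (ae_filter_ringOfSetsType mu).
move=> x /= h; rewrite in_itv/= => /andP[x0 x1].
have [_] := h x0; rewrite /w patchE ifT; last by rewrite inE/= in_itv/= !ltW.
move=> <-; rewrite derive1E.
suff [_ ->] : is_derive x 1 (fun x => \int[mu]_(t in `[0, x]) w t) (0 : R) by [].
apply: near_eq_is_derive (is_derive_cstf 0 x).
near=> y; have y0 : 0 <= y by apply/ltW; near: y; exact: lt_nbhsr.
have y1 : y <= 1 by apply/ltW; near: y; exact: lt_nbhsl.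
have y01 : 0 <= y <= 1 by rewrite y0.
rewrite -[LHS](h0 y y01) primE//; apply: eq_Rintegral => t; rewrite inE/= in_itv/= => /andP[t0 ty].
by rewrite /w patchE ifT// inE/= in_itv/= t0 (le_trans ty).
Unshelve. all: by end_near. Qed.

Lemma fundamental_lemma v : mu.-integrable `]0, 1[ (EFin \o v) ->
  (forall phi, test_function phi -> \int[mu]_(x in `]0, 1[) (v x * phi x) = 0) ->
  {ae mu, forall x, `]0, 1[%classic x -> v x = 0}.
Proof.
move=> iv hv; apply: ae_eq0_of_prim => //; apply: prim_eq0 => //.
by have [] := Rintegral_oo_cc iv.
Qed.

Lemma integrable_mul_test v phi : test_function phi ->
  mu.-integrable `]0, 1[ (EFin \o v) ->
  mu.-integrable `]0, 1[ (EFin \o (fun x => v x * phi x)).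
Proof.
move=> tphi /Rintegral_oo_cc[iv _]; apply: integrable_cc_oo.
have -> : (fun x => v x * phi x) = (fun x => phi x * v x).
  by apply/funext => x; rewrite mulrC.
by apply: integrable_mul_continuous => //; exact: test_function_continuous.
Qed.

(** The existence of v makes the choice a genuine weak derivative, and the fundamental lemma
    identifies the two almost everywhere. *)
Lemma weak_derivativeP k u v : L2 v -> is_weak_derivative k u v ->
  [/\ L2 (weak_derivative k u), is_weak_derivative k u (weak_derivative k u) &
  {ae mu, forall x, `]0, 1[%classic x -> weak_derivative k u x = v x}].
Proof.
move=> Lv wv; rewrite /weak_derivative; case: xgetP => [w _ [Lw ww]|/(_ v)[]//].
split => //.
have iv := L2_integrable Lv; have iw := L2_integrable Lw.
have iD := integrable_subf (measurable_itvR _) iw iv.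
have : {ae mu, forall x, `]0, 1[%classic x -> w x - v x = 0}.
  apply: fundamental_lemma => // phi tphi.
  have i1 := integrable_mul_test tphi iv; have i2 := integrable_mul_test tphi iw.
  have -> : (fun x => (w x - v x) * phi x) = (fun x => w x * phi x - v x * phi x).
    by apply/funext => x; rewrite mulrBl.
  rewrite (RintegralB (measurable_itvR _) i2 i1).
  have := wv phi tphi; rewrite (ww phi tphi) => /(congr1 (fun y => (-1) ^+ k * y)).
  by rewrite !mulrA -expr2 sqrr_sign !mul1r => ->; rewrite subrr.
apply: filterS; first exact: (ae_filter_ringOfSetsType mu).
by move=> x h /h /eqP; rewrite subr_eq0 => /eqP.
Qed.

(** The difference [f] of u and the double primitive of its second weak derivative is orthogonal to
    all second derivatives of test functions, hence affine. *)
Lemma W22_double_primitive u : W22 u -> {within `[0, 1], continuous u} -> u 0 = 0 ->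
  exists b : R, let U t := b + prim (weak_derivative 2 u) t in
  [/\ L2 (weak_derivative 2 u),
    forall x : R, 0 <= x <= 1 -> u x = prim U x &
    {ae mu, forall x, `]0, 1[%classic x -> weak_derivative 1 u x = U x}].
Proof.
move=> [Lu hu] cu u0.
have [v1 Lv1 wv1] := hu 1%N isT; have [v2' Lv2' wv2'] := hu 2%N isT.
have [Lv wv _] := weak_derivativeP Lv2' wv2'; set v := weak_derivative 2 u in Lv wv *.
have [iv _] := Rintegral_oo_cc (L2_integrable Lv).
have cv := prim_continuous iv.
have cV : continuous (fun t => 0 + prim v t).
  by apply: continuous_addf; [exact: continuous_cstf|].
have iV := continuous_integrable_itv 0 1 cV.
pose W := prim (fun t => 0 + prim v t).
have cW : continuous W by exact: prim_continuous.
pose f x := u (clamp x) - W x.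
have cf : continuous f by apply: continuous_subf => //; exact: continuous_comp_clamp.
have f0 : f 0 = 0 by rewrite /f clamp_id ?lexx ?ler01// u0 /W prim0 subrr.
have fE : forall x : R, 0 <= x <= 1 -> f x = x * f 1.
  move=> x x01; suff h : forall phi, test_function phi ->
      \int[mu]_(x in `]0, 1[) (f x * derive1n 2 phi x) = 0.
    by have := @weakly_affine f cf h x x01; rewrite f0 subr0 add0r.
  move=> phi tphi.
  have t2 : test_function (derive1n 2 phi).
    by rewrite derive1nS derive1n1; do 2 apply: test_function_derive1.
  have iW := integrable_mul_test t2 (integrable_cc_oo (continuous_integrable_itv 0 1 cW)).
  have iu := integrable_mul_test t2 (L2_integrable Lu).
  have -> : \int[mu]_(x in `]0, 1[) (f x * derive1n 2 phi x) =
    \int[mu]_(x in `]0, 1[) (u x * derive1n 2 phi x - W x * derive1n 2 phi x).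
    apply: eq_Rintegral => y; rewrite inE/= in_itv/= => /andP[y0 y1].
    by rewrite /f clamp_id ?mulrBl// !ltW.
  rewrite (RintegralB (measurable_itvR _) iu iW) (wv phi tphi).
  have e := weak_derivative2_prim 0 0 iv tphi.
  have -> : \int[mu]_(x in `]0, 1[) (W x * derive1n 2 phi x) =
    \int[mu]_(x in `]0, 1[) ((0 + prim (fun t => 0 + prim v t) x) * derive1n 2 phi x).
    by apply: eq_Rintegral => y _; rewrite add0r.
  by rewrite e subrr.
(* The slope of the affine function [f], which vanishes at 0, is the initial value of the first
   derivative. *)
exists (f 1); move=> U.
have cU : continuous U by apply: continuous_addf; [exact: continuous_cstf|].
have iU := continuous_integrable_itv 0 1 cU.
have uE (x : R) : 0 <= x <= 1 -> u x = prim U x.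
  move=> x01; have /andP[x0 x1] := x01.
  have -> : u x = f x + W x by rewrite /f clamp_id// subrK.
  rewrite fE// /W !primE//.
  have ic : mu.-integrable `[0, x] (EFin \o (fun=> f 1)).
    by apply: continuous_integrable_itv; exact: continuous_cstf.
  have -> : x * f 1 = \int[mu]_(t in `[0, x]) f 1.
    have d (y : R) : is_derive y 1 (fun y => y * f 1) (f 1).
      have := is_derive_mulf (is_derive_idf y) (is_derive_cstf (f 1) y).
      by move=> /is_derive_congr; apply; ring.
    by rewrite (Rintegral_FTC2 x0 (@continuous_cstf _ (f 1)) d) mul0r subr0.
  rewrite -RintegralD//; last exact: integrable_sub01 iV.
  by apply: eq_Rintegral => y _; rewrite add0r.
split => //.
have LU : L2 U by exact: L2_continuous.
have wU : is_weak_derivative 1 u U.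
  move=> phi tphi; have := weak_derivative1_prim 0 iU tphi => <-.
  apply: eq_Rintegral => y; rewrite inE/= in_itv/= => /andP[y0 y1].
  by rewrite uE ?add0r// !ltW.
by have [] := weak_derivativeP LU wU.
Qed.

End DuBoisReymond.

(** * Lower bound for the energy *)

Section LowerBound.
Context {R : realType}.
Local Notation mu := (@lebesgue_measure R).
Local Notation unit_itv := (`]0, 1[%classic : set (measurableTypeR R)).
Implicit Types (u v w U : R -> R).

(** The chosen weak derivatives may be replaced by any almost everywhere equal ones, and the energy
    is finite because g <= 1 and v is square integrable. *)
Lemma energyE u v U : L2 (weak_derivative 1 u) -> L2 (weak_derivative 2 u) ->
  L2 v -> measurable_fun unit_itv U ->
  {ae mu, forall x, `]0, 1[%classic x -> weak_derivative 2 u x = v x} ->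
  {ae mu, forall x, `]0, 1[%classic x -> weak_derivative 1 u x = U x} ->
  energy u = (\int[mu]_(x in `]0, 1[) (v x ^+ 2 * gw (U x) ^+ 2))%:E.
Proof.
move=> L1 L2' Lv mU ae2 ae1.
have gw2 (t : R) : gw t ^+ 2 = pw (- (5 / 2)) t.
  by rewrite expr2 /gw pw_mul; congr pw; field.
have gwV (t : R) : gw t ^+ 2 = ((1 + t ^+ 2) `^ (5 / 2))^-1 by rewrite gw2 /pw powRN.
have mg (f : R -> R) : measurable_fun unit_itv f ->
    measurable_fun unit_itv (fun x => gw (f x) ^+ 2).
  move=> mf; apply: measurable_funX; apply: measurableT_comp mf.
  by apply: measurable_continuous; exact: continuous_gw.
have gb (t : R) : `|gw t ^+ 2| <= 1.
  by rewrite gw2 ger0_norm ?pw_ge0// pw_le1//; lra.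
have -> : (\int[mu]_(x in `]0, 1[) (v x ^+ 2 * gw (U x) ^+ 2))%:E =
    (\int[mu]_(x in `]0%R, 1%R[) (v x ^+ 2 * gw (U x) ^+ 2)%:E)%E.
  apply: EFin_Rintegral; first exact: measurable_itvR.
  have -> : (fun x => v x ^+ 2 * gw (U x) ^+ 2) = (fun x => gw (U x) ^+ 2 * v x ^+ 2).
    by apply/funext => x; rewrite mulrC.
  apply: (@integrable_mulf _ _ 1 _ _ (measurable_itvR _)) => //; first exact: mg.
  exact: L2_sqr.
rewrite /energy; apply: ae_eq_integral => //.
- apply/measurable_EFinP.
  have -> : (fun x => weak_derivative 2 u x ^+ 2 / (1 + weak_derivative 1 u x ^+ 2) `^ (5 / 2)) =
      (fun x => weak_derivative 2 u x ^+ 2 * gw (weak_derivative 1 u x) ^+ 2).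
    by apply/funext => x; rewrite gwV.
  apply: measurable_funM; last by apply: mg; exact: L2_measurable.
  by apply: measurable_funX; exact: L2_measurable.
- apply/measurable_EFinP; apply: measurable_funM; last exact: mg.
  by apply: measurable_funX; exact: L2_measurable.
- apply: filterS2 ae1 ae2; first exact: (ae_filter_ringOfSetsType mu).
  by move=> x h1 h2 Dx; rewrite h1// h2// gwV.
Qed.

(* Pointwise [(w g(V) -+ c sqrt(1 - V/A))^2 >= 0] on [p,q], and only
   [w^2 g(V)^2 >= 0 >= - c^2 (1 - V/A)] elsewhere. *)
Lemma half_estimate w (b A l p q r c s : R) : mu.-integrable `[0, 1] (EFin \o w) ->
  mu.-integrable `[0, 1] (EFin \o (fun x => w x ^+ 2)) ->
  let V x := b + prim w x in
  0 <= l -> l <= p -> p <= q -> q <= r -> r <= 1 -> 0 < A -> 0 <= c ->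
  (forall x, l <= x <= r -> V x <= A) -> s ^+ 2 = 1 ->
  (V p = 0 /\ V q = A /\ s = 1) \/ (V p = A /\ V q = 0 /\ s = -1) ->
  2 * c * (half_length - A^-1) - c ^+ 2 * \int[mu]_(x in `[l, r]) (1 - V x / A) <=
  \int[mu]_(x in `[l, r]) (w x ^+ 2 * gw (V x) ^+ 2).
Proof.
move=> iw iw2 V l0 lp pq qr r1 A0 c0 VA s2 hV.
pose k (t : R) := Num.sqrt (1 - t / A) * gw t.
have ck : continuous k.
  apply: continuous_mulf; last exact: continuous_gw.
  apply: (@continuous_compf R Num.sqrt (fun t => 1 - t / A)); first exact: sqrt_continuous.
  apply: continuous_subf; first exact: continuous_cstf.
  by apply: continuous_mulf; [exact: continuous_idf|exact: continuous_cstf].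
have [K [K0 dK]] := continuous_primitive ck.
have [G [G0 dG]] := continuous_primitive (@continuous_gw R).
have KA := key_inequality_half dG G0 A0 K0 dK.
have cV : continuous V by apply: continuous_addf; [exact: continuous_cstf|exact: prim_continuous].
have cn : continuous (fun x => 1 - V x / A).
  apply: continuous_subf; first exact: continuous_cstf.
  by apply: continuous_mulf => //; exact: continuous_cstf.
have ckV : continuous (fun x => k (V x)) by exact: continuous_compf ck cV.
have cg : continuous (fun x => gw (V x) ^+ 2).
  apply: continuous_expf; exact: (continuous_compf gw V (@continuous_gw R) cV).
have iE (x y : R) : 0 <= x -> y <= 1 ->
    mu.-integrable `[x, y] (EFin \o (fun t => w t ^+ 2 * gw (V t) ^+ 2)).
  move=> x0 y1.
  have -> : (fun t => w t ^+ 2 * gw (V t) ^+ 2) = (fun t => gw (V t) ^+ 2 * w t ^+ 2).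
    by apply/funext => t; rewrite mulrC.
  apply: integrable_mul_continuous => //.
  exact: (integrable_sub01 x0 y1 iw2).
have in_ (x y : R) : mu.-integrable `[x, y] (EFin \o (fun t => 1 - V t / A)).
  exact: continuous_integrable_itv.
have outer (x y : R) : l <= x -> x <= y -> y <= r ->
    - (c ^+ 2 * \int[mu]_(t in `[x, y]) (1 - V t / A)) <=
    \int[mu]_(t in `[x, y]) (w t ^+ 2 * gw (V t) ^+ 2).
  move=> lx xy yr; rewrite -mulNr -(RintegralZf _ (measurable_itvR _) (in_ x y)).
  apply: (le_Rintegral (measurable_itvR _)).
  - exact: integrable_scalef (measurable_itvR _) (in_ x y).
  - by apply: iE; [exact: le_trans lx|exact: le_trans r1].
  move=> t /=; rewrite in_itv/= => /andP[xt ty].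
  apply: (@le_trans _ _ 0); last by rewrite mulr_ge0 ?sqr_ge0.
  rewrite mulNr oppr_le0 mulr_ge0 ?sqr_ge0// subr_ge0 ler_pdivrMr// mul1r VA//.
  by rewrite (le_trans lx)// (le_trans ty).
have p0 := le_trans l0 lp. have q1 := le_trans qr r1.
have ikw : mu.-integrable `[p, q] (EFin \o (fun t => k (V t) * w t)).
  by apply: integrable_mul_continuous => //; exact: (integrable_sub01 p0 q1 iw).
have inner : 2 * c * s * \int[mu]_(t in `[p, q]) (k (V t) * w t)
    - c ^+ 2 * \int[mu]_(t in `[p, q]) (1 - V t / A) <=
    \int[mu]_(t in `[p, q]) (w t ^+ 2 * gw (V t) ^+ 2).
  have ia := integrable_scalef (2 * c * s) (measurable_itvR _) ikw.
  have ib := integrable_scalef (c ^+ 2) (measurable_itvR _) (in_ p q).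
  rewrite -(RintegralZf _ (measurable_itvR _) (in_ p q)).
  rewrite -(RintegralZf _ (measurable_itvR _) ikw).
  rewrite -(RintegralB (measurable_itvR _) ia ib).
  apply: (le_Rintegral (measurable_itvR _)).
  - exact: integrable_subf (measurable_itvR _) ia ib.
  - exact: iE.
  move=> t /=; rewrite in_itv/= => /andP[pt tq]; rewrite /k.
  have h0 : 0 <= 1 - V t / A.
    rewrite subr_ge0 ler_pdivrMr// mul1r VA//.
    by rewrite (le_trans lp)// (le_trans tq).
  have := sqr_sqrtr h0; set z := Num.sqrt _ => <-; set g := gw _.
  have := sqr_ge0 (s * (w t * g) - c * z).
  rewrite sqrrB exprMn s2 mul1r 2!exprMn; move: (w t) => a.
  by clear -a; lra.
have chain : \int[mu]_(t in `[p, q]) (k (V t) * w t) = K (V q) - K (V p).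
  exact: (prim_chain_rule b iw ck dK p0 pq q1).
(* The sign [s] accounts for the direction in which V runs between 0 and A; as s^2 = 1 it leaves the
   squares unchanged. *)
have chain' : s * \int[mu]_(t in `[p, q]) (k (V t) * w t) = K A.
  by rewrite chain; case: hV => -[-> [-> ->]]; rewrite K0; ring.
have lr := le_trans lp (le_trans pq qr).
rewrite (@Rintegral_split _ (fun x => w x ^+ 2 * gw (V x) ^+ 2) l p r)//;
  [|exact: le_trans qr|exact: iE].
rewrite (@Rintegral_split _ (fun x => w x ^+ 2 * gw (V x) ^+ 2) p q r)//; last exact: iE.
rewrite (@Rintegral_split _ (fun x => 1 - V x / A) l p r)//; last exact: le_trans qr.
rewrite (@Rintegral_split _ (fun x => 1 - V x / A) p q r)//.
have o1 := outer l p (lexx _) lp (le_trans pq qr).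
have o2 := outer q r (le_trans lp pq) qr (lexx _).
have key : 2 * c * (half_length - A^-1) <= 2 * c * s * \int[mu]_(t in `[p, q]) (k (V t) * w t).
  by rewrite -[leRHS]mulrA chain' ler_wpM2l// mulr_ge0.
rewrite !mulrDr; move: o1 o2 key inner.
move: (Rintegral _ _ _) (Rintegral _ _ _) (Rintegral _ _ _) (Rintegral _ _ _) (Rintegral _ _ _) (Rintegral _ _ _) (Rintegral _ _ _).
by move=> i1 i2 i3 i4 i5 i6 i7; lra.
Qed.

Lemma energy_lower_bound u (h x0 : R) : W22 u -> {within `[0, 1], continuous u} ->
  u 0 = 0 -> u 1 = 0 -> 0 <= x0 <= 1 -> h <= u x0 -> 1 < h * half_length ->
  (((2 * half_length) ^+ 2)%:E < energy u)%E.
Proof.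
move=> hu cu u0 u1 x01 hx hL.
have L0 : (0 : R) < half_length by exact: half_length_gt0.
have h0 : 0 < h by move: hL; rewrite -(pmulr_lgt0 h L0); lra.
have [b [Lv uE ae1]] := W22_double_primitive hu cu u0.
set v := weak_derivative 2 u in Lv uE ae1.
have [iv _] := Rintegral_oo_cc (L2_integrable Lv).
have [iv2 _] := Rintegral_oo_cc (L2_sqr Lv).
pose U x := b + prim v x.
have cU : continuous U by apply: continuous_addf; [exact: continuous_cstf|exact: prim_continuous].
have iU := continuous_integrable_itv 0 1 cU.
have [v1 Lv1 wv1] := hu.2 1%N isT.
have [L1 _ _] := weak_derivativeP Lv1 wv1.
have -> : energy u = (\int[mu]_(x in `]0, 1[) (v x ^+ 2 * gw (U x) ^+ 2))%:E.
  apply: energyE => //; first exact: measurable_continuous.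
  exact: aeW.
rewrite lte_fin.
have ivU : mu.-integrable `[0, 1] (EFin \o (fun x => v x ^+ 2 * gw (U x) ^+ 2)).
  have -> : (fun x => v x ^+ 2 * gw (U x) ^+ 2) = (fun x => gw (U x) ^+ 2 * v x ^+ 2).
    by apply/funext => x; rewrite mulrC.
  apply: integrable_mul_continuous => //; apply: continuous_expf.
  exact: (continuous_compf gw U (@continuous_gw R) cU).
rewrite (Rintegral_oo_eq_cc ivU).
have cP : continuous (prim U) by exact: prim_continuous.
have [m] := EVT_max ler01 (continuous_subspaceT cP).
rewrite in_itv/= => /andP[m0 m1] hm.
have P0 := prim0 U; have P1 : prim U 1 = 0 by rewrite -uE ?u1// ler01 lexx.
pose H := prim U m.
have Hh : h <= H by apply: (le_trans hx); rewrite uE//; apply: hm; rewrite in_itv.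
have {}m0 : 0 < m.
  by rewrite lt_neqAle m0 andbT; apply/eqP => e; move: Hh; rewrite /H -e P0; lra.
have {}m1 : m < 1.
  by rewrite lt_neqAle m1 andbT; apply/eqP => e; move: Hh; rewrite /H e P1; lra.
have m01 : 0 < m < 1 by rewrite m0.
have Um : U m = 0.
  have [_ <-] := prim_is_derive cU m01.
  have [_ ->//] : is_derive m 1 (prim U) 0.
  apply: (derive1_at_max ler01) => [t| |t].
  - by rewrite in_itv/= => t01; have [] := prim_is_derive cU t01.
  - by rewrite in_itv.
  - by rewrite in_itv/= => /andP[t0 t1]; apply: hm; rewrite in_itv/= !ltW.
have Hl : \int[mu]_(x in `[0, m]) U x = H.
  by rewrite -(prim_sub iU (lexx 0) (ltW m0) (ltW m1)) P0 subr0.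
have Hr : \int[mu]_(x in `[m, 1]) U x = - H.
  by rewrite -(prim_sub iU (ltW m0) (ltW m1) (lexx 1)) P1 sub0r.
have imax (f : R -> R) (x y A : R) : x <= y -> continuous f ->
    (forall t, x <= t <= y -> f t <= A) -> A <= 0 -> \int[mu]_(t in `[x, y]) f t <= 0.
  move=> xy cf fA A0; rewrite -oppr_ge0 -mulN1r -(RintegralZf (-1) (measurable_itvR _) (continuous_integrable_itv x y cf)).
  apply: Rintegral_ge0 => t; rewrite /= in_itv/= => txy.
  by rewrite mulN1r oppr_ge0 (le_trans (fA t txy)).
have [p] := EVT_max (ltW m0) (continuous_subspaceT cU).
rewrite in_itv/= => /andP[p0 pm] hp.
have [q] := EVT_max (ltW m1) (continuous_subspaceT (continuous_oppf cU)).
rewrite in_itv/= => /andP[mq q1] hq.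
(* Otherwise the derivative is at most 0 on [0,m], against its integral H > 0. *)
have A0 : 0 < U p.
  rewrite ltNge; apply/negP => A0.
  have : \int[mu]_(t in `[0, m]) U t <= 0.
    apply: (imax U 0 m (U p) (ltW m0) cU _ A0) => t tm.
    by apply: hp; rewrite in_itv.
  by rewrite Hl leNgt (lt_le_trans h0 Hh).
have B0 : 0 < - U q.
  rewrite ltNge; apply/negP => B0.
  have : \int[mu]_(t in `[m, 1]) (- U t) <= 0.
    apply: (imax _ m 1 (- U q) (ltW m1) (continuous_oppf cU) _ B0) => t tm.
    by apply: hq; rewrite in_itv.
  have -> : \int[mu]_(t in `[m, 1]) (- U t) = H.
    rewrite -[RHS]opprK -Hr -mulN1r.
    rewrite -(RintegralZf (-1) (measurable_itvR _) (continuous_integrable_itv m 1 cU)).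
    by apply: eq_Rintegral => t _; rewrite mulN1r.
  by rewrite leNgt (lt_le_trans h0 Hh).
set A := U p in A0 hp; set B := - U q in B0 hq.
(* The two halves together give 4 c [half_length] - c^2 plus terms in 1/A and 1/B; this value of c
   maximises the former part. *)
pose c := 2 * @half_length R.
have c0 : 0 <= c by rewrite mulr_ge0// ltW.
have left := @half_estimate v b A 0 p m m c (-1) iv iv2 (lexx 0) p0 pm (lexx m) (ltW m1) A0 c0.
have {}left : 2 * c * (half_length - A^-1) - c ^+ 2 * \int[mu]_(x in `[0, m]) (1 - U x / A) <=
    \int[mu]_(x in `[0, m]) (v x ^+ 2 * gw (U x) ^+ 2).
  apply: left; rewrite ?sqrrN ?expr1n//.
  by right.
(* The right half is the left-hand situation for the opposite slope -U; g is even. *)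
pose w x := - v x.
have wE (x : R) : prim w x = - prim v x.
  have /andP[_ c1] := clamp01 x; have ivc := integrable_sub01 (lexx 0) c1 iv.
  rewrite /prim -[RHS]mulN1r -(RintegralZf (-1) (measurable_itvR _) ivc).
  by apply: eq_Rintegral => t _; rewrite mulN1r.
have VE x : - b + prim w x = - U x by rewrite wE /U opprD.
have iw : mu.-integrable `[0, 1] (EFin \o w).
  have := integrable_scalef (-1) (measurable_itvR _) iv.
  by congr (mu.-integrable _ _); apply/funext => t /=; rewrite mulN1r.
have iw2 : mu.-integrable `[0, 1] (EFin \o (fun x => w x ^+ 2)).
  have -> // : (fun x => w x ^+ 2) = (fun x => v x ^+ 2).
  by apply/funext => x; rewrite sqrrN.
have right_ := @half_estimate w (- b) B m m q 1 c 1 iw iw2 (ltW m0) (lexx m) mq q1 (lexx 1) B0 c0.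
have {}right_ : 2 * c * (half_length - B^-1) - c ^+ 2 * \int[mu]_(x in `[m, 1]) (1 + U x / B) <=
    \int[mu]_(x in `[m, 1]) (v x ^+ 2 * gw (U x) ^+ 2).
  have -> : \int[mu]_(x in `[m, 1]) (1 + U x / B) =
      \int[mu]_(x in `[m, 1]) (1 - (- b + prim w x) / B).
    by apply: eq_Rintegral => x _; rewrite VE mulNr opprK.
  have -> : \int[mu]_(x in `[m, 1]) (v x ^+ 2 * gw (U x) ^+ 2) =
      \int[mu]_(x in `[m, 1]) (w x ^+ 2 * gw (- b + prim w x) ^+ 2).
    by apply: eq_Rintegral => x _; rewrite VE /w sqrrN /gw pwN.
  apply: right_; rewrite ?expr1n//.
    by move=> x xm; rewrite VE; apply: hq; rewrite in_itv.
  by left; rewrite !VE Um oppr0.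
have lin (x y d : R) : 0 <= x -> x <= y -> y <= 1 ->
    \int[mu]_(t in `[x, y]) (1 + U t / d) = (y - x) + (\int[mu]_(t in `[x, y]) U t) / d.
  move=> x0' xy y1.
  have i1 := continuous_integrable_itv x y (@continuous_cstf R 1).
  have i2 := continuous_integrable_itv x y cU.
  have -> : \int[mu]_(t in `[x, y]) (1 + U t / d) = \int[mu]_(t in `[x, y]) (1 + d^-1 * U t).
    by apply: eq_Rintegral => t _; rewrite mulrC.
  rewrite (RintegralD (measurable_itvR _) i1 (integrable_scalef _ (measurable_itvR _) i2)).
  rewrite (RintegralZf _ (measurable_itvR _) i2) [_ / d]mulrC; congr (_ + _).
  have d1 (t : R) : is_derive t 1 (fun t => t) (1 : R) by exact: is_derive_idf.
  by rewrite (Rintegral_FTC2 xy (@continuous_cstf R 1) d1).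
rewrite (@Rintegral_split _ _ 0 m 1 (ltW m0) (ltW m1) ivU).
have e1 : \int[mu]_(x in `[0, m]) (1 - U x / A) = m - H / A.
  have := lin 0 m (- A) (lexx 0) (ltW m0) (ltW m1); rewrite Hl subr0 invrN mulrN => <-.
  by apply: eq_Rintegral => t _; rewrite mulrN.
have e2 : \int[mu]_(x in `[m, 1]) (1 + U x / B) = 1 - m - H / B.
  by rewrite lin// ?ltW// Hr mulNr.
rewrite e1 in left; rewrite e2 in right_.
have s0 : 0 < A^-1 + B^-1 by rewrite addr_gt0// invr_gt0.
have cH : 0 < c * H - 2.
  have : 1 < H * half_length by apply: (lt_le_trans hL); rewrite ler_wpM2r// ltW.
  rewrite /c; lra.
have gain : 0 < c * ((A^-1 + B^-1) * (c * H - 2)).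
  by rewrite !mulr_gt0// /c mulr_gt0.
apply: (lt_le_trans _ (lerD left right_)).
rewrite -/c -subr_gt0; apply: (lt_le_trans gain).
by rewrite le_eqVlt; apply/orP; left; apply/eqP; rewrite /c; ring.
Qed.

End LowerBound.

(** * The competitor *)

Section Competitor.
Context {R : realType}.
Local Notation mu := (@lebesgue_measure R).
Local Notation unit_itv := (`]0, 1[%classic : set (measurableTypeR R)).
Implicit Types (u v w U f F : R -> R).

Lemma is_derive_ge0_le f (df : R -> R) (x y : R) : (forall t : R, is_derive t 1 f (df t)) ->
  x <= y -> (forall t, x < t < y -> 0 <= df t) -> f x <= f y.
Proof.
move=> d xy d0; apply: (derive_ge0_le xy _ (fun t _ => d t) d0).
by apply: continuous_subspaceT => t; exact: is_derive_continuous (d t).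
Qed.

Lemma eq_of_is_derive (f g d : R -> R) : (forall t : R, is_derive t 1 f (d t)) ->
  (forall t : R, is_derive t 1 g (d t)) -> f 0 = g 0 -> f =1 g.
Proof.
move=> df dg e.
have inc (a b : R -> R) (x y : R) : (forall t : R, is_derive t 1 a (d t)) ->
    (forall t : R, is_derive t 1 b (d t)) -> x <= y -> a x - b x <= a y - b y.
  move=> da db xy; have dab (t : R) : is_derive t 1 (fun t => a t - b t) (d t - d t).
    exact: is_derive_subf.
  by apply: (is_derive_ge0_le dab xy) => t _; rewrite subrr.
move=> x; have [x0|x0] := leP 0 x.
  by have := inc _ _ _ _ df dg x0; have := inc _ _ _ _ dg df x0; rewrite e; lra.
by have := inc _ _ _ _ df dg (ltW x0); have := inc _ _ _ _ dg df (ltW x0); rewrite e; lra.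
Qed.

Lemma is_derive_flip f (d : R -> R) (a x : R) : (forall t : R, is_derive t 1 f (d t)) ->
  is_derive x 1 (fun t => f (a - t)) (- d (a - x)).
Proof.
move=> df; have := is_derive_compf f (fun t => a - t) (df _)
  (is_derive_subf (is_derive_cstf a x) (is_derive_idf x)).
by move=> /is_derive_congr; apply; ring.
Qed.

(* [Z] is the inverse of the odd function [kap * int_0^t gw + eta * t]. *)
Lemma inverse_profile (kap eta : R) : 0 < kap -> 0 < eta ->
  exists Z P : R -> R,
  [/\ forall z : R, is_derive z 1 P (Z z),
      forall z : R, is_derive z 1 Z (kap * gw (Z z) + eta)^-1, P 0 = 0 & Z 0 = 0] /\
  [/\ forall z, P (- z) = P z & forall z, z <= kap * half_length + eta * Z z].
Proof.
move=> k0 e0; have [G [G0 dG]] := continuous_primitive (@continuous_gw R).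
pose Y t := kap * G t + eta * t; pose dY t := kap * gw t + eta.
have Y0 : Y 0 = 0 by rewrite /Y G0 !mulr0 addr0.
have dYE (t : R) : is_derive t 1 Y (dY t).
  have := is_derive_addf (is_derive_scalef kap (dG t)) (is_derive_scalef eta (is_derive_idf t)).
  by move=> /is_derive_congr; apply; rewrite /dY mulr1.
have dY0 t : 0 < dY t by rewrite ltr_wpDl// mulr_ge0 ?gw_ge0// ltW.
have cY : continuous Y by move=> t; exact: is_derive_continuous (dYE t).
have Ygrow (x y : R) : x <= y -> eta * (y - x) <= Y y - Y x.
  move=> xy; have := gw_primitive_le dG xy => h.
  by rewrite /Y mulrBr; have := ler_wpM2l (ltW k0) h; lra.
have Yinj : injective Y.
  move=> x y e; have [xy|yx] := leP x y.
    have := Ygrow _ _ xy; rewrite e subrr pmulr_rle0// => h; lra.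
  by have := Ygrow _ _ (ltW yx); rewrite e subrr pmulr_rle0// => h; lra.
have Ysurj z : exists t, Y t = z.
  (* Y has slope at least eta, so its values at -M and M enclose z. *)
  pose M := `|z| / eta; have M0 : 0 <= M by rewrite divr_ge0// ltW.
  have eM : eta * M = `|z| by rewrite mulrC divfK// gt_eqF.
  have h1 := Ygrow _ _ M0; rewrite Y0 !subr0 eM in h1.
  have NM : - M <= 0 by lra.
  have h2 := Ygrow _ _ NM; rewrite Y0 !sub0r opprK eM in h2.
  have [||t _ <-] := @IVT R Y (- M) M z _ (continuous_subspaceT cY); [lra| |by exists t].
  rewrite ge_min le_max; have := ler_norm z; have := ler_norm (- z); rewrite normrN => ? ?.
  by apply/andP; split; apply/orP; [left|right]; lra.
have [Z ZK] := boolp.choice Ysurj.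
have YK : cancel Y Z by move=> t; apply: Yinj; exact: ZK.
have dZ (z : R) : is_derive z 1 Z (kap * gw (Z z) + eta)^-1.
  rewrite -{1}(ZK z); apply: (@is_derive_inverse R Y Z) => //.
  - by near=> t; exact: YK.
  - by near=> t; exact: cY.
  - by rewrite gt_eqF// dY0.
have cZ : continuous Z by move=> t; exact: is_derive_continuous (dZ t).
have [P [P0 dP]] := continuous_primitive cZ.
have Godd (t : R) : G (- t) = - G t.
  have d1 (s : R) : is_derive s 1 (fun s => - G (0 - s)) (gw s).
    have := is_derive_oppf (is_derive_flip 0 s dG).
    by move=> /is_derive_congr; apply; rewrite sub0r opprK /gw pwN.
  have := eq_of_is_derive d1 dG; rewrite subr0 G0 oppr0 => /(_ erefl t) <-.
  by rewrite sub0r opprK.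
have Yodd t : Y (- t) = - Y t by rewrite /Y Godd; ring.
have Zodd z : Z (- z) = - Z z by apply: Yinj; rewrite Yodd !ZK.
exists Z, P; split; split => //.
- by apply: Yinj; rewrite ZK Y0.
- move=> z; have d1 (s : R) : is_derive s 1 (fun s => P (0 - s)) (Z s).
    have := is_derive_flip 0 s dP.
    by move=> /is_derive_congr; apply; rewrite sub0r Zodd opprK.
  by have := eq_of_is_derive d1 dP; rewrite subr0 => /(_ erefl z) <-; rewrite sub0r.
(* This is z = Y(Z(z)) with the primitive of g bounded by [half_length]; it forces Z to be large
   once z exceeds [kap * half_length]. *)
- move=> z; rewrite -{1}(ZK z) /Y lerD2r ler_wpM2l ?(ltW k0)//.
  exact: gw_primitive_le_half dG G0 _.
Unshelve. all: by end_near. Qed.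

Lemma prim_of_derive f F (x : R) : continuous f -> (forall t : R, is_derive t 1 F (f t)) ->
  0 <= x <= 1 -> prim f x = F x - F 0.
Proof. by move=> cf dF x01; have /andP[x0 _] := x01; rewrite primE// (Rintegral_FTC2 x0 cf dF). Qed.

Lemma C2_weak_derivatives w U v : continuous v ->
  (forall t : R, is_derive t 1 w (U t)) -> (forall t : R, is_derive t 1 U (v t)) ->
  [/\ W22 w, is_weak_derivative 1 w U & is_weak_derivative 2 w v].
Proof.
move=> cv dw dU.
have cw : continuous w by move=> t; exact: is_derive_continuous (dw t).
have cU : continuous U by move=> t; exact: is_derive_continuous (dU t).
have iv := continuous_integrable_itv 0 1 cv.
have iU := continuous_integrable_itv 0 1 cU.
have w1 : is_weak_derivative 1 w U.
  move=> phi tphi; rewrite -(weak_derivative1_prim (w 0) iU tphi).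
  apply: eq_Rintegral => y; rewrite inE/= in_itv/= => /andP[y0 y1].
  by rewrite (prim_of_derive cU dw) ?(ltW y0) ?(ltW y1)// subrKC.
have w2 : is_weak_derivative 2 w v.
  move=> phi tphi; rewrite -(weak_derivative2_prim (w 0) (U 0) iv tphi).
  apply: eq_Rintegral => y; rewrite inE/= in_itv/= => /andP[y0 y1].
  have y01 : 0 <= y <= 1 by rewrite !ltW.
  congr (_ * _); rewrite -[LHS](subrKC (w 0)) -(prim_of_derive cU dw y01); congr (_ + _).
  rewrite !primE//; apply: eq_Rintegral => t; rewrite inE/= in_itv/= => /andP[t0 ty].
  by rewrite (prim_of_derive cv dU) ?t0 ?(le_trans ty (ltW y1))// subrKC.
split => //; split; first exact: L2_continuous.
case=> [//|[|[|//]]] _; [exists U => //|exists v => //]; exact: L2_continuous.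
Qed.

Lemma competitor (h e : R) : 0 < h -> (2 * half_length) ^+ 2 < e ->
  exists w : R -> R, [/\ W22 w, continuous w, w 0 = 0, w 1 = 0 &
    [/\ forall x : R, w (1 - x) = w x,
     forall x : R, 0 <= x <= 1 / 2 -> 2 * x * h <= w x & (energy w <= e%:E)%E]].
Proof.
move=> h0 ce; have L0 : (0 : R) < half_length by exact: half_length_gt0.
set c := 2 * half_length in ce; have c0 : 0 < c by rewrite mulr_gt0.
have e0 : 0 < e by apply: lt_trans ce; rewrite exprn_gt0.
pose rho := c ^+ 2 / e.
have rho1 : rho < 1 by rewrite ltr_pdivrMr// mul1r.
have rho0 : 0 < rho by rewrite divr_gt0// exprn_gt0.
(* Chosen so that (1 - d)^2 >= 1 - 2 d = c^2/e, which is kap^(-2) <= e. *)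
pose d := (1 - rho) / 2.
have d0 : 0 < d by rewrite /d; lra.
have d1 : d < 1 / 2 by rewrite /d; lra.
pose kap := (1 - d) / c; have k0 : 0 < kap by rewrite divr_gt0//; lra.
(* The lower bound for the height obtained below is d^2/(8 eta), here equal to h. *)
pose eta := d ^+ 2 / (8 * h); have eta0 : 0 < eta by rewrite divr_gt0 ?exprn_gt0// mulr_gt0.
have kL : kap * half_length = (1 - d) / 2.
  by rewrite /kap /c; field; exact: lt0r_neq0.
have ke : kap ^- 2 <= e.
  rewrite invf_ple ?posrE ?exprn_gt0//.
  have -> : e^-1 = rho / c ^+ 2 by rewrite /rho mulrAC divff ?mul1r// gt_eqF// exprn_gt0.
  rewrite /kap expr_div_n ler_wpM2r ?invr_ge0 ?sqr_ge0//.
  by rewrite sqrrB expr1n mul1r; have := sqr_ge0 d; rewrite {2}/d; lra.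
have [Z [P [[dP dZ P0 Z0] [Pev Zlow]]]] := inverse_profile k0 eta0.
pose dZf z := (kap * gw (Z z) + eta)^-1.
have den0 t : 0 < kap * gw t + eta by rewrite ltr_wpDl// mulr_ge0 ?gw_ge0// ltW.
have cZ : continuous Z by move=> t; exact: is_derive_continuous (dZ t).
have Zmono (x y : R) : x <= y -> Z x <= Z y.
  move=> xy; apply: (is_derive_ge0_le dZ xy) => t _.
  by rewrite invr_ge0 ltW.
have cP : continuous P by move=> t; exact: is_derive_continuous (dP t).
have Z_ge0 (z : R) : 0 <= z -> 0 <= Z z by move=> z0; rewrite -Z0; exact: Zmono.
pose w x := P (1 / 2) - P (1 / 2 - x).
pose U x := Z (1 / 2 - x).
pose v x := - dZf (1 / 2 - x).
have dw (x : R) : is_derive x 1 w (U x).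
  have := is_derive_subf (is_derive_cstf (P (1 / 2)) x) (is_derive_flip (1 / 2) x dP).
  by move=> /is_derive_congr; apply; rewrite sub0r opprK.
have dU (x : R) : is_derive x 1 U (v x) by exact: is_derive_flip.
have cw : continuous w by move=> t; exact: is_derive_continuous (dw t).
have cU : continuous U by move=> t; exact: is_derive_continuous (dU t).
have cv : continuous v.
  apply: continuous_oppf; apply: (@continuous_compf R dZf (fun x => 1 / 2 - x)).
    apply: continuous_invf; last by move=> y; rewrite gt_eqF.
    apply: continuous_addf; last exact: continuous_cstf.
    apply: continuous_mulf; first exact: continuous_cstf.
    exact: (continuous_compf gw Z (@continuous_gw R) cZ).
  by apply: continuous_subf; [exact: continuous_cstf|exact: continuous_idf].
have [Ww w1 w2] := C2_weak_derivatives cv dw dU.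
have w0 : w 0 = 0 by rewrite /w subr0 subrr.
have wsym (x : R) : w (1 - x) = w x.
  by rewrite /w -[P (1 / 2 - x)]Pev; congr (_ - P _); field.
exists w; split => //; first by rewrite -[1]subr0 wsym.
split => //.
  move=> x /andP[x0 x1].
  have Pmono (y z : R) : 0 <= y -> y <= z -> P y <= P z.
    by move=> y0 yz; apply: (is_derive_ge0_le dP yz) => t /andP[yt _]; apply: Z_ge0; lra.
  have Ph : h <= P (1 / 2).
    (* The primitive of the lower bound (z - 1/2 + d/2)/eta for Z, which is used where it is
       nonnegative, on [1/2 - d/2, 1/2]. *)
    pose q z := (z - 1 / 2 + d / 2) ^+ 2 / (2 * eta).
    have dq (z : R) : is_derive z 1 q ((z - 1 / 2 + d / 2) / eta).
      have := is_derive_mulf (is_derive_expf 2 (is_derive_addf (is_derive_subf (is_derive_idf z)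
        (is_derive_cstf (1 / 2) z)) (is_derive_cstf (d / 2) z))) (is_derive_cstf ((2 * eta)^-1) z).
      by move=> /is_derive_congr; apply; field; exact: lt0r_neq0.
    have hd : 1 / 2 - d / 2 <= 1 / 2 by lra.
    have : P (1 / 2 - d / 2) - q (1 / 2 - d / 2) <= P (1 / 2) - q (1 / 2).
      apply: (@is_derive_ge0_le (fun z => P z - q z) (fun z => Z z - (z - 1 / 2 + d / 2) / eta)) => //.
      move=> t _; rewrite subr_ge0 ler_pdivrMr//.
      have := Zlow t; rewrite kL; lra.
    have -> : q (1 / 2 - d / 2) = 0 by rewrite /q; ring.
    have -> : q (1 / 2) = h.
      by rewrite /q /eta; field; rewrite !lt0r_neq0.
    have : P 0 <= P (1 / 2 - d / 2) by apply: Pmono; lra.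
    by rewrite P0; lra.
  pose z := 1 / 2 - x.
  have z0 : 0 <= z by rewrite /z; lra.
  have zx : z = 1 / 2 - x by [].
  have zh : z <= 1 / 2 by rewrite /z; lra.
  have cPs a b : {within `[a, b], continuous P} by exact: continuous_subspaceT.
  (* Two mean values of the nondecreasing Z give the convexity inequality P(z) <= 2 z P(1/2); w
     therefore lies above its chord on [0,1/2]. *)
  have [a] := MVT_segment z0 (fun t _ => dP t) (cPs _ _).
  rewrite in_itv/= => /andP[a0 az]; rewrite P0 !subr0 => ea.
  have [b] := MVT_segment zh (fun t _ => dP t) (cPs _ _).
  rewrite in_itv/= => /andP[zb bh] eb.
  have Zab : Z a <= Z b by apply: Zmono; exact: le_trans zb.
  have Pz : P z <= 2 * z * P (1 / 2).
    have -> : P (1 / 2) = Z b * (1 / 2 - z) + Z a * z by rewrite -eb -ea subrK.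
    have t0 : 0 <= z * (1 / 2 - z) by rewrite mulr_ge0// subr_ge0.
    have := ler_wpM2l t0 Zab; rewrite ea; lra.
  rewrite /w -zx; have : 2 * x * h <= 2 * x * P (1 / 2) by rewrite ler_wpM2l// mulr_ge0.
  have -> : 2 * x * P (1 / 2) = P (1 / 2) - 2 * z * P (1 / 2) by rewrite zx; field.
  lra.
have [LU _ aeU] := weak_derivativeP (L2_continuous cU) w1.
have [Lv _ aev] := weak_derivativeP (L2_continuous cv) w2.
rewrite (energyE LU Lv (L2_continuous cv) (measurable_continuous cU) aev aeU) lee_fin.
apply: le_trans ke.
have cE : continuous (fun x => v x ^+ 2 * gw (U x) ^+ 2).
  apply: continuous_mulf; apply: continuous_expf => //.
  exact: (continuous_compf gw U (@continuous_gw R) cU).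
have iE := continuous_integrable_itv 0 1 cE.
rewrite (Rintegral_oo_eq_cc iE).
have -> : kap ^- 2 = \int[mu]_(x in `[0, 1]) (kap ^- 2).
  have dk (x : R) : is_derive x 1 (fun x => kap ^- 2 * x) (kap ^- 2).
    have := is_derive_scalef (kap ^- 2) (is_derive_idf x).
    by move=> /is_derive_congr; apply; rewrite mulr1.
  by rewrite (Rintegral_FTC2 ler01 (@continuous_cstf R (kap ^- 2)) dk) mulr1 mulr0 subr0.
apply: (le_Rintegral (measurable_itvR _) iE).
  by apply: continuous_integrable_itv; exact: continuous_cstf.
move=> x _; rewrite /v sqrrN -exprMn -exprVn lerXn2r ?nnegrE ?mulr_ge0 ?invr_ge0 ?gw_ge0//.
- by rewrite ltW.
- by rewrite ltW.
(* Here |w''| g(w') = g(w')/(kap g(w') + eta) <= 1/kap. *)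
rewrite /dZf /U mulrC ler_pdivrMr// mulrDr mulrA mulVf ?mul1r ?gt_eqF//.
by rewrite lerDl; apply: mulr_ge0; rewrite ?invr_ge0; exact: ltW.
Qed.

End Competitor.

(** * The obstacle and the conclusion *)

Section Assembly.
Context {R : realType}.

(** The cone lies below the tent with the same apex that vanishes at 0 and 1, since s (1/2 - x) >= 0
    on the left half; the parameter s then disappears from the argument. *)
Lemma symmetric_cone_sup (psi : R -> R) : symmetric_cone psi ->
  exists2 h : R, 0 < h &
  [/\ forall x : R, 0 <= x <= 1 / 2 -> psi x <= 2 * x * h,
      forall x : R, 1 / 2 <= x <= 1 -> psi x <= 2 * (1 - x) * h,
      psi (1 / 2) = h &
      (ereal_sup [set (psi x)%:E | x in `]0%R, 1%R[] <= h%:E)%E].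
Proof.
move=> [h [s [h0 /andP[s0 s1] psi1 psi2]]]; exists h => //.
have d0 : 0 < 1 / 2 - s by rewrite subr_gt0.
have cone (y : R) : 0 <= y <= 1 / 2 -> h / (1 / 2 - s) * (y - s) <= 2 * y * h.
  move=> /andP[y0 y1]; rewrite mulrAC ler_pdivrMr// [2 * y * h]mulrC -mulrA ler_wpM2l ?(ltW h0)//.
  have : 0 <= s * (1 / 2 - y) by rewrite mulr_ge0 ?subr_ge0// ltW.
  lra.
have p1 (x : R) : 0 <= x <= 1 / 2 -> psi x <= 2 * x * h.
  by move=> x01; rewrite psi1// cone.
have p2 (x : R) : 1 / 2 <= x <= 1 -> psi x <= 2 * (1 - x) * h.
  move=> x01; rewrite psi2// (_ : 1 - s - x = 1 - x - s); last by ring.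
  by apply: cone; lra.
split => //.
  rewrite psi1; last by apply/andP; split; lra.
  by rewrite divfK// gt_eqF.
apply: ge_ereal_sup => _ [x /= + <-]; rewrite in_itv/= => /andP[x0 x1]; rewrite lee_fin.
have [xh|xh] := leP x (1 / 2).
  apply: (le_trans (p1 x _)); first by rewrite (ltW x0).
  by rewrite ler_piMl ?(ltW h0)//; lra.
apply: (le_trans (p2 x _)); first by rewrite !ltW.
by rewrite ler_piMl ?(ltW h0)//; lra.
Qed.

End Assembly.

Unset Implicit Arguments.

Theorem theorem1p1 (R : realType) (psi : R -> R) :
  symmetric_cone psi ->
  (ereal_sup [set y%:E | y in
     [set y : R | exists A : R, 0 < A /\
        y%:C = (1 / 3 * A)%:C * (HYP2F1 1 (3 / 2) (7 / 4) (- A ^+ 2)%:C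
                                 / HYP2F1 (1 / 2) 1 (3 / 4) (- A ^+ 2)%:C)]%R]
   < ereal_sup [set (psi x)%:E | x in `]0%R, 1%R[])%E ->
  ~ exists2 u, admissible psi u &
      energy u = ereal_inf [set energy w | w in admissible psi].
Proof.
move=> /symmetric_cone_sup[h h0 [psi1 psi2 psih suph]] sup_lt [u [Wu cu u0 u1 upsi] Eu].
have L0 : (0 : R) < half_length by exact: half_length_gt0.
have hL : 1 < h * half_length.
  have := le_lt_trans hyp_ratio_sup (lt_le_trans sup_lt suph).
  by rewrite lte_fin -div1r ltr_pdivrMr.
have half01 : 0 <= (1 / 2 : R) <= 1 by lra.
have hu : h <= u (1 / 2) by rewrite -psih; exact: upsi.
have low := energy_lower_bound Wu cu u0 u1 half01 hu hL.
(* The energy of u is an extended real: if it is finite, e is the midpoint between it and c^2, and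
   if it is infinite, c^2 + 1 serves. *)
have [e ce eu] : exists2 e : R, (2 * half_length) ^+ 2 < e & (e%:E < energy u)%E.
  case: (energy u) low => [r| |//].
    rewrite lte_fin => lt; exists (((2 * half_length) ^+ 2 + r) / 2); first lra.
    by rewrite lte_fin; lra.
  by exists ((2 * half_length) ^+ 2 + 1); rewrite ?ltry//; lra.
have [w [Ww cw w0 w1 [wsym wge Ew]]] := competitor h0 ce.
have aw : admissible psi w.
  split => //; first exact: continuous_subspaceT.
  move=> x /andP[x0 x1]; have [xh|xh] := leP x (1 / 2).
    by apply: (le_trans (psi1 x _)); [rewrite x0|apply: wge; rewrite x0].
  apply: (le_trans (psi2 x _)); first by rewrite (ltW xh).
  by rewrite -wsym; apply: wge; apply/andP; split; lra.
have : (energy u <= energy w)%E by rewrite Eu; apply: ereal_inf_lbound; exists w.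
by move=> /(lt_le_trans eu)/lt_le_trans-/(_ _ Ew); rewrite ltxx.
Qed.
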